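(* Let $d,m\in\mathbb{N}$, $d,m\ge 1$, and let $\mathsf{f}=\{f_1,\dots,f_m\}$ be a finite set of polynomials $f_j\in\mathbb{R}[x_1,\dots,x_d]$ which generate the polynomial algebra $\mathbb{R}[x_1,\dots,x_d]$ (as a unital $\mathbb{R}$-algebra). Suppose that $L:\mathbb{R}[x_1,\dots,x_d]\to\mathbb{R}$ is an $\mathbb{R}$-linear functional satisfying $$L(p^2)\ge 0\quad\text{and}\quad L(f_jp^2)\ge 0\qquad\text{for all } p\in\mathbb{R}[x_1,\dots,x_d],\ j=1,\dots,m,$$ and $$\sum_{n=1}^\infty L(f_j^{n})^{-1/(2n)}=+\infty\qquad\text{for } j=1,\dots,m.$$ Then $L$ is a moment functional, it has a unique representing measure (on $\mathbb{R}^d$), and this measure is supported on the semi-algebraic set $$\mathcal{K}(\mathsf{f}):=\{x\in\mathbb{R}^d: f_1(x)\ge 0,\dots,f_m(x)\ge 0\}.$$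
   Context: Radon measures are nonnegative. A Radon measure $\mu$ on $\mathbb{R}^d$ is a representing measure of a linear functional $L$ on $\mathbb{R}[x_1,\dots,x_d]$ if every polynomial $p\in\mathbb{R}[x_1,\dots,x_d]$ is $\mu$-integrable and $L(p)=\int_{\mathbb{R}^d}p(x)\,d\mu(x)$. $L$ is called a moment functional if it has a representing measure on $\mathbb{R}^d$. Under the positivity hypotheses one has $L(f_j^n)\ge 0$ for all $n$; in the divergence condition the convention $0^{-1/(2n)}=+\infty$ is used (so the series is $+\infty$ if some $L(f_j^n)=0$). *)

(* Defs.v *)
From HB Require Import structures.
From mathcomp Require Import all_boot all_order all_algebra.
From mathcomp Require Import all_classical all_reals all_analysis.
(* The notations of mpoly clash with those of MathComp-Analysis. *)
From mathcomp Require Import -(notations) mpoly.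

Set Implicit Arguments.
Unset Strict Implicit.
Unset Printing Implicit Defensive.
Import Order.TTheory GRing.Theory Num.Theory numFieldNormedType.Exports.

Local Open Scope classical_set_scope.
Local Open Scope ring_scope.
Local Open Scope ereal_scope.

Notation rpoly R d := (mpoly d R) (only parsing).

Notation borelRn R d := (g_sigma_algebraType (@open 'rV[R]_d)) (only parsing).

Definition polyfun (R : realType) (d : nat) (p : rpoly R d) (x : 'rV[R]_d) : R :=
  meval (fun i => x ord0 i) p.

(* The smallest unital subalgebra containing the f_j is everything.  Quantifying
   over boolean predicates loses no subset: boolp reflects any Prop in bool. *)
Definition generates_algebra (R : realType) (d m : nat)
    (f : 'I_m -> rpoly R d) : Prop :=
  forall S : {pred rpoly R d}, GRing.subalg_closed S ->
    (forall j, f j \in S) -> forall p, p \in S.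

(* A Borel measure (nonnegative by construction) that is finite on compact sets
   and inner regular. *)
Definition is_radon (R : realType) (d : nat)
    (mu : {measure set (borelRn R d) -> \bar R}) : Prop :=
  (forall K : set 'rV[R]_d, compact K -> mu K < +oo) /\
  (forall A : set (borelRn R d), measurable A ->
     mu A = ereal_sup [set mu K | K in [set K : set 'rV[R]_d |
                                          compact K /\ K `<=` A]]).

Definition representing_measure (R : realType) (d : nat)
    (L : {scalar rpoly R d}) (mu : {measure set (borelRn R d) -> \bar R}) : Prop :=
  [/\ is_radon mu,
      forall p, mu.-integrable setT (fun x => (polyfun p x)%:E) &
      forall p, (L p)%:E = \int[mu]_x (polyfun p x)%:E].

Definition moment_functional (R : realType) (d : nat)
    (L : {scalar rpoly R d}) : Prop :=
  exists mu : {measure set (borelRn R d) -> \bar R}, representing_measure L mu.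

Definition semialgK (R : realType) (d m : nat) (f : 'I_m -> rpoly R d)
    : set 'rV[R]_d :=
  [set x | forall j, (0 <= polyfun (f j) x)%R].

(* Meaningful for Borel A; it is used for the closed set semialgK f. *)
Definition supported_on (R : realType) (d : nat)
    (mu : {measure set (borelRn R d) -> \bar R}) (A : set 'rV[R]_d) : Prop :=
  mu (~` A) = 0.

(* a ^ (-1/(2n)) for a >= 0 and n >= 1, with the convention 0 ^ (-1/(2n)) = +oo
   (whereas powR 0 r = 0 for r <> 0). *)
Definition carleman_term (R : realType) (a : R) (n : nat) : \bar R :=
  if a == 0%R then +oo else (a `^ (- ((2 * n)%:R)^-1))%:E.

(* Main.v *)
Require Import Defs.
From HB Require Import structures.
From mathcomp Require Import all_boot all_order all_algebra.
From mathcomp Require Import ring lra zify.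
From mathcomp Require Import all_classical all_reals all_analysis measurable_realfun.
From mathcomp Require Import -(notations) mpoly.

Set Implicit Arguments.
Unset Strict Implicit.
Unset Printing Implicit Defensive.
Import Order.TTheory GRing.Theory Num.Theory numFieldNormedType.Exports.

Local Open Scope classical_set_scope.
Local Open Scope ring_scope.

(** Write ||q|| for the square root of L (q^2).  The proof rests on one density
    property: [dense_mul L e] says that the multiples of the polynomial e are
    dense for all the seminorms q |-> ||w q||, w a polynomial.  It replaces the
    essential self-adjointness of multiplication operators in the usual
    functional-analytic argument; no Hilbert space completion is formed.

    Density from the divergence condition.  Fix w and c > 0, and put
    Lam P = L (w^2 (1 + f) P(f)) for a univariate P.  Both Lam (P^2) and
    Lam (X P^2) are nonnegative, and the orthogonal polynomials of Lam and of
    X Lam, interleaved, satisfy a two-term recurrence which at the point -c, up to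
    signs of the values, has positive coefficients.  If no polynomial with value 1 at -c had a small
    norm, the Christoffel sums at -c would stay bounded, and Carleman's
    inequality would bound the sum of the Lam (X^n)^(-1/(2n)), hence that of the
    L (f^n)^(-1/(2n)).  So the multiples of c + f are dense
    ([stieltjes_dichotomy], [dense_mul_shift]).  A contraction argument in which
    L (f p^2) >= 0 enters once more passes from c + f to quadratic polynomials
    in f, in particular to 1 + f^2 and 1 + (1 + f)^2.

    Existence.  Let F_i run through the f_j and the 1 + f_j.  The squares
    g_i = F_i^2 still generate the algebra, since
    f = ((1 + f)^2 - f^2 - 1) / 2, and E = prod_i (1 + g_i) has dense multiples.
    For a large N and a Y with Y^2 E^(N-D) close to 1, the expansion of Y^2 E^N
    into monomials in the g_i spreads L over a grid of points with nonnegative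
    weights, because each weight is a multiple of a value of L at a square.  As in
    Bernstein's proof of the Weierstrass theorem, the moments of these discrete
    measures up to any given degree converge to those of L
    ([discrete_approximation]).  A limit is found by coding points of the orthant
    by binary words: the masses of all words converge along an ultrafilter, and a
    consistent family of masses is realized by nested intervals in [0, c[ with Lebesgue measure.  This gives functions on
    [0, c[ with the moments of L ([moment_realization]); the polynomials that
    express the coordinates through the g_i push Lebesgue measure forward to
    R^d, where every finite Borel measure is Radon ([finite_borel_radon]).

    Uniqueness and support.  Let mu represent L, or be a sum of two such
    measures.  Density of the multiples of 1 + F_i^2 makes 1 / (1 + F_i^2) a
    limit of polynomials in L^2(w^2 mu) for every polynomial w.  Bounded
    functions with this approximation property are closed under products and
    bounded pointwise limits, and therefore contain all indicators of Borel sets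
    ([borel_dense_sets]).  Polynomials close to the indicator of A for mu + nu
    give mu A = nu A.  Polynomials p close to the indicator of the set where
    f_j < 0 give, through L (f_j p^2) >= 0, that the integral of f_j over that
    set is nonnegative, so the set is null. *)

(** * Carleman's inequality *)

(** The elementary half of Stirling's formula; it follows from
    (1 + 1/n)^n <= e by induction. *)
Lemma expnn_le_fact (R : realType) n : n%:R ^+ n <= expR 1 ^+ n * n`!%:R :> R.
Proof.
elim: n => [|[|n] IH]; first by rewrite !expr0 fact0 mulr1.
  by rewrite !expr1 mulr1; have := expR_ge1Dx (1 : R); lra.
set m := n.+1 in IH *.
have m0 : 0 < m%:R :> R by rewrite ltr0n.
have em : (1 + m%:R^-1) ^+ m <= expR 1 :> R.
  rewrite -[in leRHS](@mulVf _ (m%:R : R)) ?lt0r_neq0// mulrC expRM_natl.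
  by rewrite lerXn2r ?nnegrE ?expR_ge0 ?expR_ge1Dx// addr_ge0// invr_ge0 ltW.
have -> : m.+1%:R ^+ m.+1 = m.+1%:R * (m%:R ^+ m * (1 + m%:R^-1) ^+ m) :> R.
  by rewrite exprS -exprMn mulrDr mulr1 mulfV ?lt0r_neq0// -natr1.
rewrite factS natrM exprS.
rewrite [leRHS](_ : _ = m.+1%:R * (expR 1 ^+ m * m`!%:R * expR 1)); last by ring.
rewrite ler_wpM2l ?ler0n// ler_pM ?exprn_ge0 ?ler0n//.
Qed.

Lemma powR_invn_le (R : realType) (x r : R) n : (0 < n)%N ->
  0 <= x -> 0 <= r -> x <= r ^+ n -> x `^ n%:R^-1 <= r.
Proof.
move=> n0 x0 r0 xr; have nR : n%:R != 0 :> R by rewrite pnatr_eq0 -lt0n.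
have -> : r = (r ^+ n) `^ n%:R^-1.
  by rewrite -powR_mulrn// -powRrM mulfV// powRr1.
by rewrite ge0_ler_powR ?nnegrE ?invr_ge0 ?ler0n ?exprn_ge0.
Qed.

(** Polya's weighting trick: the arithmetic-geometric inequality is applied to
    the numbers (k+1) a_k, and the factorial this produces is absorbed by
    [expnn_le_fact]. *)
Lemma root_prod_le (R : realType) (a : nat -> R) n : (0 < n)%N ->
  (forall k, 0 <= a k) ->
  (\prod_(k < n) a k) `^ n%:R^-1
    <= expR 1 * (\sum_(k < n) k.+1%:R * a k) / n%:R ^+ 2.
Proof.
move=> n0 a0; have nR : 0 < n%:R :> R by rewrite ltr0n.
set S := \sum_(k < n) _.
have S0 : 0 <= S by apply: sumr_ge0 => k _; rewrite mulr_ge0.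
have agm : n`!%:R * \prod_(k < n) a k <= (S / n%:R) ^+ n.
  have e0 : {in predT, forall k : 'I_n, 0 <= k.+1%:R * a k}.
    by move=> k _; rewrite mulr_ge0.
  have [+ _] := leif_AGM e0; rewrite cardT size_enum_ord big_split/= fact_prod.
  have -> // : \prod_(k < n) (k.+1)%:R = (\prod_(1 <= k < n.+1) k)%:R :> R.
  by rewrite natr_prod big_add1/= big_mkord.
have le1 : \prod_(k < n) a k <= (expR 1 * S / n%:R ^+ 2) ^+ n.
  have f0 : 0 < n`!%:R :> R by rewrite ltr0n fact_gt0.
  rewrite -(ler_pM2l f0) (le_trans agm)//.
  have -> : expR 1 * S / n%:R ^+ 2 = (S / n%:R) * (expR 1 / n%:R) :> R by field; lra.
  rewrite [in leRHS]exprMn [leRHS]mulrCA ler_peMr ?exprn_ge0 ?divr_ge0 ?ler0n//.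
  by rewrite expr_div_n mulrA mulrC ler_pdivlMl ?exprn_gt0// mulr1 mulrC expnn_le_fact.
have r0 : 0 <= expR 1 * S / n%:R ^+ 2.
  by rewrite divr_ge0 ?exprn_ge0 ?mulr_ge0 ?expR_ge0.
by apply: powR_invn_le => //; apply: prodr_ge0 => k _.
Qed.

(** After [root_prod_le] the double sum telescopes, because
    1 / n^2 <= 2 (1/n - 1/(n+1)); the term - 2 S N / (N+1) is what the induction
    needs. *)
Lemma carleman_inequality (R : realType) (a : nat -> R) N :
  (forall k, 0 <= a k) ->
  \sum_(1 <= n < N.+1) (\prod_(k < n) a k) `^ n%:R^-1
    <= 2 * expR 1 * \sum_(k < N) a k.
Proof.
move=> a0; pose S n : R := \sum_(k < n) k.+1%:R * a k.
have S0 n : 0 <= S n by apply: sumr_ge0 => k _; rewrite mulr_ge0.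
suff tele : \sum_(1 <= n < N.+1) S n / n%:R ^+ 2
    <= 2 * \sum_(k < N) a k - 2 * S N / N.+1%:R.
  rewrite mulrAC [leRHS]mulrC.
  apply: (@le_trans _ _ (expR 1 * \sum_(1 <= n < N.+1) S n / n%:R ^+ 2)).
    rewrite mulr_sumr; apply: ler_sum_nat => n /andP[n0 _].
    by rewrite mulrA root_prod_le.
  rewrite ler_wpM2l ?expR_ge0// (le_trans tele)// gerBl.
  by rewrite divr_ge0 ?mulr_ge0.
elim: N => [|N IH]; first by rewrite big_nil big_ord0 /S big_ord0 !mulr0 mul0r subr0.
rewrite big_nat_recr//= [in leRHS]big_ord_recr/=.
apply: le_trans (lerD IH (lexx _)) _.
have -> : S N.+1 = S N + N.+1%:R * a N by rewrite /S big_ord_recr.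
have := a0 N; have := S0 N; move: (a N) (S N) (\sum_(_ < _) _) => x s A s0 x0.
have p1 : 0 < N.+1%:R :> R by rewrite ltr0n.
have -> : N.+2%:R = N.+1%:R + 1 :> R by rewrite -natr1.
have p1' : 1 <= N.+1%:R :> R by rewrite ler1n.
move: (N.+1%:R : R) p1 p1' => p p0 p1.
rewrite -subr_ge0.
have -> : 2 * (A + x) - 2 * (s + p * x) / (p + 1) - (2 * A - 2 * s / p + (s + p * x) / p ^+ 2)
  = (s + p * x) * (p - 1) / (p ^+ 2 * (p + 1)) by field; lra.
have sx : 0 <= s + p * x by rewrite addr_ge0// mulr_ge0// ltW.
by apply: divr_ge0; apply: mulr_ge0; rewrite ?subr_ge0 ?exprn_ge0//; lra.
Qed.

(** * Orthogonal polynomials of a Stieltjes functional *)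

Section StieltjesOrthogonal.
Variables (R : realType) (Lam : {scalar {poly R}}).
Hypothesis Lam_sqr : forall p, 0 <= Lam (p ^+ 2).
Hypothesis Lam_Xsqr : forall p, 0 <= Lam ('X * p ^+ 2).

(** The polynomials orthogonal for Lam are interleaved with those orthogonal
    for the functional p |-> Lam (X p): index n refers to the functional
    p |-> Lam (parity_weight n p), so that indices of the same parity form one
    orthogonal family. *)
Definition parity_weight n : {poly R} := if odd n then 'X else 1.

Lemma parity_weightM n : parity_weight n.+1 * parity_weight n = 'X.
Proof. by rewrite /parity_weight /=; case: (odd n); rewrite ?mul1r ?mulr1. Qed.

Lemma parity_weightMC n : parity_weight n * parity_weight n.+1 = 'X.
Proof. by rewrite mulrC parity_weightM. Qed.

Lemma Lam_parity_weight n p : 0 <= Lam (parity_weight n * p ^+ 2).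
Proof. by rewrite /parity_weight; case: (odd n); rewrite ?mul1r. Qed.

Let wsqnorm n p := Lam (parity_weight n * p ^+ 2).

(** Consecutive pairs carry the two-term recurrence; the coefficient is the
    quotient of norms that makes the next polynomial orthogonal to the lower ones
    of its own parity. *)
Fixpoint orth2 n : {poly R} * {poly R} :=
  if n is n'.+1 then
    let: (p, q) := orth2 n' in (q, parity_weight n * q - (wsqnorm n q / wsqnorm n' p) *: p)
  else (1, 1).

Definition orth n := (orth2 n).1.
Definition orth_sqnorm n := wsqnorm n (orth n).
Definition orth_ratio n := orth_sqnorm n.+1 / orth_sqnorm n.

Lemma orth2E n : orth2 n = (orth n, orth n.+1).
Proof. by rewrite /orth /=; case: (orth2 n). Qed.

Lemma orthSS n : orth n.+2 = parity_weight n.+1 * orth n.+1 - orth_ratio n *: orth n.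
Proof. by rewrite {1}/orth/= orth2E/=. Qed.

Lemma orth_sqnorm_ge0 n : 0 <= orth_sqnorm n.
Proof. exact: Lam_parity_weight. Qed.

Lemma orth_ratio_ge0 n : 0 <= orth_ratio n.
Proof. by rewrite divr_ge0 ?orth_sqnorm_ge0. Qed.

Lemma orth_monic n : (orth n \is monic) && (size (orth n) == n./2.+1).
Proof.
suff: ((orth n \is monic) && (size (orth n) == n./2.+1)) &&
  ((orth n.+1 \is monic) && (size (orth n.+1) == n.+1./2.+1)) by case/andP.
elim: n => [|n /andP[/andP[m0 /eqP s0] /andP[m1 /eqP s1]]].
  by rewrite /orth/= monic1 size_poly1.
rewrite m1 s1 eqxx/= orthSS.
have le0 : (size (- (orth_ratio n *: orth n)) <= n./2.+1)%N.
  by rewrite size_polyN (leq_trans (size_scale_leq _ _))// s0.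
have mp : parity_weight n.+1 * orth n.+1 \is monic.
  by rewrite rpredM// /parity_weight; case: ifP => _; rewrite ?monicX ?monic1.
have sp : size (parity_weight n.+1 * orth n.+1) = n./2.+2.
  have o1n : orth n.+1 != 0 by exact: monic_neq0.
  rewrite /parity_weight /=; case: (boolP (odd n)) => on /=.
    by rewrite mul1r s1 /= uphalf_half on.
  by rewrite mulrC size_mulX// s1 /= uphalf_half (negbTE on).
rewrite monicE lead_coefDl ?sp ?ltnS// size_polyDl ?sp ?ltnS// eqxx andbT.
by rewrite -monicE.
Qed.

Lemma size_orth n : size (orth n) = n./2.+1.
Proof. by have /andP[_ /eqP] := orth_monic n. Qed.

Lemma lead_orth n : (orth n)`_n./2 = 1.
Proof.
by have /andP[/monicP + _] := orth_monic n; rewrite lead_coefE size_orth.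
Qed.

Section Nondegenerate.
Variable m : nat.
Hypothesis orth_sqnorm_neq0 : forall k, (k < m)%N -> orth_sqnorm k != 0.

Let orthog n := forall q : {poly R}, (size q <= n./2)%N ->
  Lam (parity_weight n * orth n * q) = 0.

(** Orthogonality to lower degrees leaves only the leading coefficient. *)
Lemma Lam_orth_lead n (q : {poly R}) : orthog n -> (size q <= n./2.+1)%N ->
  Lam (parity_weight n * orth n * q) = q`_n./2 * orth_sqnorm n.
Proof.
move=> on sq; set a := q`_n./2.
have -> : q = a *: orth n + (q - a *: orth n) by rewrite addrC subrK.
rewrite mulrDr linearD/= -scalerAr linearZ/= on ?addr0.
  by rewrite /orth_sqnorm /wsqnorm expr2 mulrA.
apply/leq_sizeP => j; rewrite leq_eqVlt => /predU1P[<-|jn].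
  by rewrite coefB coefZ lead_orth mulr1 subrr.
rewrite coefB coefZ !nth_default ?mulr0 ?subrr ?size_orth//.
exact: leq_trans sq _.
Qed.

(** Two polynomials of the same parity have degrees differing by one, and
    multiplying by [parity_weight] turns one family into the other, which is why
    a two-term recurrence suffices. *)
Lemma orth_orthogonal n : (n <= m)%N -> orthog n.
Proof.
suff H : (n <= m)%N -> orthog n /\ ((n.+1 <= m)%N -> orthog n.+1).
  by move=> nm; have [] := H nm.
elim: n => [|n IH] nm.
  split=> [q|_ q]; rewrite leqn0 size_poly_eq0 => /eqP ->; by rewrite mulr0 linear0.
have [c0 c1] := IH (ltnW nm); split; first exact: c1.
move=> n2m q sq; rewrite orthSS.
have pp : parity_weight n.+2 = parity_weight n by rewrite /parity_weight /= negbK.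
rewrite pp mulrBr mulrBl linearB/= -!scalerAr -scalerAl linearZ/=.
have sq1 : (size q <= n./2.+1)%N by [].
rewrite (Lam_orth_lead c0 sq1) mulrA parity_weightMC.
have on := orth_sqnorm_neq0 (ltnW n2m : (n < m)%N).
rewrite /= [orth_ratio n * _]mulrCA /orth_ratio divfK//; apply/eqP; rewrite subr_eq0; apply/eqP.
case: (boolP (odd n)) => odn.
  have -> : 'X * orth n.+1 * q = parity_weight n.+1 * orth n.+1 * (q * 'X).
    by rewrite /parity_weight /= odn/= mul1r; ring.
  rewrite (Lam_orth_lead (c1 nm)) ?coefMX /= ?uphalf_half odn//.
  have [->|q0] := eqVneq q 0; first by rewrite mul0r size_poly0.
  by rewrite size_mulX.
have -> : 'X = parity_weight n.+1 by rewrite /parity_weight /= odn.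
by rewrite (Lam_orth_lead (c1 nm)) /= ?uphalf_half (negbTE odn).
Qed.

(** An orthogonal polynomial minimizes the weighted norm among monic
    polynomials of its degree, and X^n is the weighted square of a monomial of
    that degree. *)
Lemma orth_sqnorm_le n : (n <= m)%N -> orth_sqnorm n <= Lam ('X^n).
Proof.
move=> nm; have o := orth_orthogonal nm.
have -> : 'X^n = parity_weight n * ('X^(n./2)) ^+ 2 :> {poly R}.
  rewrite -exprM muln2 /parity_weight -{1}(odd_double_half n) exprD.
  by case: (odd n); rewrite ?expr0 ?expr1.
pose q : {poly R} := 'X^(n./2) - orth n.
have sq : (size q <= n./2)%N.
  apply/leq_sizeP => j; rewrite leq_eqVlt => /predU1P[<-|jn].
    by rewrite coefB lead_orth coefXn eqxx subrr.
  by rewrite coefB coefXn gtn_eqF// nth_default ?subrr ?size_orth.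
have -> : 'X^(n./2) = orth n + q by rewrite addrC subrK.
have -> : parity_weight n * (orth n + q) ^+ 2 =
    parity_weight n * orth n ^+ 2 + parity_weight n * orth n * q + parity_weight n * orth n * q + parity_weight n * q ^+ 2.
  by rewrite sqrrD; ring.
by rewrite !linearD/= o// !addr0 lerDl Lam_parity_weight.
Qed.

Lemma orth_cross j k : (j < k <= m)%N -> odd j = odd k ->
  Lam (parity_weight k * (orth j * orth k)) = 0.
Proof.
move=> /andP[jk km] ojk; rewrite mulrA mulrAC orth_orthogonal// size_orth.
move: jk; rewrite -{1}(odd_double_half j) -{1}(odd_double_half k) ojk ltn_add2l.
by rewrite ltn_double.
Qed.

End Nondegenerate.

Variables (c : R) (c_gt0 : 0 < c).

(** At the point -c, multiplication by the parity weight is, up to sign,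
    multiplication by [abs_step]; after removing the sign (-1)^(n/2) all
    coefficients of the recurrence become positive. *)
Definition abs_step n : R := if odd n then c else 1.

Fixpoint orth_abs2 n : R * R :=
  if n is n'.+1 then
    let: (u, v) := orth_abs2 n' in (v, abs_step n * v + orth_ratio n' * u)
  else (1, 1).

Definition orth_abs n := (orth_abs2 n).1.

Lemma orth_absSS n : orth_abs n.+2 = abs_step n.+1 * orth_abs n.+1 + orth_ratio n * orth_abs n.
Proof.
have E k : orth_abs2 k = (orth_abs k, orth_abs k.+1) by rewrite /orth_abs /=; case: (orth_abs2 k).
by rewrite {1}/orth_abs/= E.
Qed.

Lemma abs_step_gt0 n : 0 < abs_step n.
Proof. by rewrite /abs_step; case: ifP. Qed.

Lemma orth_abs_gt0 n : 0 < orth_abs n.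
Proof.
suff: (0 < orth_abs n) && (0 < orth_abs n.+1) by case/andP.
elim: n => [|n /andP[u0 u1]]; first by rewrite /orth_abs/= ltr01.
by rewrite u1/= orth_absSS ltr_pwDl ?mulr_gt0 ?abs_step_gt0// mulr_ge0 ?orth_ratio_ge0// ltW.
Qed.

Lemma horner_orth n : (orth n).[- c] = (-1) ^+ n./2 * orth_abs n.
Proof.
suff: (orth n).[- c] = (-1) ^+ n./2 * orth_abs n /\
   (orth n.+1).[- c] = (-1) ^+ n.+1./2 * orth_abs n.+1 by case.
elim: n => [|n [u0 u1]].
  by rewrite /orth /orth_abs /= hornerC expr0 mulr1.
split=> //; rewrite orthSS hornerD hornerN hornerM hornerZ u0 u1 orth_absSS.
rewrite /parity_weight /abs_step /= uphalf_half; case: (odd n) => /=; rewrite ?hornerC ?hornerX.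
  by rewrite add1n exprS; ring.
by rewrite add0n exprS; ring.
Qed.

Lemma horner_orth_sqr n : (orth n).[- c] ^+ 2 = orth_abs n ^+ 2.
Proof. by rewrite horner_orth exprMn sqrr_sign mul1r. Qed.

Section Infinite.
Hypothesis orth_sqnorm_gt0 : forall n, 0 < orth_sqnorm n.

(** The product of two consecutive values dominates the previous one times
    [orth_ratio], and these ratios are exactly the increments of the norms. *)
Lemma orth_abs_growth n : (orth_sqnorm 0)^-1 <= orth_abs n.+1 * orth_abs n / orth_sqnorm n.
Proof.
elim: n => [|n IH]; first by rewrite /orth_abs/= mul1r mul1r.
rewrite (le_trans IH)// orth_absSS mulrDl mulrDl -[leLHS]add0r lerD//.
  by rewrite divr_ge0 ?mulr_ge0 ?ltW ?abs_step_gt0 ?orth_abs_gt0 ?orth_sqnorm_gt0.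
rewrite /orth_ratio [leRHS](_ : _ = orth_abs n.+1 * orth_abs n / orth_sqnorm n)//.
by field; rewrite !gt_eqF ?orth_sqnorm_gt0.
Qed.

(** By the arithmetic-geometric inequality applied to [orth_abs_growth]: the
    Christoffel sums at -c control the square roots of ratios of consecutive
    norms, the quantities to which Carleman's inequality applies. *)
Lemma sqrt_ratio_le n : Num.sqrt (orth_sqnorm n / orth_sqnorm n.+1)
  <= orth_sqnorm 0 / 2 * (orth_abs n ^+ 2 / orth_sqnorm n + orth_abs n.+1 ^+ 2 / orth_sqnorm n.+1).
Proof.
have h0 := orth_sqnorm_gt0 n; have h1 := orth_sqnorm_gt0 n.+1; have g := orth_abs_growth n.
have hh := orth_sqnorm_gt0 0.
set x := Num.sqrt (orth_sqnorm n); set y := Num.sqrt (orth_sqnorm n.+1).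
have x0 : 0 < x by rewrite sqrtr_gt0.
have y0 : 0 < y by rewrite sqrtr_gt0.
have xE : orth_sqnorm n = x ^+ 2 by rewrite sqr_sqrtr// ltW.
have yE : orth_sqnorm n.+1 = y ^+ 2 by rewrite sqr_sqrtr// ltW.
have -> : Num.sqrt (orth_sqnorm n / orth_sqnorm n.+1) = x / y.
  by rewrite sqrtrM ?ltW// sqrtrV ?ltW.
rewrite yE xE in g *.
have step : (orth_sqnorm 0)^-1 * (x / y) <= orth_abs n.+1 * orth_abs n / (x * y).
  have -> : orth_abs n.+1 * orth_abs n / (x * y) = (orth_abs n.+1 * orth_abs n / x ^+ 2) * (x / y).
    by field; rewrite !gt_eqF.
  by rewrite ler_wpM2r// divr_ge0 ?ltW.
rewrite -(ler_pM2l (_ : 0 < (orth_sqnorm 0)^-1)) ?invr_gt0// (le_trans step)//.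
rewrite -subr_ge0.
have -> : (orth_sqnorm 0)^-1 * (orth_sqnorm 0 / 2 * (orth_abs n ^+ 2 / x ^+ 2 + orth_abs n.+1 ^+ 2 / y ^+ 2))
  - orth_abs n.+1 * orth_abs n / (x * y) = (orth_abs n / x - orth_abs n.+1 / y) ^+ 2 / 2.
  by field; rewrite !gt_eqF.
by rewrite divr_ge0// sqr_ge0.
Qed.

(** The reproducing (Christoffel-Darboux) kernel at -c of one parity family. *)
Definition repro_kernel (par : bool) n :=
  \sum_(k < n | odd k == par) ((orth k).[- c] / orth_sqnorm k) *: orth k.

Lemma horner_repro_kernel par n :
  (repro_kernel par n).[- c] = \sum_(k < n | odd k == par) orth_abs k ^+ 2 / orth_sqnorm k.
Proof.
rewrite /repro_kernel horner_sum; apply: eq_bigr => k _.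
by rewrite hornerZ mulrAC -expr2 horner_orth_sqr.
Qed.

Lemma Lam_repro_kernel (par : bool) n :
  Lam (parity_weight par * repro_kernel par n ^+ 2) = (repro_kernel par n).[- c].
Proof.
have cross j k : odd j = par -> odd k = par -> j != k ->
    Lam (parity_weight par * (orth j * orth k)) = 0.
  move=> oj ok; have pj : parity_weight par = parity_weight j by rewrite /parity_weight oj; case: (par).
  have pk : parity_weight par = parity_weight k by rewrite /parity_weight ok; case: (par).
  have nz i : (i < (maxn j k))%N -> orth_sqnorm i != 0 by rewrite gt_eqF.
  rewrite neq_ltn => /orP[jk|kj].
    by rewrite pk (orth_cross nz)// ?jk ?leq_maxr// oj ok.
  by rewrite [orth j * _]mulrC pj (orth_cross nz)// ?kj ?leq_maxl// oj ok.
rewrite horner_repro_kernel {1}/repro_kernel expr2 mulr_suml mulr_sumr linear_sum/=.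
apply: eq_bigr => k /eqP ok; rewrite mulr_sumr mulr_sumr linear_sum/=.
rewrite (bigD1 k) ?ok//= big1 ?addr0 => [|j /andP[/eqP oj jk]].
  rewrite -scalerAl -!scalerAr !linearZ/= -expr2.
  have -> : parity_weight par = parity_weight k by rewrite /parity_weight ok; case: (par).
  rewrite -[Lam _]/(orth_sqnorm k) -horner_orth_sqr.
  by field; rewrite gt_eqF ?orth_sqnorm_gt0.
rewrite -scalerAl -!scalerAr !linearZ/=.
by rewrite cross ?mulr0// eq_sym.
Qed.

End Infinite.

(** If some norm vanishes, the corresponding orthogonal polynomial already has
    norm 0 and a nonzero value at -c.  Otherwise the Christoffel sums are
    unbounded, for the geometric means of the ratios of norms are at least the
    terms of the divergent series and Carleman's inequality bounds their sum by
    a multiple of the Christoffel sum; one of the two parities has an unbounded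
    sum, and its normalized reproducing kernel has arbitrarily small norm. *)
Lemma stieltjes_dichotomy :
  ((forall n, 0 < Lam 'X^n) -> forall B, exists n,
     B < \sum_(1 <= k < n.+1) Num.sqrt (Lam 1 / Lam 'X^k) `^ k%:R^-1) ->
  forall eps, 0 < eps -> exists p : {poly R}, p.[- c] = 1 /\
    (Lam (p ^+ 2) < eps \/ Lam ('X * p ^+ 2) < eps).
Proof.
move=> div eps eps0.
suff [b [p [pc Lp]]] : exists (b : bool) (p : {poly R}), p.[- c] != 0 /\
    Lam (parity_weight b * p ^+ 2) < eps * p.[- c] ^+ 2.
  exists (p.[- c]^-1 *: p); split; first by rewrite hornerZ mulVf.
  have p2 : 0 < p.[- c] ^+ 2 by rewrite exprn_even_gt0.
  have LE q : Lam (q * (p.[- c]^-1 *: p) ^+ 2) = (p.[- c] ^+ 2)^-1 * Lam (q * p ^+ 2).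
    by rewrite exprZn -scalerAr linearZ/= exprVn.
  have scaled q : Lam (q * p ^+ 2) < eps * p.[- c] ^+ 2 ->
      Lam (q * (p.[- c]^-1 *: p) ^+ 2) < eps.
    by move=> ?; rewrite LE ltr_pdivrMl// [ltRHS]mulrC.
  move: Lp; rewrite /parity_weight; case: b => /= /scaled; rewrite ?mul1r; by [right|left].
have [[n hn]|nex] := pselect (exists n, orth_sqnorm n = 0).
  exists (odd n), (orth n); rewrite horner_orth_sqr; split.
    by rewrite horner_orth mulf_neq0 ?signr_eq0// gt_eqF ?orth_abs_gt0.
  have -> : parity_weight (odd n) = parity_weight n by rewrite /parity_weight; case: (odd n).
  by rewrite -/(wsqnorm n _) -/(orth_sqnorm n) hn mulr_gt0// exprn_gt0// orth_abs_gt0.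
have h0 n : 0 < orth_sqnorm n.
  by rewrite lt0r orth_sqnorm_ge0 andbT; apply/negP => /eqP hn; apply: nex; exists n.
have hle n : orth_sqnorm n <= Lam 'X^n.
  by apply: (@orth_sqnorm_le n) => // k _; rewrite gt_eqF.
have L0 n : 0 < Lam 'X^n by exact: lt_le_trans (h0 n) (hle n).
have hh : orth_sqnorm 0 = Lam 1.
  by rewrite /orth_sqnorm /wsqnorm /parity_weight /orth /= expr1n mulr1.
(* The product of the first n numbers a k telescopes, so their geometric mean
   is the n-th root of sqrt (Lam 1 / orth_sqnorm n). *)
pose a k := Num.sqrt (orth_sqnorm k / orth_sqnorm k.+1).
pose s (P : pred nat) n := \sum_(k < n | P k) orth_abs k ^+ 2 / orth_sqnorm k.
have t0 k : 0 <= orth_abs k ^+ 2 / orth_sqnorm k.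
  by rewrite divr_ge0 ?exprn_ge0 ?orth_sqnorm_ge0// ltW// orth_abs_gt0.
have proda n : \prod_(k < n) a k = Num.sqrt (orth_sqnorm 0 / orth_sqnorm n).
  elim: n => [|n IH]; first by rewrite big_ord0 mulfV ?sqrtr1// gt_eqF.
  rewrite big_ord_recr/= IH -sqrtrM; last by rewrite divr_ge0 ?orth_sqnorm_ge0.
  congr (Num.sqrt _); field; by rewrite !gt_eqF ?h0.
have suma n : \sum_(k < n) a k <= orth_sqnorm 0 * s predT n.+1.
  rewrite (@le_trans _ _ (\sum_(k < n) orth_sqnorm 0 / 2 *
     (orth_abs k ^+ 2 / orth_sqnorm k + orth_abs k.+1 ^+ 2 / orth_sqnorm k.+1)))//.
    by apply: ler_sum => k _; exact: sqrt_ratio_le.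
  rewrite -mulr_sumr big_split/= -mulrA ler_wpM2l ?orth_sqnorm_ge0//.
  rewrite ler_pdivrMl// [leRHS]mulrC mulr_natr mulr2n lerD//.
    by rewrite /s big_ord_recr/= lerDl.
  by rewrite /s big_ord_recl/= lerDr.
(* The bound is chosen so that the total Christoffel sum exceeds 2 / eps, and
   hence one of the two parities exceeds 1 / eps. *)
pose B := 2 * expR 1 * (orth_sqnorm 0 * (2 / eps)).
have [n Bn] := div L0 B.
have : B < 2 * expR 1 * (orth_sqnorm 0 * s predT n.+1).
  apply: lt_le_trans Bn _; apply: (@le_trans _ _ (2 * expR 1 * \sum_(k < n) a k)).
    apply: le_trans (carleman_inequality _ _); last by move=> k; exact: sqrtr_ge0.
    apply: ler_sum_nat => k /andP[k0 _]; rewrite proda -hh.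
    rewrite ge0_ler_powR ?nnegrE ?sqrtr_ge0 ?invr_ge0//.
    by rewrite ler_wsqrtr// ler_wpM2l ?orth_sqnorm_ge0// lef_pV2 ?posrE.
  by rewrite ler_wpM2l ?suma// mulr_ge0 ?expR_ge0.
rewrite ltr_pM2l ?mulr_gt0 ?expR_gt0// ltr_pM2l// => sn.
have [b sb] : exists b, eps^-1 < s (fun k => odd k == b) n.+1.
  have sE : s predT n.+1 = s (fun k => odd k == true) n.+1 + s (fun k => odd k == false) n.+1.
    rewrite /s (bigID (fun k : 'I__ => odd k))/=; congr (_ + _); apply: eq_bigl => k.
      by rewrite eqb_id.
    by rewrite eqbF_neg.
  have [?|t1] := ltP eps^-1 (s (fun k => odd k == true) n.+1); first by exists true.
  exists false; rewrite ltNge; apply/negP => t2.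
  by move: sn; rewrite sE mulrDl mul1r ltNge lerD.
have k0 : 0 < s (fun k => odd k == b) n.+1 by apply: lt_trans sb; rewrite invr_gt0.
exists b, (repro_kernel b n.+1); rewrite Lam_repro_kernel// horner_repro_kernel; split.
  by rewrite gt_eqF.
by rewrite expr2 mulrA ltr_pMl// -ltr_pdivrMl// mulr1.
Qed.

End StieltjesOrthogonal.

(** * Dense multipliers of a positive functional *)

Section CauchySchwarz.
Variables (R : realType) (A : comAlgType R) (L : {scalar A}).
Hypothesis L_sqr : forall p, 0 <= L (p ^+ 2).

Lemma L_alg k p : L (k%:A * p) = k * L p.
Proof. by rewrite mulr_algl linearZ. Qed.

Lemma L_natl n p : L (n%:R * p) = n%:R * L p.
Proof. by rewrite mulr_natl raddfMn mulr_natl. Qed.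

Lemma L_cauchy_schwarz p q : L (p * q) ^+ 2 <= L (p ^+ 2) * L (q ^+ 2).
Proof.
have key t : 0 <= L (p ^+ 2) + 2 * t * L (p * q) + t ^+ 2 * L (q ^+ 2).
  have := L_sqr (p + t *: q).
  rewrite sqrrD exprZn -scalerAr -scaler_nat !linearD/= !linearZ/=.
  by rewrite mulrA.
have [q0|q0] := eqVneq (L (q ^+ 2)) 0.
  rewrite q0 mulr0; have [->|pq] := eqVneq (L (p * q)) 0; first by rewrite expr0n.
  have := key (- (L (p ^+ 2) + 1) / (2 * L (p * q))).
  rewrite q0 mulr0 addr0 [X in _ + X](_ : _ = - (L (p ^+ 2) + 1)); last by field.
  by rewrite opprD addrA subrr add0r oppr_ge0 ler10.
have q1 : 0 < L (q ^+ 2) by rewrite lt0r q0 L_sqr.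
have := key (- L (p * q) / L (q ^+ 2)).
rewrite [X in 0 <= X -> _](_ : _ = L (p ^+ 2) - L (p * q) ^+ 2 / L (q ^+ 2)).
  by rewrite subr_ge0 ler_pdivrMr.
by field.
Qed.

(** A triangle inequality without square roots; the free parameter t keeps the
    loss on one summand as small as desired. *)
Lemma L_sqrD p q (t : R) : 0 < t ->
  L ((p + q) ^+ 2) <= (1 + t) * L (p ^+ 2) + (1 + t^-1) * L (q ^+ 2).
Proof.
move=> t0; have := L_sqr (t%:A * p - q).
have -> : (t%:A * p - q) ^+ 2 =
  t%:A * (t%:A * p ^+ 2) - 2%:R * (t%:A * (p * q)) + q ^+ 2 by ring.
have -> : (p + q) ^+ 2 = p ^+ 2 + 2%:R * (p * q) + q ^+ 2 by ring.
rewrite !linearD/= linearN/= !L_natl !L_alg.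
move: (L (p ^+ 2)) (L (p * q)) (L (q ^+ 2)) => a b d h; rewrite -subr_ge0.
rewrite [X in 0 <= X](_ : _ = t^-1 * (t * (t * a) - 2 * (t * b) + d)).
  by rewrite mulr_ge0// invr_ge0 ltW.
by field; rewrite gt_eqF.
Qed.

End CauchySchwarz.

(** Written as a sum of nonnegative terms for x = c and y = f, this identity
    shows that (x + y)^2 dominates 4 x y in the norm of L. *)
Lemma quartic_split (B : comNzRingType) (x y u : B) :
  ((x + y) ^+ 2 * u) ^+ 2 = 16%:R * (x ^+ 2 * (y * u) ^+ 2)
    + x ^+ 2 * ((x - y) * u) ^+ 2 + 6%:R * (x * (y * ((x - y) * u) ^+ 2))
    + (y * ((x - y) * u)) ^+ 2.
Proof. ring. Qed.

Section Density.
Variables (R : realType) (A : comAlgType R) (L : {scalar A}).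
Hypothesis L_sqr : forall p, 0 <= L (p ^+ 2).

(** The image of multiplication by e is dense for every weighted seminorm; it
    is enough to approximate the constant 1, all weights being allowed. *)
Definition dense_mul (e : A) := forall (w : A) (eps : R), 0 < eps ->
  exists p, L ((w * (1 - e * p)) ^+ 2) < eps.

Lemma dense_mul1 : dense_mul 1.
Proof. by move=> w eps e0; exists 1; rewrite mulr1 subrr mulr0 expr0n linear0. Qed.

Lemma dense_mulM e1 e2 : dense_mul e1 -> dense_mul e2 -> dense_mul (e1 * e2).
Proof.
move=> d1 d2 w eps e0.
have e4 : 0 < eps / 4 by rewrite divr_gt0.
have [p1 h1] := d1 w _ e4; have [p2 h2] := d2 (w * e1 * p1) _ e4.
exists (p1 * p2).
have -> : w * (1 - e1 * e2 * (p1 * p2)) =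
  w * (1 - e1 * p1) + w * e1 * p1 * (1 - e2 * p2) by ring.
apply: le_lt_trans (L_sqrD L_sqr _ _ ltr01) _; lra.
Qed.

Lemma dense_mul_prod (I : Type) (r : seq I) (e : I -> A) :
  (forall i, dense_mul (e i)) -> dense_mul (\prod_(i <- r) e i).
Proof. by move=> d; elim/big_rec: _ => [|i x _]; [exact: dense_mul1|exact: dense_mulM]. Qed.

Lemma dense_mulX e n : dense_mul e -> dense_mul (e ^+ n).
Proof.
move=> d; elim: n => [|n IH]; first exact: dense_mul1.
by rewrite exprS; exact: dense_mulM.
Qed.

Variable f : A.
Hypothesis L_fsqr : forall p, 0 <= L (f * p ^+ 2).

(** The difference between c^2 + b f + f^2 and (c + f)^2 is (b - 2c) f; this
    bound, with a constant below 1, makes it a relatively small perturbation. *)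
Lemma quadratic_contraction (c b : R) u : 0 < c -> 0 <= b <= 4 * c ->
  (2 * c - b) ^+ 2 * L ((f * u) ^+ 2) <= 4^-1 * L (((c%:A + f) ^+ 2 * u) ^+ 2).
Proof.
move=> c0 /andP[b0 bc].
set v := (c%:A - f) * u.
have -> : L (((c%:A + f) ^+ 2 * u) ^+ 2) = 16 * (c ^+ 2 * L ((f * u) ^+ 2)) +
    c ^+ 2 * L (v ^+ 2) + 6 * (c * L (f * v ^+ 2)) + L ((f * v) ^+ 2).
  rewrite quartic_split -/v !linearD/= !L_natl.
  by rewrite [_%:A ^+ 2]exprZn expr1n !L_alg.
have s1 := L_sqr v; have s2 := L_fsqr v; have s3 := L_sqr (f * v).
have : (2 * c - b) ^+ 2 * L ((f * u) ^+ 2) <= 4 * (c ^+ 2 * L ((f * u) ^+ 2)).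
  rewrite mulrA ler_wpM2r// -subr_ge0.
  have -> : 4 * c ^+ 2 - (2 * c - b) ^+ 2 = b * (4 * c - b) by ring.
  by rewrite mulr_ge0// subr_ge0.
have t1 : 0 <= c ^+ 2 * L (v ^+ 2) by rewrite mulr_ge0// exprn_ge0// ltW.
have t2 : 0 <= c * L (f * v ^+ 2) by rewrite mulr_ge0// ltW.
lra.
Qed.

(** Division by G = (c + f)^2 is available up to a small error, and G - E is a
    contraction relative to G, so that iterating q |-> (G - E) p with G p close to
    q solves E p = q approximately, as in a Neumann series. *)
Lemma dense_mul_quadratic (c b : R) : 0 < c -> 0 <= b <= 4 * c ->
  dense_mul (c%:A + f) -> dense_mul ((c ^+ 2)%:A + b *: f + f ^+ 2).
Proof.
move=> c0 /andP[b0 bc] d1; set E := (X in dense_mul X).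
set G := (c%:A + f) ^+ 2.
have dG : dense_mul G by exact: dense_mulX.
have GE : G - E = (2 * c - b) *: f.
  have cc : (c ^+ 2)%:A = c%:A ^+ 2 :> A by rewrite exprZn expr1n.
  have cb : (2 * c - b)%:A = 2%:R * c%:A - b%:A :> A.
    by rewrite scalerBl -scalerA scaler_nat mulr_natl.
  by rewrite /G /E -![_ *: f]mulr_algl cb cc; ring.
have contr u : L (((G - E) * u) ^+ 2) <= 4^-1 * L ((G * u) ^+ 2).
  rewrite GE -scalerAl exprZn linearZ/=.
  by apply: quadratic_contraction; rewrite ?b0.
(* Each step loses a factor 1/4 from the contraction and two factors 3/2 from
   [L_sqrD] with t = 1/2: in total 9/16 < 1. *)
have iter n w q eps : 0 < eps -> exists p,
    L ((w * (q - E * p)) ^+ 2) <= (9 / 16) ^+ n * L ((w * q) ^+ 2) + eps.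
  elim: n q eps => [|n IH] q eps e0.
    by exists 0; rewrite mulr0 subr0 expr0 mul1r lerDl ltW.
  have e10 : 0 < eps / 10 by rewrite divr_gt0.
  have [p0] := dG (w * q) _ e10; set p1 := q * p0 => h1.
  have {}h1 : L ((w * (q - G * p1)) ^+ 2) < eps / 10.
    by move: h1; congr (L (_ ^+ 2) < _); rewrite /p1; ring.
  have [p2 h2] := IH ((G - E) * p1) _ e10.
  exists (p1 + p2).
  have -> : w * (q - E * (p1 + p2)) =
    w * ((G - E) * p1 - E * p2) + w * (q - G * p1) by ring.
  have h2' : (0 < 2^-1 :> R) by rewrite invr_gt0.
  apply: le_trans (L_sqrD L_sqr _ _ h2') _; rewrite invrK.
  have h3 := L_sqrD L_sqr (w * q) (- (w * (q - G * p1))) h2'.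
  rewrite invrK sqrrN in h3.
  have h4 := contr (w * p1); rewrite mulrCA [G * _]mulrCA in h4.
  have h5 : L ((w * (G * p1)) ^+ 2) <=
     (1 + 2^-1) * L ((w * q) ^+ 2) + 3 * (eps / 10).
    apply: le_trans (_ : (1 + 2^-1) * L ((w * q) ^+ 2) + (1 + 2) * L ((w * (q - G * p1)) ^+ 2) <= _); last by lra.
    by move: h3; congr (L (_ ^+ 2) <= _); ring.
  have k0 : 0 <= (9 / 16 : R) ^+ n by rewrite exprn_ge0// divr_ge0.
  have k1 : (9 / 16 : R) ^+ n <= 1 by rewrite exprn_ile1// ?divr_ge0//; lra.
  have q4 : 0 <= 4^-1 :> R by rewrite invr_ge0.
  have h6 := ler_wpM2l k0 (le_trans h4 (ler_wpM2l q4 h5)).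
  have h7 : (9 / 16 : R) ^+ n * eps <= eps by rewrite ler_piMl// ltW.
  rewrite [_ ^+ n.+1]exprS; move: h1 h2 h6 h7.
  move: ((9 / 16) ^+ n) (L ((w * (q - G * p1)) ^+ 2)) (L ((w * q) ^+ 2))
    (L ((w * ((G - E) * p1)) ^+ 2)) (L ((w * ((G - E) * p1 - E * p2)) ^+ 2)).
  by move=> k x y z t; lra.
move=> w eps e0.
have e2 : 0 < eps / 2 by rewrite divr_gt0.
have [n hn] : exists n, (9 / 16) ^+ n * L (w ^+ 2) < eps / 2.
  have cv : (fun n => (9 / 16 : R) ^+ n * L (w ^+ 2)) @ \oo --> 0 * L (w ^+ 2).
    by apply: cvgMl; apply: cvg_expr; rewrite ger0_norm ?divr_ge0//; lra.
  rewrite mul0r in cv.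
  by have [n _ /(_ n (leqnn n))] := cvgr_lt _ cv _ e2; exists n.
have [p hp] := iter n w 1 _ e2.
exists p; apply: le_lt_trans hp _; rewrite mulr1; lra.
Qed.

End Density.

(** * Carleman's condition gives dense multipliers *)

Section WeightedEval.
Variables (R : realType) (A : comAlgType R) (L : {scalar A}) (V f : A).

Definition weighted_eval (p : {poly R}) : R := L (V * horner_alg f p).

Fact weighted_eval_scalar : scalar weighted_eval.
Proof.
move=> a p q; rewrite /weighted_eval -mul_polyC rmorphD rmorphM/= horner_algC.
by rewrite mulrDr linearD/= mulr_algl -scalerAr linearZ.
Qed.

HB.instance Definition _ :=
  GRing.isLinear.Build R {poly R} R *%R weighted_eval weighted_eval_scalar.

End WeightedEval.

Section CarlemanDensity.
Variables (R : realType) (A : comAlgType R) (L : {scalar A}).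
Hypothesis L_sqr : forall p, 0 <= L (p ^+ 2).
Variable f : A.
Hypothesis L_fsqr : forall p, 0 <= L (f * p ^+ 2).

Let S n := L (f ^+ n).

Lemma moment_ge0 n : 0 <= S n.
Proof.
rewrite /S -(odd_double_half n) exprD -muln2 exprM.
by case: (odd n); rewrite ?expr0 ?mul1r ?expr1.
Qed.

(** Cauchy-Schwarz for L at even n, and for the positive functional
    p |-> L (f p) at odd n. *)
Lemma moment_log_convex n : S n.+1 ^+ 2 <= S n * S n.+2.
Proof.
pose M : {scalar A} := L \o (f \*o idfun).
have E : n = (odd n + n./2.*2)%N by rewrite odd_double_half.
have e1 i : (f ^+ i) ^+ 2 = f ^+ i.*2 by rewrite -exprM muln2.
case: (boolP (odd n)) E => on E.
  have := @L_cauchy_schwarz R A M L_fsqr (f ^+ n./2) (f ^+ n./2.+1).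
  rewrite /M /= !e1 -!exprS -exprD -exprS.
  have -> : (n./2 + n./2.+1).+1 = n.+1 by lia.
  have -> : n./2.*2.+1 = n by lia.
  by have -> : n./2.+1.*2.+1 = n.+2 by lia.
have := L_cauchy_schwarz L_sqr (f ^+ n./2) (f ^+ n./2.+1).
rewrite !e1 -exprD.
have -> : (n./2 + n./2.+1 = n.+1)%N by lia.
have -> : n./2.*2 = n by lia.
by have -> : n./2.+1.*2 = n.+2 by lia.
Qed.

Lemma moment_root_le n : (forall k, 0 < S k) -> S n ^+ n.+1 <= S 0 * S n.+1 ^+ n.
Proof.
move=> S0; elim: n => [|n IH]; first by rewrite expr1 expr0 mulr1.
rewrite -(ler_pM2l (exprn_gt0 n (S0 n.+1))).
have -> : S n.+1 ^+ n * S n.+1 ^+ n.+2 = (S n.+1 ^+ 2) ^+ n.+1.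
  by rewrite -exprD -exprM; congr (_ ^+ _); lia.
apply: (@le_trans _ _ ((S n * S n.+2) ^+ n.+1)).
  by rewrite lerXn2r ?moment_log_convex// nnegrE ?exprn_ge0 ?mulr_ge0 ?moment_ge0.
rewrite exprMn mulrA [_ * S 0]mulrC ler_wpM2r ?exprn_ge0 ?moment_ge0//.
Qed.

Hypothesis carleman : (\sum_(1 <= n <oo) carleman_term (S n) n = +oo)%E.

Let tau n := S n `^ (- ((2 * n)%:R)^-1).

Lemma carleman_unbounded : (forall n, 0 < S n) ->
  forall B, exists n, B < \sum_(1 <= k < n) tau k.
Proof.
move=> S0 B; apply: contrapT => /forallNP nB.
have tE n : carleman_term (S n) n = (tau n)%:E.
  by rewrite /carleman_term gt_eqF.
have le n : (\sum_(1 <= k < n) carleman_term (S k) k <= B%:E)%E.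
  under eq_bigr do rewrite tE.
  by rewrite sumEFin lee_fin leNgt; apply/negP/nB.
have : (\sum_(1 <= n <oo) carleman_term (S n) n <= B%:E)%E.
  apply: lime_le; last by apply: nearW.
  by apply: is_cvg_nneseries => n _ _; rewrite tE lee_fin powR_ge0.
by rewrite carleman leye_eq.
Qed.

Lemma tau_pow n : (0 < n)%N -> 0 < S n -> tau n ^+ (2 * n) = (S n)^-1.
Proof.
move=> n0 Sn; have n2 : (2 * n)%:R != 0 :> R by rewrite pnatr_eq0 muln_eq0 -lt0n.
by rewrite -powR_mulrn ?powR_ge0// -powRrM mulNr mulVf// powR_inv1// ltW.
Qed.

(** Log-convexity compares an odd term with the preceding even one, so that the
    even terms alone carry the divergence. *)
Lemma tau_odd_le k : (forall n, 0 < S n) -> (0 < k)%N ->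
  tau (2 * k).+1 <= Num.max 1 (S 0) * tau (2 * k).
Proof.
move=> S0 k0; set K := Num.max 1 (S 0).
have K1 : 1 <= K by rewrite le_max lexx.
have KS : S 0 <= K by rewrite le_max lexx orbT.
have e0 : (0 < 2 * (2 * k).+1 * (2 * k))%N by rewrite !muln_gt0 k0.
rewrite -(ler_pXn2r e0) ?nnegrE ?mulr_ge0 ?powR_ge0 ?(le_trans ler01)//.
rewrite exprM tau_pow// exprMn.
have -> : tau (2 * k) ^+ (2 * (2 * k).+1 * (2 * k)) = (S (2 * k))^-1 ^+ (2 * k).+1.
  by rewrite -tau_pow ?muln_gt0// -exprM; congr (_ ^+ _); lia.
have h := moment_root_le (2 * k) S0.
rewrite !exprVn.
apply: (@le_trans _ _ (S 0 * (S (2 * k) ^+ (2 * k).+1)^-1)).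
  rewrite -ler_pdivrMl// -[in leLHS]invfM lef_pV2 ?posrE ?mulr_gt0 ?exprn_gt0//.
rewrite ler_wpM2r ?invr_ge0 ?exprn_ge0 ?moment_ge0// (le_trans KS)//.
by rewrite ler_eXnr.
Qed.

Lemma even_carleman_unbounded : (forall n, 0 < S n) ->
  forall B, exists n, B < \sum_(1 <= k < n.+1) tau (2 * k).
Proof.
move=> S0 B; set K := Num.max 1 (S 0).
have K1 : 1 <= K by rewrite le_max lexx.
have t0 k : 0 <= tau k by rewrite powR_ge0.
have [N hN] := carleman_unbounded S0 (tau 1 + (1 + K) * B).
exists N; rewrite ltNge; apply/negP => hB.
have split n : \sum_(1 <= k < (2 * n).+2) tau k <=
    tau 1 + (1 + K) * \sum_(1 <= k < n.+1) tau (2 * k).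
  elim: n => [|n IH]; first by rewrite muln0 big_nat1 big_geq// mulr0 addr0.
  have -> : (2 * n.+1).+2 = (2 * n).+2.+2 by lia.
  rewrite big_nat_recr//= big_nat_recr//= [X in _ <= _ + _ * X]big_nat_recr//=.
  have := @tau_odd_le n.+1 S0 isT; rewrite -/K.
  have -> : (2 * n.+1 = (2 * n).+2)%N by lia.
  move: IH; move: (\sum_(_ <= _ < _) _) (\sum_(_ <= _ < _) _) => x y; lra.
move: hN; rewrite ltNge => /negP; apply.
apply: le_trans (_ : _ <= \sum_(1 <= k < (2 * N).+2) tau k) _.
  have [N1|N1] := leqP 1 N; last by rewrite big_geq ?sumr_ge0//; lia.
  rewrite [leRHS](@big_cat_nat _ _ _ N)//=; last by lia.
  by rewrite lerDl sumr_ge0.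
by rewrite (le_trans (split N))// lerD2l ler_wpM2l//; lra.
Qed.

(** The weight V = w^2 (1 + f) makes a small value of either Lam (p^2) or
    Lam (X p^2) an upper bound for the norm of w p(f) or of w f p(f).  In the
    second case X p / (-c) replaces p; in both cases 1 - p is divisible by c + X.
    The moments of Lam are compared with those of L by Cauchy-Schwarz, which only
    involves even powers of f; hence the use of [even_carleman_unbounded]. *)
Lemma dense_mul_shift c : 0 < c -> dense_mul L (c%:A + f).
Proof.
move=> c0 w eps eps0.
pose V := w ^+ 2 * (1 + f).
pose Lam : {scalar {poly R}} := weighted_eval L V f.
have LamE p : Lam p = L (V * horner_alg f p) by [].
have LV p : L (V * p ^+ 2) = L ((w * p) ^+ 2) + L (f * (w * p) ^+ 2).
  by rewrite -linearD; congr (L _); rewrite /V; ring.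
have LamXn n : Lam 'X^n = L (V * f ^+ n).
  by rewrite LamE rmorphXn/= horner_algX.
have Lam_sqr p : 0 <= Lam (p ^+ 2).
  by rewrite LamE rmorphXn/= LV addr_ge0.
have LVX p : L (V * (f * p ^+ 2)) = L (f * (w * p) ^+ 2) + L ((w * (f * p)) ^+ 2).
  by rewrite -linearD; congr (L _); rewrite /V; ring.
have Lam_Xsqr p : 0 <= Lam ('X * p ^+ 2).
  by rewrite LamE rmorphM/= rmorphXn/= horner_algX LVX addr_ge0.
have cs n : Lam 'X^n ^+ 2 <= L (V ^+ 2) * S (2 * n).
  by rewrite LamXn (le_trans (L_cauchy_schwarz L_sqr _ _))// -exprM mulnC.
suff [p [pc Lp]] : exists p : {poly R}, p.[- c] = 1 /\
    L ((w * horner_alg f p) ^+ 2) < eps.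
  have /factor_theorem[q qE] : root (1 - p) (- c).
    by rewrite /root hornerD hornerN hornerC pc subrr.
  exists (horner_alg f q); move: Lp; congr (L ((w * _) ^+ 2) < eps).
  have -> : p = 1 - q * ('X + c%:P) by rewrite -(opprK c%:P) -polyCN -qE; ring.
  rewrite rmorphB rmorph1 rmorphM rmorphD/= horner_algX horner_algC.
  by ring.
have div : (forall n, 0 < Lam 'X^n) -> forall B, exists n,
    B < \sum_(1 <= k < n.+1) Num.sqrt (Lam 1 / Lam 'X^k) `^ k%:R^-1.
  move=> L0.
  have VV : 0 < L (V ^+ 2).
    rewrite lt0r L_sqr andbT; apply/eqP => V0; have := cs 0.
    by rewrite V0 mul0r leNgt exprn_gt0.
  have S0 n : 0 < S n.
    rewrite lt0r moment_ge0 andbT; apply/eqP => Sn.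
    have Sm m : S (n + m) = 0.
      elim: m => [|m IH]; first by rewrite addn0.
      apply/eqP; rewrite -sqrf_eq0 eq_le sqr_ge0 andbT addnS.
      by rewrite (le_trans (moment_log_convex _))// IH mul0r.
    have := cs n; rewrite mul2n -addnn Sm mulr0 leNgt.
    by rewrite exprn_gt0.
  have L1 : 0 < Lam 1 by have := L0 0; rewrite expr0.
  (* A constant at most 1, so that its 4k-th power is at most d^2 and the
     termwise comparison holds for every k at once. *)
  pose d := Num.min 1 (Lam 1 / Num.sqrt (L (V ^+ 2))).
  have d0 : 0 < d by rewrite lt_min ltr01 divr_gt0// sqrtr_gt0.
  have d1 : d <= 1 by rewrite ge_min lexx.
  have dV : d ^+ 2 * L (V ^+ 2) <= Lam 1 ^+ 2.
    have ds : d * Num.sqrt (L (V ^+ 2)) <= Lam 1.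
      by rewrite -ler_pdivlMr ?sqrtr_gt0// ge_min lexx orbT.
    rewrite -[L (V ^+ 2)]sqr_sqrtr ?L_sqr// -exprMn lerXn2r// nnegrE.
      by rewrite mulr_ge0 ?sqrtr_ge0 ?ltW.
    exact: ltW.
  move=> B; have [n hn] := even_carleman_unbounded S0 (d^-1 * B).
  exists n; rewrite ltr_pdivrMl// in hn; apply: lt_le_trans hn _.
  rewrite mulr_sumr; apply: ler_sum_nat => k /andP[k0 _].
  set r := _ `^ _.
  have r0 : 0 <= r by exact: powR_ge0.
  have rE : r ^+ (4 * k) = (Lam 1 / Lam 'X^k) ^+ 2.
    have q0 : 0 <= Lam 1 / Lam 'X^k by rewrite divr_ge0 ?ltW.
    rewrite -[X in _ = X ^+ 2](sqr_sqrtr q0) /r.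
    have -> : (4 * k = k * (2 * 2))%N by lia.
    rewrite exprM -[X in X ^+ (2 * 2)]powR_mulrn ?powR_ge0// -powRrM mulVf ?pnatr_eq0 -?lt0n//.
    by rewrite powRr1 ?sqrtr_ge0// exprM.
  have k4 : (0 < 4 * k)%N by lia.
  rewrite -(ler_pXn2r k4) ?nnegrE ?(mulr_ge0 (ltW d0) (powR_ge0 _ _))// rE exprMn.
  have -> : tau (2 * k) ^+ (4 * k) = (S (2 * k))^-1.
    by rewrite -tau_pow ?muln_gt0//; congr (_ ^+ _); lia.
  rewrite expr_div_n ler_pdivlMr ?exprn_gt0// mulrAC ler_pdivrMr//.
  apply: le_trans (ler_wpM2l (exprn_ge0 _ (ltW d0)) (cs k)) _.
  rewrite mulrA ler_wpM2r ?moment_ge0// (le_trans _ dV)// ler_wpM2r ?L_sqr//.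
  by apply: ler_wiXn2l => //; [exact: ltW|lia].
pose eps' := Num.min eps (c ^+ 2 * eps).
have eps'0 : 0 < eps' by rewrite lt_min eps0 mulr_gt0// exprn_gt0.
have [p [pc [Lp|Lp]]] := stieltjes_dichotomy Lam_sqr Lam_Xsqr c0 div eps'0.
  exists p; split=> //; move: Lp; rewrite lt_min => /andP[+ _].
  by apply: le_lt_trans; rewrite LamE rmorphXn/= LV lerDl.
exists (- c^-1 *: ('X * p)); split.
  by rewrite hornerZ hornerM hornerX pc mulr1 mulrNN mulVf// gt_eqF.
move: Lp; rewrite lt_min => /andP[_].
rewrite LamE rmorphM rmorphXn/= horner_algX LVX => Lp.
have -> : w * horner_alg f (- c^-1 *: ('X * p)) = - c^-1 *: (w * (f * horner_alg f p)).
  by rewrite -mul_polyC !rmorphM/= horner_algC horner_algX mulr_algl -scalerAr.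
rewrite exprZn linearZ/= sqrrN exprVn.
rewrite ltr_pdivrMl ?exprn_gt0//; apply: le_lt_trans Lp.
by rewrite lerDr.
Qed.

Lemma dense_mul_sqr1 : dense_mul L (1 + f ^+ 2).
Proof.
have h : 0 <= (0 : R) <= 4 * 1 by lra.
have := dense_mul_quadratic L_sqr L_fsqr ltr01 h (dense_mul_shift ltr01).
by rewrite expr1n scale1r scale0r addr0.
Qed.

(** Here 1 + (1 + f)^2 = c^2 + 2 f + f^2 with c = sqrt 2. *)
Lemma dense_mul_sqr1_shift : dense_mul L (1 + (1 + f) ^+ 2).
Proof.
have s0 : 0 < Num.sqrt 2 :> R by rewrite sqrtr_gt0.
have h : 0 <= (2 : R) <= 4 * Num.sqrt 2.
  rewrite ler0n/= -(@ler_pXn2r _ 2)// ?nnegrE ?mulr_ge0 ?sqrtr_ge0//.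
  by rewrite exprMn sqr_sqrtr//; lra.
have := dense_mul_quadratic L_sqr L_fsqr s0 h (dense_mul_shift s0).
rewrite sqr_sqrtr// [2 *: f]scaler_nat.
have -> : 2%:A = 1 + 1 :> A by rewrite scaler_nat mulr2n.
by congr dense_mul; ring.
Qed.

End CarlemanDensity.

(** * Approximation by discrete measures *)

Lemma prod_dist_le (R : realType) (I : finType) (u v : I -> R) :
  (forall i, 0 <= u i <= 1) -> (forall i, 0 <= v i <= 1) ->
  `|\prod_i u i - \prod_i v i| <= \sum_i `|u i - v i|.
Proof.
move=> u01 v01.
suff: [/\ `|\prod_i u i - \prod_i v i| <= \sum_i `|u i - v i|,
   0 <= \prod_i u i <= 1 & 0 <= \prod_i v i <= 1] by case.
elim/big_rec3: _ => [|i y1 y2 s _ [h /andP[a0 a1] /andP[b0 b1]]].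
  by split; rewrite ?subrr ?normr0// ler01 lexx.
have /andP[u0 u1] := u01 i; have /andP[v0 v1] := v01 i.
split; rewrite ?mulr_ge0 ?mulr_ile1//.
have -> : u i * s - v i * y2 = (u i - v i) * s + v i * (s - y2) by ring.
rewrite (le_trans (ler_normD _ _))// !normrM lerD//.
  by rewrite ler_piMr// ger0_norm.
by rewrite (le_trans _ h)// ler_piMl// ger0_norm.
Qed.

(** The binomial factor counts k-subsets of N points; choosing ordered samples
    inside and outside the subset first gives the right-hand side.  It turns the
    sampling weights below into plain binomial coefficients. *)
Lemma bin_ffactM (N D a k : nat) : (a <= D <= N)%N -> (k <= N)%N ->
  ('C(N, k) * (k ^_ a * (N - k) ^_ (D - a)) =
    N ^_ D * ((a <= k) * 'C(N - D, k - a)))%N.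
Proof.
move=> /andP[aD DN] kN; have [ak|ka] := leqP a k; last first.
  by rewrite ffact_small// mul0n !muln0.
rewrite mul1n; have [kk|kk] := leqP (k - a) (N - D); last first.
  by rewrite [in RHS]bin_small// (@ffact_small (N - k)%N) ?muln0//; lia.
have p0 : (0 < (k - a)`! * (N - D - (k - a))`!)%N by rewrite muln_gt0 !fact_gt0.
apply/eqP; rewrite -(eqn_pmul2r p0); apply/eqP.
rewrite -[RHS]mulnA bin_fact// ffact_fact//.
have -> : (N - D - (k - a) = N - k - (D - a))%N by lia.
have h1 : (k ^_ a * (k - a)`! = k`!)%N by rewrite ffact_fact.
have h2 : ((N - k) ^_ (D - a) * (N - k - (D - a))`! = (N - k)`!)%N.
  by rewrite ffact_fact//; lia.
by rewrite -mulnA mulnACA h1 h2 bin_fact.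
Qed.

Section SumsOfSquares.
Variable A : comNzRingType.

Definition sos (p : A) := exists s : seq A, p = \sum_(x <- s) x ^+ 2.

Lemma sos0 : sos 0.
Proof. by exists [::]; rewrite big_nil. Qed.

Lemma sos_sqr p : sos (p ^+ 2).
Proof. by exists [:: p]; rewrite big_seq1. Qed.

Lemma sos1 : sos 1.
Proof. by rewrite -(expr1n _ 2); exact: sos_sqr. Qed.

Lemma sosD p q : sos p -> sos q -> sos (p + q).
Proof. by move=> [s ->] [t ->]; exists (s ++ t); rewrite big_cat. Qed.

Lemma sos_sum (I : Type) (r : seq I) (P : pred I) (p : I -> A) :
  (forall i, P i -> sos (p i)) -> sos (\sum_(i <- r | P i) p i).
Proof. by move=> h; apply: (big_ind sos); [exact: sos0|exact: sosD|]. Qed.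

Lemma sosM p q : sos p -> sos q -> sos (p * q).
Proof.
move=> [s ->] [t ->]; rewrite mulr_suml; apply: sos_sum => i _.
rewrite mulr_sumr; apply: sos_sum => j _; rewrite -exprMn; exact: sos_sqr.
Qed.

Lemma sosMn p n : sos p -> sos (p *+ n).
Proof.
by move=> h; elim: n => [|n IH]; rewrite ?mulr0n ?mulrS; [exact: sos0|exact: sosD].
Qed.

Lemma sosX p n : sos p -> sos (p ^+ n).
Proof.
by move=> h; elim: n => [|n IH]; rewrite ?expr0 ?exprS; [exact: sos1|exact: sosM].
Qed.

Lemma sos_prodB (I : Type) (r : seq I) (p q : I -> A) :
  (forall i, sos (p i)) -> (forall i, sos (q i)) -> (forall i, sos (p i - q i)) ->
  sos (\prod_(i <- r) p i - \prod_(i <- r) q i).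
Proof.
move=> sp sq spq.
suff: sos (\prod_(i <- r) p i - \prod_(i <- r) q i) /\ sos (\prod_(i <- r) p i) by case.
elim/big_rec2: _ => [|i y x _ [h sx]]; first by rewrite subrr; split; [exact: sos0|exact: sos1].
split; last exact: sosM.
have -> : p i * x - q i * y = (p i - q i) * x + q i * (x - y) by ring.
by apply: sosD; exact: sosM.
Qed.

End SumsOfSquares.

Section Bernstein.
Variables (R : realType) (A : comAlgType R) (L : {scalar A}).
Hypothesis L_sqr : forall p, 0 <= L (p ^+ 2).

Lemma L_sos p : sos p -> 0 <= L p.
Proof. by move=> [s ->]; rewrite linear_sum sumr_ge0. Qed.

Variables (M : nat) (F : 'I_M -> A).
Let g i := F i ^+ 2.
Let E := \prod_i (1 + g i).

(** The grid sums are values of L at a product over the coordinates, by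
    distributivity. *)
Lemma moment_box_expand (N : nat) (h : 'I_M -> 'I_N.+1 -> R) (Z : A) :
  \sum_(l : {ffun 'I_M -> 'I_N.+1}) L (Z * \prod_i g i ^+ l i) * \prod_i h i (l i)
  = L (Z * \prod_i \sum_(k < N.+1) h i k *: g i ^+ k).
Proof.
rewrite bigA_distr_bigA/= mulr_sumr linear_sum/=; apply: eq_bigr => l _.
have -> : \prod_i (h i (l i) *: g i ^+ l i) =
    (\prod_i h i (l i)) *: \prod_i g i ^+ l i by rewrite scaler_prod.
by rewrite -scalerAr linearZ/= mulrC.
Qed.

Lemma bernstein_monomial (N D a : nat) (x : A) : (a <= D <= N)%N ->
  \sum_(k < N.+1) (((a <= k) * 'C(N - D, k - a))%:R : R) *: x ^+ k
  = x ^+ a * (1 + x) ^+ (N - D).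
Proof.
move=> /andP[aD DN]; rewrite addrC exprDn mulr_sumr.
rewrite -(big_mkord xpredT (fun k => (((a <= k) * 'C(N - D, k - a))%:R : R) *: x ^+ k)).
rewrite (@big_cat_nat _ _ _ a)//=; last by lia.
rewrite big_nat big1 ?add0r => [|k /andP[_ ka]]; last first.
  by rewrite leqNgt ka mul0n scale0r.
rewrite (@big_cat_nat _ _ _ (a + (N - D).+1))//=; [|by lia|by lia].
rewrite [X in _ + X]big_nat [X in _ + X]big1 ?addr0 => [|k /andP[ka _]]; last first.
  by rewrite bin_small ?muln0 ?scale0r//; lia.
rewrite -{1}[a]add0n big_addn addKn big_mkord (reindex_inj rev_ord_inj)/=.
apply: eq_bigr => k _; have kN := ltn_ord k.
have -> : ((N - D).+1 - k.+1 + a - a = N - D - k)%N by lia.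
have -> : ((a <= (N - D).+1 - k.+1 + a)%N = true) by lia.
rewrite mul1n bin_sub//.
rewrite expr1n mulr1 scaler_nat mulrnAr -exprD; congr (_ ^+ _ *+ _); lia.
Qed.

(** If the indices k are thought of as binomially distributed with parameter
    x = t / (1 + t), then k / N is close to x and the node is close to t. *)
Definition node N (k : nat) : R := k%:R / (N - k)%:R.

Lemma node_ge0 N k : 0 <= node N k.
Proof. by rewrite divr_ge0. Qed.

(** The factor (1 - k/N)^D removes the pole of [node] at k = N; this is what
    the strict inequality a < D is for. *)
Lemma node_pow (N D a k : nat) : (a < D)%N -> (k <= N)%N -> (0 < N)%N ->
  (1 - k%:R / N%:R) ^+ D * node N k ^+ a
  = (k%:R / N%:R) ^+ a * ((N - k)%:R / N%:R) ^+ (D - a).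
Proof.
move=> aD kN N0; have N1 : N%:R != 0 :> R by rewrite pnatr_eq0 -lt0n.
have -> : 1 - k%:R / N%:R = (N - k)%:R / N%:R :> R.
  by rewrite natrB// mulrBl mulfV.
have [->|kN'] := eqVneq k N.
  by rewrite subnn mul0r !expr0n subn_eq0 leqNgt aD (gtn_eqF (leq_ltn_trans _ aD))// mul0r mulr0.
have k1 : (N - k)%:R != 0 :> R by rewrite pnatr_eq0 subn_eq0 -ltnNge ltn_neqAle kN' kN.
have -> : D = (a + (D - a))%N by lia.
rewrite exprD mulrAC -exprMn addKn /node; congr (_ ^+ _ * _).
by field; rewrite N1 k1.
Qed.

(** Sampling without replacement: unlike the powers of k / N and (N - k) / N,
    these falling factorials have exact binomial sums. *)
Definition ffact_sample (N a b k : nat) : R :=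
  (k ^_ a)%:R / N%:R ^+ a * ((N - k) ^_ b)%:R / N%:R ^+ b.

Lemma ffact_ratioE N a k : (k ^_ a)%:R / N%:R ^+ a = \prod_(i < a) ((k - i)%:R / N%:R) :> R.
Proof.
by rewrite big_split/= prodr_const card_ord exprVn ffact_prod natr_prod.
Qed.

Lemma ratio01 N k : (k <= N)%N -> (0 < N)%N -> 0 <= (k%:R / N%:R : R) <= 1.
Proof.
move=> kN N0; rewrite divr_ge0//= ler_pdivrMr ?ltr0n// mul1r ler_nat//.
Qed.

Lemma ffact_ratio_dist N a k : (k <= N)%N -> (0 < N)%N ->
  `|(k ^_ a)%:R / N%:R ^+ a - (k%:R / N%:R) ^+ a| <= (a ^ 2)%:R / N%:R :> R.
Proof.
move=> kN N0; have N1 : 0 < N%:R :> R by rewrite ltr0n.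
rewrite ffact_ratioE; have -> : (k%:R / N%:R) ^+ a = \prod_(i < a) (k%:R / N%:R) :> R.
  by rewrite prodr_const card_ord.
apply: le_trans (prod_dist_le _ _) _ => [i|i|].
- by apply: ratio01 => //; rewrite (leq_trans (leq_subr _ _)).
- exact: ratio01.
apply: le_trans (_ : \sum_(i < a) (a%:R / N%:R) <= _); last first.
  by rewrite sumr_const card_ord -[leLHS]mulr_natl mulrA -natrM mulnn.
apply: ler_sum => i _; rewrite -mulrBl normrM [X in _ * X]ger0_norm ?invr_ge0//.
rewrite ler_pM2r ?invr_gt0// distrC -natrB ?leq_subr// normr_nat ler_nat.
have := ltn_ord i; lia.
Qed.

Lemma ffact_sample01 N a b k : (k <= N)%N -> (0 < N)%N -> 0 <= ffact_sample N a b k <= 1.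
Proof.
move=> kN N0; rewrite /ffact_sample -mulrA !ffact_ratioE.
have h (m c : nat) : (m <= N)%N -> 0 <= (\prod_(i < c) ((m - i)%:R / N%:R) : R) <= 1.
  move=> mN; rewrite prodr_ge0 => [|i _]; last by rewrite divr_ge0.
  by rewrite prodr_ile1// => i _; apply: ratio01; rewrite ?(leq_trans (leq_subr _ _)).
have /andP[a0 a1] := h k a kN; have /andP[b0 b1] := h (N - k)%N b (leq_subr _ _).
by rewrite mulr_ge0// mulr_ile1.
Qed.

Lemma ffact_sample_dist N D a k : (k <= N)%N -> (0 < N)%N -> (a <= D)%N ->
  `|(k%:R / N%:R) ^+ a * ((N - k)%:R / N%:R) ^+ (D - a) - ffact_sample N a (D - a) k|
    <= (2 * D ^ 2)%:R / N%:R.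
Proof.
move=> kN N0 aD; set b := (D - a)%N.
have d1 := ffact_ratio_dist a kN N0.
have d2 := ffact_ratio_dist b (leq_subr k N) N0.
rewrite /ffact_sample -mulrA.
have h1 : 0 <= (((N - k)%:R / N%:R) ^+ b : R) <= 1.
  have /andP[u0 u1] := ratio01 (leq_subr k N) N0.
  by rewrite exprn_ge0//= exprn_ile1.
have h2 : 0 <= ((k ^_ a)%:R / N%:R ^+ a : R) <= 1.
  by have := ffact_sample01 a 0 kN N0; rewrite /ffact_sample expr0 !invr1 !mulr1.
move: d1 d2 h1 h2; move: (_ ^+ a) (_ / _ ^+ a) (((N - k)%:R / N%:R) ^+ b) (_ / _ ^+ b).
move=> x x' y y' d1 d2 /andP[y0 y1] /andP[x0 x1].
have -> : x * y - x' * y' = (x - x') * y - x' * (y' - y) by ring.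
rewrite (le_trans (ler_normB _ _))// !normrM [`|y|]ger0_norm// [`|x'|]ger0_norm//.
apply: le_trans (lerD (ler_piMr _ y1) (ler_piMl _ x1)) _ => //.
rewrite distrC in d1.
apply: (@le_trans _ _ ((a ^ 2)%:R / N%:R + (b ^ 2)%:R / N%:R)).
  by rewrite lerD// distrC.
rewrite -mulrDl -natrD ler_wpM2r ?invr_ge0// ler_nat.
have: (a ^ 2 <= D ^ 2)%N by rewrite leq_exp2r.
have: (b ^ 2 <= D ^ 2)%N by rewrite leq_exp2r ?leq_subr.
lia.
Qed.

(** The number of samples of size D with replacement, divided by the number of
    those without. *)
Definition ffact_scale (N D : nat) : R := N%:R ^+ D / (N ^_ D)%:R.

Lemma ffact_scale_ge0 N D : 0 <= ffact_scale N D.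
Proof. by rewrite divr_ge0 ?exprn_ge0. Qed.

Lemma ffact_scale_le N D : (2 * D <= N)%N -> ffact_scale N D <= 2 ^+ D.
Proof.
move=> DN; have [->|D0] := posnP D; first by rewrite /ffact_scale expr0 divr1 expr0.
rewrite /ffact_scale ler_pdivrMr; last by rewrite ltr0n ffact_gt0; lia.
rewrite ffact_prod natr_prod -[D in 2 ^+ D]card_ord -prodr_const -big_split/=.
rewrite -[D in leLHS]card_ord -prodr_const; apply: ler_prod => i _.
rewrite ler0n/= -natrM ler_nat; have := ltn_ord i; lia.
Qed.

Lemma ffact_scale_sampled N D a k : (a <= D <= N)%N -> (k <= N)%N -> (0 < N)%N ->
  ffact_scale N D * ('C(N, k)%:R * ffact_sample N a (D - a) k) = ((a <= k) * 'C(N - D, k - a))%:R.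
Proof.
move=> aDN kN N0; have /andP[aD DN] := aDN.
have f0 : (N ^_ D)%:R != 0 :> R by rewrite pnatr_eq0 -lt0n ffact_gt0.
have N1 : N%:R != 0 :> R by rewrite pnatr_eq0 -lt0n.
apply: (mulfI f0); rewrite -natrM -bin_ffactM// !natrM /ffact_sample /ffact_scale.
have -> : N%:R ^+ D = N%:R ^+ a * N%:R ^+ (D - a) :> R by rewrite -exprD subnKC.
by field; rewrite f0 !expf_neq0.
Qed.

Lemma box_mass (N : nat) (Z : A) :
  \sum_(l : {ffun 'I_M -> 'I_N.+1}) L (Z * \prod_i g i ^+ l i) * \prod_i 'C(N, l i)%:R
  = L (Z * E ^+ N).
Proof.
rewrite (@moment_box_expand N (fun i k => 'C(N, k)%:R)) /E -prodrXl.
congr (L (_ * _)); apply: eq_bigr => i _.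
have h := @bernstein_monomial N 0 0 (g i) isT.
rewrite subn0 expr0 mul1r in h; rewrite -h.
by apply: eq_bigr => k _; rewrite mul1n subn0.
Qed.

Lemma box_ffact_sample (N D : nat) (al : 'I_M -> nat) (Z : A) :
  (forall i, (al i <= D)%N) -> (D <= N)%N -> (0 < N)%N ->
  \sum_(l : {ffun 'I_M -> 'I_N.+1}) L (Z * \prod_i g i ^+ l i) *
     \prod_i (ffact_scale N D * ('C(N, l i)%:R * ffact_sample N (al i) (D - al i) (l i)))
  = L (Z * \prod_i g i ^+ al i * E ^+ (N - D)).
Proof.
move=> aD DN N0.
rewrite (@moment_box_expand N (fun i k =>
  ffact_scale N D * ('C(N, k)%:R * ffact_sample N (al i) (D - al i) k))).
rewrite -mulrA /E -prodrXl -big_split/=; congr (L (_ * _)).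
apply: eq_bigr => i _; rewrite -bernstein_monomial ?aD//.
by apply: eq_bigr => k _; rewrite ffact_scale_sampled ?aD// -ltnS.
Qed.

Lemma moment_box_ge0 (l : 'I_M -> nat) (Y : A) : 0 <= L (Y ^+ 2 * \prod_i g i ^+ l i).
Proof.
have -> : Y ^+ 2 * \prod_i g i ^+ l i = (Y * \prod_i F i ^+ l i) ^+ 2.
  rewrite exprMn -prodrXl; congr (_ * _); apply: eq_bigr => i _.
  by rewrite /g -!exprM mulnC.
exact: L_sqr.
Qed.

(** The moments of the discrete measure differ from values of L only through
    the replacement of powers by falling factorials, an error of order 1/N
    relative to the total mass L (Y^2 E^N). *)
Lemma box_dist (N D : nat) (al : 'I_M -> nat) (Y : A) :
  (forall i, (al i < D)%N) -> (2 * D <= N)%N -> (0 < N)%N ->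
  `| \sum_(l : {ffun 'I_M -> 'I_N.+1})
       (L (Y ^+ 2 * \prod_i g i ^+ l i) *
        \prod_i (ffact_scale N D * ('C(N, l i)%:R * (1 - (l i)%:R / N%:R) ^+ D))) *
        \prod_i node N (l i) ^+ al i
     - L (Y ^+ 2 * \prod_i g i ^+ al i * E ^+ (N - D)) |
  <= (2 ^+ D) ^+ M * (M%:R * ((2 * D ^ 2)%:R / N%:R)) * L (Y ^+ 2 * E ^+ N).
Proof.
move=> aD DN N0; have aD' i : (al i <= D)%N by exact: ltnW.
have DN' : (D <= N)%N by lia.
rewrite -(box_ffact_sample _ aD' DN' N0) -sumrB -(box_mass N) mulr_sumr.
apply: le_trans (ler_norm_sum _ _ _) _; apply: ler_sum => l _.
have lN i : (l i <= N)%N by rewrite -ltnS.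
set V := L (_ * _); have V0 : 0 <= V by exact: moment_box_ge0.
pose G i := ((l i)%:R / N%:R) ^+ al i * ((N - l i)%:R / N%:R) ^+ (D - al i) : R.
pose s i := ffact_sample N (al i) (D - al i) (l i).
have -> : V * \prod_i (ffact_scale N D * ('C(N, l i)%:R * (1 - (l i)%:R / N%:R) ^+ D)) *
    \prod_i node N (l i) ^+ al i - V * \prod_i (ffact_scale N D * ('C(N, l i)%:R * s i))
  = ffact_scale N D ^+ M * (V * \prod_i 'C(N, l i)%:R) * (\prod_i G i - \prod_i s i).
  have -> : \prod_i G i = \prod_i (1 - (l i)%:R / N%:R) ^+ D * \prod_i node N (l i) ^+ al i.
    by rewrite -big_split/=; apply: eq_bigr => i _; rewrite node_pow.
  have sp (a b : 'I_M -> R) : \prod_i (ffact_scale N D * (a i * b i)) =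
      ffact_scale N D ^+ M * (\prod_i a i * \prod_i b i).
    rewrite big_split/= prodr_const card_ord; congr (_ * _).
    by rewrite big_split.
  rewrite (sp (fun i => 'C(N, l i)%:R) (fun i => (1 - (l i)%:R / N%:R) ^+ D)).
  rewrite (sp (fun i => 'C(N, l i)%:R) s).
  move: (\prod_i s i) (\prod_i node N (l i) ^+ al i) (\prod_(i < M) _ ^+ D).
  by move: (\prod_i 'C(N, l i)%:R) => x y z t; ring.
have C0 : 0 <= \prod_i 'C(N, l i)%:R :> R by rewrite prodr_ge0.
rewrite normrM [X in X * _]ger0_norm; last by rewrite !mulr_ge0 ?exprn_ge0 ?ffact_scale_ge0.
rewrite [leLHS]mulrAC; apply: ler_pM; rewrite ?mulr_ge0 ?exprn_ge0 ?ffact_scale_ge0//.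
apply: ler_pM; rewrite ?exprn_ge0 ?ffact_scale_ge0//.
  by rewrite lerXn2r ?nnegrE ?ffact_scale_ge0 ?exprn_ge0 ?ffact_scale_le.
apply: le_trans (prod_dist_le _ _) _ => [i|i|].
- have /andP[u0 u1] := ratio01 (lN i) N0.
  have /andP[v0 v1] := ratio01 (leq_subr (l i) N) N0.
  by rewrite mulr_ge0 ?exprn_ge0//= mulr_ile1 ?exprn_ge0 ?exprn_ile1.
- exact: ffact_sample01.
rewrite mulr_natl -[M in _ *+ M]card_ord -sumr_const.
by apply: ler_sum => i _; exact: ffact_sample_dist.
Qed.

(** Every monomial of bounded degree in the squares F_i^2 occurs in the
    expansion of the squared weight, where all other terms are squares too; so
    the weighted seminorm dominates all the moments that have to be
    approximated. *)
Lemma sos_box_weight (D : nat) (al : 'I_M -> nat) : (forall i, (al i <= D)%N) ->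
  sos ((E ^+ D.+1) ^+ 2 - (\prod_i F i ^+ al i) ^+ 2).
Proof.
move=> aD; rewrite -exprM /E -!prodrXl; apply: sos_prodB => i.
- by apply: sosX; apply: sosD; [exact: sos1|exact: sos_sqr].
- exact: sos_sqr.
have aN : (al i < (D.+1 * 2).+1)%N by have := aD i; lia.
rewrite exprDn (bigD1 (Ordinal aN))//= -[(_ ^+ al i) ^+ 2]exprM [(al i * 2)%N]mulnC exprM expr1n mul1r.
rewrite addrAC; apply: sosD; last first.
  apply: sos_sum => k _; apply: sosMn; rewrite expr1n mul1r.
  by apply: sosX; exact: sos_sqr.
have -> : 'C(D.+1 * 2, al i) = 'C(D.+1 * 2, al i).-1.+1.
  by rewrite prednK// bin_gt0; lia.
by rewrite mulrS addrAC subrr add0r; apply: sosMn; apply: sosX; exact: sos_sqr.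
Qed.

(** The weights are values of L at squares times nonnegative numbers.  With
    N = 2n and Y = w S, where E^n S is close to 1 for the weight w, the factor
    Y^2 E^N is close to w^2, which keeps the total mass bounded while N grows, and
    Y^2 E^(N - 2(D+1)) is close to 1, which makes the moments converge. *)
Lemma discrete_approximation (D : nat) (eps : R) :
  (forall i, dense_mul L (1 + F i ^+ 2)) -> 0 < eps ->
  exists (T : finType) (W : T -> R) (x : T -> 'I_M -> R),
    [/\ forall t, 0 <= W t, forall t i, 0 <= x t i &
      forall al : 'I_M -> nat, (forall i, (al i <= D)%N) ->
      `|\sum_t W t * \prod_i x t i ^+ al i - L (\prod_i (F i ^+ 2) ^+ al i)| <= eps].
Proof.
move=> dense eps0; pose D2 := (2 * D.+1)%N; pose w := E ^+ D.+1; pose B := L (w ^+ 2).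
have B0 : 0 <= B by exact: L_sqr.
(* K / N bounds the discretization error of [box_dist], the mass being at most
   2 B + 2. *)
pose K : R := (2 ^+ D2) ^+ M * (M%:R * (2 * D2 ^ 2)%:R) * (2 * B + 2).
have K0 : 0 <= K by rewrite !mulr_ge0 ?exprn_ge0// addr_ge0 ?mulr_ge0.
have [n [nD nK]] : exists n, (D2 <= n)%N /\ K <= eps / 2 * n%:R.
  pose n0 := Num.truncn (K / (eps / 2)); exists (D2 + n0.+1)%N; split; first exact: leq_addr.
  rewrite mulrC -ler_pdivrMr ?divr_gt0// (le_trans (ltW (truncnS_gt _)))//.
  by rewrite ler_nat leq_addl.
pose N := (n * 2)%N.
have n0 : (0 < n)%N by apply: leq_trans nD; rewrite muln_gt0.
(* In [L_sqrD] the parameter t costs t (2 B + 2) = eps / 4, and eta is small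
   enough to compensate the factor 1 / t on the other summand. *)
pose t : R := eps / (8 * (B + 1)).
have t0 : 0 < t by rewrite divr_gt0// mulr_gt0// ltr_wpDl.
pose eta : R := Num.min 1 (eps / 4 / (t^-1 + 1)).
have ti : 0 < t^-1 + 1 by rewrite addr_gt0 ?invr_gt0.
have eta0 : 0 < eta by rewrite lt_min ltr01 !divr_gt0.
have eta1 : eta <= 1 by rewrite ge_min lexx.
have etat : eta * (t^-1 + 1) <= eps / 4 by rewrite -ler_pdivlMr// ge_min lexx orbT.
have dE : dense_mul L (E ^+ n) by apply/dense_mulX/dense_mul_prod.
have [S hS] := dE w _ eta0.
pose Y := w * S.
have mass : L (Y ^+ 2 * E ^+ N) <= 2 * B + 2.
  have -> : Y ^+ 2 * E ^+ N = (w + - (w * (1 - E ^+ n * S))) ^+ 2.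
    by rewrite exprM /Y; move: (w) (E ^+ n) => u e; ring.
  apply: le_trans (L_sqrD L_sqr _ _ ltr01) _; rewrite sqrrN invr1 -/B; lra.
exists ({ffun 'I_M -> 'I_N.+1} : finType),
  (fun l : {ffun 'I_M -> 'I_N.+1} => L (Y ^+ 2 * \prod_i g i ^+ l i) *
        \prod_i (ffact_scale N D2 * ('C(N, l i)%:R * (1 - (l i)%:R / N%:R) ^+ D2))),
  (fun (l : {ffun 'I_M -> 'I_N.+1}) i => node N (l i)).
split=> [l|l i|al aD]; last 1 first.
- have aD2 i : (al i < D2)%N by have := aD i; rewrite /D2; clear; lia.
  have DN : (2 * D2 <= N)%N by rewrite /N mulnC leq_mul2r.
  have N0 : (0 < N)%N by rewrite /N muln_gt0 n0.
  have h1 := box_dist Y aD2 DN N0.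
  pose Fa := \prod_i F i ^+ al i.
  have FaE : \prod_i g i ^+ al i = Fa ^+ 2.
    by rewrite /Fa -prodrXl; apply: eq_bigr => i _; rewrite /g -!exprM mulnC.
  pose De := 1 - E ^+ n * S.
  have h2 : L (Y ^+ 2 * \prod_i g i ^+ al i * E ^+ (N - D2)) = L ((Fa + - (Fa * De)) ^+ 2).
    congr (L _); rewrite FaE /De mulrBr mulr1 opprB addrC subrK /Y /w !exprMn -!exprM.
    have -> : (n * 2 = D.+1 * 2 + (N - D2))%N.
      by rewrite /N [(D.+1 * 2)%N]mulnC subnKC// (leq_trans nD)// leq_pmulr.
    rewrite exprD; move: (E ^+ (_ * _)) (E ^+ (_ - _)) (S ^+ 2) (Fa ^+ 2).
    by move=> x y z u; ring.
  have dom q : L ((Fa * q) ^+ 2) <= L ((w * q) ^+ 2).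
    rewrite -subr_ge0 -linearB !exprMn -mulrBl L_sos//; apply: sosM; last exact: sos_sqr.
    exact: sos_box_weight.
  have FaB : L (Fa ^+ 2) <= B by have := dom 1; rewrite !mulr1.
  have h3 : L ((Fa * De) ^+ 2) < eta by apply: le_lt_trans (dom _) hS.
  have u1 := L_sqrD L_sqr Fa (- (Fa * De)) t0.
  have u2 := L_sqrD L_sqr (Fa + - (Fa * De)) (Fa * De) t0.
  rewrite subrK in u2; rewrite sqrrN in u1.
  have u3 := L_sqrD L_sqr Fa (- (Fa * De)) ltr01.
  rewrite sqrrN invr1 in u3.
  have tB : t * (2 * B + 2) = eps / 4.
    by rewrite /t; field; rewrite gt_eqF// ltr_wpDl.
  have close : `|L ((Fa + - (Fa * De)) ^+ 2) - L (Fa ^+ 2)| <= 3 / 4 * eps.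
    have t1 : (t^-1 + 1) * L ((Fa * De) ^+ 2) <= eps / 4.
      by rewrite (le_trans _ etat)// [leLHS]mulrC ler_wpM2r ?(ltW ti) ?(ltW h3).
    have t2 : t * L (Fa ^+ 2) <= eps / 4.
      by rewrite -tB ler_wpM2l ?(ltW t0)//; lra.
    have t3 : t * L ((Fa + - (Fa * De)) ^+ 2) <= eps / 4.
      by rewrite -tB ler_wpM2l ?(ltW t0)//; lra.
    by rewrite ler_norml; apply/andP; split; lra.
  have far : (2 ^+ D2) ^+ M * (M%:R * ((2 * D2 ^ 2)%:R / N%:R)) * L (Y ^+ 2 * E ^+ N)
      <= eps / 4.
    have N0R : 0 < N%:R :> R by rewrite ltr0n.
    rewrite [leLHS](_ : _ = (2 ^+ D2) ^+ M * (M%:R * (2 * D2 ^ 2)%:R) *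
       L (Y ^+ 2 * E ^+ N) / N%:R); last by ring.
    rewrite ler_pdivrMr// (le_trans (ler_wpM2l _ mass)) ?mulr_ge0 ?exprn_ge0//.
    rewrite -/K (le_trans nK)// /N natrM; lra.
  rewrite h2 in h1; rewrite -/(\prod_i g i ^+ al i) FaE.
  rewrite -(subrKA (L ((Fa + - (Fa * De)) ^+ 2))) (le_trans (ler_normD _ _))//.
  by apply: le_trans (lerD (le_trans h1 far) close) _; lra.
- rewrite mulr_ge0 ?moment_box_ge0// prodr_ge0// => i _.
  have /andP[_ le1] : 0 <= ((l i)%:R / N%:R : R) <= 1.
    by apply: ratio01; rewrite /N ?muln_gt0 ?n0// -ltnS.
  by rewrite !mulr_ge0 ?ffact_scale_ge0// exprn_ge0// subr_ge0.
- exact: node_ge0.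
Qed.

End Bernstein.

(** * Masses of binary words realized on an interval *)

Section IntervalWalk.
Variables (R : realType) (p : seq bool -> R).
Hypothesis p_ge0 : forall w, 0 <= p w.
Hypothesis p_split : forall w, p w = p (rcons w false) + p (rcons w true).

(** The k-th cell containing u together with its left end point: the cell of a
    word w has length p w and is cut into the cells of its two extensions. *)
Fixpoint cell_walk (u : R) k : seq bool * R :=
  if k is k'.+1 then
    let: (w, a) := cell_walk u k' in
    let b := a + p (rcons w false) <= u in
    (rcons w b, if b then a + p (rcons w false) else a)
  else ([::], 0).

Definition walk_bit u k := (cell_walk u k).2 + p (rcons (cell_walk u k).1 false) <= u.

Lemma walkS u k : cell_walk u k.+1 = (rcons (cell_walk u k).1 (walk_bit u k),
  if walk_bit u k then (cell_walk u k).2 + p (rcons (cell_walk u k).1 false) else (cell_walk u k).2).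
Proof. by rewrite /walk_bit /=; case: (cell_walk u k). Qed.

Lemma walk_word u k : (cell_walk u k).1 = mkseq (walk_bit u) k.
Proof. by elim: k => [//|k IH]; rewrite walkS /= {1}IH mkseqS. Qed.

(** The induction carries the end point of the cell along with the word, since
    the next bit is decided by comparing u with the cut point counted from it. *)
Lemma walk_cell w : exists a, (0 <= a /\ a + p w <= p [::]) /\
  forall u, 0 <= u < p [::] -> ((cell_walk u (size w)).1 = w <-> a <= u < a + p w) /\
  ((cell_walk u (size w)).1 = w -> (cell_walk u (size w)).2 = a).
Proof.
elim/last_ind: w => [|w b [a [[a0 ap] IH]]].
  by exists 0; rewrite add0r; split=> // u u01; rewrite add0r; split.
have p0 := p_ge0 (rcons w false); have p1 := p_ge0 (rcons w true); have ps := p_split w.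
exists (if b then a + p (rcons w false) else a); split; first by case: (b); split; lra.
move=> u u01; have [IH1 IH2] := IH u u01; rewrite size_rcons walkS /=.
have fwd : rcons (cell_walk u (size w)).1 (walk_bit u (size w)) = rcons w b ->
  [/\ (cell_walk u (size w)).2 = a, a <= u < a + p w & b = (a + p (rcons w false) <= u)].
  move=> /rcons_inj[e1 e2]; have e3 := IH2 e1; split=> //; first exact/IH1.
  by rewrite -e2 /walk_bit e3 e1.
split; [split|]; last first.
- by move=> h; have [e1 _ e2] := fwd h; move/rcons_inj: h => [-> ->]; rewrite e1.
- move=> h; have /andP[h1 h2] : a <= u < a + p w.
    by move: h; case: (b) => /andP[h1 h2]; apply/andP; split; lra.
  have e1 : (cell_walk u (size w)).1 = w by apply/IH1; rewrite h1.
  rewrite /walk_bit (IH2 e1) e1; congr rcons.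
  by move: h; case: (b) => /andP[h3 h4]; [|apply/negbTE; rewrite -ltNge]; lra.
- move=> /fwd [_ /andP[h1 h2] e] {fwd}.
  by case: b e => /esym e; apply/andP; split=> //; lra.
Qed.

Let a w := sval (cid (walk_cell w)).
Let D : set R := `[0, p [::][%classic.
Let cell w : set R := `[a w, a w + p w[%classic.

Lemma walk_cellP w u : D u -> ((cell_walk u (size w)).1 = w <-> cell w u).
Proof.
rewrite /D /cell /= !in_itv /=.
by move=> u01; have [_ /(_ u u01)[+ _]] := svalP (cid (walk_cell w)).
Qed.

Lemma measurable_cell w : measurable (cell w).
Proof. exact: measurable_itv. Qed.

Lemma measurable_walk_dom : measurable D.
Proof. exact: measurable_itv. Qed.

Lemma walk_indic K (phi : seq bool -> R) u : D u ->
  phi (mkseq (walk_bit u) K) = \sum_(w : K.-tuple bool) phi w * \1_(cell w) u.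
Proof.
move=> Du; rewrite -walk_word.
have sz : size (cell_walk u K).1 == K by rewrite walk_word size_mkseq.
rewrite (bigD1 (Tuple sz))//= indicE mem_set ?mulr1; last first.
  by apply/walk_cellP => //=; rewrite (eqP sz).
rewrite big1 ?addr0// => w wu; rewrite indicE memNset ?mulr0//.
have := walk_cellP w Du => -[_ h] /h; rewrite size_tuple => e.
by move/eqP: wu; apply; apply/val_inj.
Qed.

Lemma cell_measure w : lebesgue_measure (cell w `&` D) = (p w)%:E.
Proof.
have [[a0 ap] _] := svalP (cid (walk_cell w)); rewrite -/(a w) in a0 ap.
have cD : cell w `<=` D.
  move=> u; rewrite /D /cell /= !in_itv /= => /andP[h1 h2].
  by rewrite (le_trans a0)//= (lt_le_trans h2).
rewrite setIidl// lebesgue_measure_itv/= lte_fin ltrDl.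
case: ltP => pw; first by rewrite -EFinB addrAC subrr add0r.
by congr EFin; apply/esym/eqP; rewrite eq_le pw p_ge0.
Qed.

Lemma walk_integral K (phi : seq bool -> R) : (forall w, 0 <= phi w) ->
  measurable_fun D (fun u => phi (mkseq (walk_bit u) K)) /\
  (\int[lebesgue_measure]_(u in D) (phi (mkseq (walk_bit u) K))%:E =
    (\sum_(w : K.-tuple bool) phi w * p w)%:E)%E.
Proof.
move=> phi0; split.
  apply: (@eq_measurable_fun _ _ _ _ _
    (fun u => \sum_(w : K.-tuple bool) phi w * \1_(cell w) u)).
    by move=> u; rewrite inE => Du; rewrite walk_indic.
  apply: measurable_sum => w; apply: measurable_funM => //.
  by apply: measurable_indic; exact: measurable_cell.
transitivity (\int[lebesgue_measure]_(u in D)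
    (\sum_(w : K.-tuple bool) (phi w)%:E * (\1_(cell w) u)%:E)%E)%E.
  apply: eq_integral => u; rewrite inE => Du; rewrite walk_indic// -sumEFin.
  by under eq_bigr do rewrite EFinM.
rewrite ge0_integral_sum//; last 3 first.
- exact: measurable_walk_dom.
- move=> w; apply/measurable_EFinP; apply: measurable_funM => //.
  by apply: measurable_indic; exact: measurable_cell.
- by move=> w u _; rewrite mule_ge0// lee_fin// indicE.
rewrite -sumEFin; apply: eq_bigr => w _.
rewrite ge0_integralZl//=; last 3 first.
- exact: measurable_walk_dom.
- by apply/measurable_EFinP; apply: measurable_indic; exact: measurable_cell.
- by rewrite lee_fin.
rewrite integral_indic; last 2 first.
- exact: measurable_walk_dom.
- exact: measurable_cell.
by rewrite EFinM; congr (_ * _)%E; exact: cell_measure.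
Qed.

End IntervalWalk.

(** Boundedness gives a cluster point in a compact segment, and for an
    ultrafilter a cluster point is a limit. *)
Lemma ultra_bounded_cvg (R : realType) (T : Type) (U : set_system T) (u : T -> R) (B : R) :
  UltraFilter U -> (forall n, 0 <= u n <= B) ->
  exists l : R, 0 <= l /\ u @ U --> l.
Proof.
move=> UU uB.
have UB : U (u @^-1` `[0, B]%classic).
  by apply: filterE => n /=; rewrite in_itv/=; exact: uB.
have [l [/= lB lU]] := @segment_compact R 0 B (u @ U) _ UB.
exists l; split; first by move: lB; rewrite in_itv/= => /andP[].
move=> V nV; have [//|nVU] := @in_ultra_setVsetC _ U (u @^-1` V) UU.
exfalso; have [x [/= nx Vx]] := lU (~` V) V nVU nV; exact: nx.
Qed.

(** Masses of words for a sequence of discrete measures converge simultaneously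
    along one ultrafilter, so no diagonal extraction is needed, and the limits
    are again additive under extension of words. *)
Lemma random_bits (R : realType) (T : nat -> finType) (W : forall n, T n -> R)
    (beta : forall n, T n -> nat -> bool) (B : R) :
  (forall n t, 0 <= W n t) -> (forall n, \sum_t W n t <= B) ->
  exists (U : set_system nat) (c : R) (b : R -> nat -> bool),
  [/\ ProperFilter U, \oo `<=` U, 0 <= c &
    forall K (phi : seq bool -> R), (forall w, 0 <= phi w) ->
    measurable_fun `[0, c[%classic (fun u => phi (mkseq (b u) K)) /\
    exists a, (\int[lebesgue_measure]_(u in `[0%R, c[%classic) (phi (mkseq (b u) K))%:E = a%:E)%E
      /\ (fun n => \sum_t W n t * phi (mkseq (beta n t) K)) @ U --> a].
Proof.
move=> W0 WB; have [U [UU sU]] := @ultraFilterLemma _ (\oo : set_system nat) _.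
have pU : ProperFilter U by exact: ultra_proper.
pose mass n w := \sum_(t | mkseq (beta n t) (size w) == w) W n t.
have massB n w : 0 <= mass n w <= B.
  rewrite sumr_ge0//= (le_trans _ (WB n))//.
  by rewrite [leRHS](bigID (fun t => mkseq (beta n t) (size w) == w))/= lerDl sumr_ge0.
have massS n w : mass n w = mass n (rcons w false) + mass n (rcons w true).
  rewrite /mass !size_rcons (bigID (fun t => beta n t (size w)))/= addrC; congr (_ + _);
    apply: eq_bigl => t; rewrite mkseqS eqseq_rcons.
    by rewrite eqbF_neg.
  by rewrite eqb_id.
pose p w := sval (cid (@ultra_bounded_cvg R _ U (mass ^~ w) B UU (massB ^~ w))).
have p0 w : 0 <= p w by rewrite /p; case: cid => l [].
have pl w : mass ^~ w @ U --> p w by rewrite /p; case: cid => l [].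
have ps w : p w = p (rcons w false) + p (rcons w true).
  have h : mass ^~ w @ U --> p (rcons w false) + p (rcons w true).
    rewrite (_ : mass ^~ w = mass ^~ (rcons w false) \+ mass ^~ (rcons w true)).
      by apply: cvgD; exact: pl.
    by apply/funext => n; rewrite /= massS.
  exact: cvg_unique (pl w) h.
exists U, (p [::]), (walk_bit p); split=> // K phi phi0.
have [h1 h2] := walk_integral p0 ps K phi0; split=> //.
exists (\sum_(w : K.-tuple bool) phi w * p w); split=> //.
rewrite (_ : (fun n => _) = fun n => \sum_(w : K.-tuple bool) phi w * mass n w).
  apply: cvg_big => [|w _]; first exact: add_continuous.
  by apply: cvgMr; exact: pl.
apply/funext => n.
rewrite (partition_big (fun t => Tuple (introT eqP (size_mkseq (beta n t) K))) predT)//=.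
apply: eq_bigr => w _; rewrite /mass mulr_sumr size_tuple.
rewrite (eq_bigl (fun t => mkseq (beta n t) K == w)); last by move=> t; rewrite -val_eqE.
by apply: eq_bigr => t /eqP <-; rewrite mulrC.
Qed.

(** * Binary digits of points of the half line *)

Section BinaryDigits.
Variable R : realType.

Fixpoint bin_remainder (x : R) j : R :=
  if j is j'.+1 then
    if 2^-1 <= bin_remainder x j' then 2 * bin_remainder x j' - 1 else 2 * bin_remainder x j'
  else x.

Definition digit (x : R) j := 2^-1 <= bin_remainder x j.

Definition bin_value (b : nat -> bool) J : R := \sum_(j < J) (b j)%:R / 2 ^+ j.+1.

Lemma bin_remainder01 x j : 0 <= x < 1 -> 0 <= bin_remainder x j < 1.
Proof.
move=> x01; elim: j => [//|j /=]; move: (bin_remainder x j) => r /andP[h0 h1].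
by have [h|h] := leP 2^-1 r; apply/andP; split; lra.
Qed.

Lemma digit_expansion x J : x = bin_value (digit x) J + bin_remainder x J / 2 ^+ J.
Proof.
elim: J => [|J IH]; first by rewrite /bin_value big_ord0 add0r expr0 divr1.
rewrite {1}IH /bin_value big_ord_recr/= -addrA; congr (_ + _).
have e : (2 ^+ J != 0 :> R) by rewrite expf_neq0.
by rewrite /digit exprS; case: ifP => _ /=; field.
Qed.

Lemma bin_value_ge0 b J : 0 <= bin_value b J.
Proof. by apply: sumr_ge0 => j _; rewrite divr_ge0 ?exprn_ge0. Qed.

Lemma bin_value_lt1 b J : bin_value b J < 1.
Proof.
have h : bin_value b J <= 1 - (2 ^+ J)^-1.
  elim: J => [|J IH]; first by rewrite /bin_value big_ord0 expr0 invr1 subrr.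
  rewrite /bin_value big_ord_recr/=; apply: (@le_trans _ _ (1 - (2 ^+ J)^-1 + (2 ^+ J.+1)^-1)).
    apply: lerD => //; rewrite ler_piMl ?invr_ge0 ?exprn_ge0//.
    by case: (b J).
  have e : (2 ^+ J != 0 :> R) by rewrite expf_neq0.
  by rewrite exprS le_eqVlt; apply/orP; left; apply/eqP; field.
apply: le_lt_trans h _; rewrite gtrBl invr_gt0; exact: exprn_gt0.
Qed.

Lemma bin_value_nondecreasing b : {homo bin_value b : m n / (m <= n)%N >-> m <= n}.
Proof.
apply: homo_leq => [x|y x z|J]; [exact: lexx|exact: le_trans|].
by rewrite /bin_value big_ord_recr/= lerDl divr_ge0 ?exprn_ge0.
Qed.

(** The inverse of [unit_coord], from [0, 1[ to the half line. *)
Definition odds (x : R) := x / (1 - x).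

Lemma odds_le x y : 0 <= x -> x <= y -> y < 1 -> odds x <= odds y.
Proof.
move=> x0 xy y1; have x1 : x < 1 by exact: le_lt_trans y1.
rewrite /odds ler_pdivrMr ?subr_gt0// mulrAC ler_pdivlMr ?subr_gt0//.
by rewrite !mulrBr !mulr1 [y * x]mulrC lerD2r.
Qed.

Lemma odds_ge0 x : 0 <= x -> x < 1 -> 0 <= odds x.
Proof. by move=> x0 x1; rewrite divr_ge0// subr_ge0 ltW. Qed.

Definition unit_coord (t : R) := t / (1 + t).

Lemma unit_coord01 t : 0 <= t -> 0 <= unit_coord t < 1.
Proof.
move=> t0; have t1 : 0 < 1 + t by rewrite ltr_pwDl.
by rewrite divr_ge0 ?(ltW t1)//= ltr_pdivrMr// mul1r ltrDr.
Qed.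

(** Truncating the digits of t / (1 + t) approximates t from below, with an
    error controlled by a polynomial in t: moments of slightly higher degree
    therefore control the loss of mass near infinity. *)
Lemma odds_trunc t J : 0 <= t ->
  let s := odds (bin_value (digit (unit_coord t)) J) in
  0 <= s <= t /\ t - s <= (2 ^+ J)^-1 * (1 + t) ^+ 2.
Proof.
move=> t0; have t1 : 0 < 1 + t by rewrite ltr_pwDl.
set x := unit_coord t; set y := bin_value _ J => /=.
have x01 : 0 <= x < 1 by exact: unit_coord01.
have /andP[x0 x1] := x01.
have tE : t = odds x by rewrite /odds /x /unit_coord; field; lra.
have xyE := digit_expansion x J; rewrite -/y in xyE.
have /andP[r0 r1] := bin_remainder01 J x01.
have p0 : 0 < (2 ^+ J)^-1 :> R by rewrite invr_gt0 exprn_gt0.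
have yx : y <= x by rewrite xyE lerDl mulr_ge0// ltW.
have xy : x - y <= (2 ^+ J)^-1.
  by rewrite {1}xyE addrAC subrr add0r ler_piMl// ltW.
have y0 : 0 <= y by exact: bin_value_ge0.
have y1 : y < 1 by exact: bin_value_lt1.
have st : odds y <= t by rewrite tE odds_le.
split; first by rewrite odds_ge0.
have i1 : (1 - x)^-1 = 1 + t by rewrite /x /unit_coord; field; lra.
have i2 : (1 - y)^-1 <= 1 + t by rewrite -i1 lef_pV2 ?posrE ?subr_gt0// lerB.
have -> : t - odds y = (x - y) * ((1 - x)^-1 * (1 - y)^-1).
  by rewrite tE /odds; field; rewrite !subr_eq0 !gt_eqF.
have k0 : 0 <= (1 - y)^-1 by rewrite invr_ge0 subr_ge0 ltW.
apply: ler_pM => //; rewrite ?subr_ge0// ?mulr_ge0 ?i1// ?(ltW t1)//.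
by rewrite expr2 ler_wpM2l// ltW.
Qed.

Lemma expr_trunc (d s t : R) a : 0 <= d -> 0 <= s <= t -> t - s <= d * (1 + t) ^+ 2 ->
  t ^+ a - s ^+ a <= a%:R * d * (1 + t) ^+ a.+1.
Proof.
move=> d0 /andP[s0 st] h; have t0 : 0 <= t by exact: le_trans st.
have t1 : 0 <= 1 + t by rewrite addr_ge0.
elim: a => [|a IH]; first by rewrite !expr0 subrr !mul0r.
have -> : t ^+ a.+1 - s ^+ a.+1 = t * (t ^+ a - s ^+ a) + (t - s) * s ^+ a.
  by rewrite !exprS; ring.
have -> : a.+1%:R * d * (1 + t) ^+ a.+2 =
   (1 + t) * (a%:R * d * (1 + t) ^+ a.+1) + (d * (1 + t) ^+ 2) * (1 + t) ^+ a.
  by rewrite -natr1 !exprS; ring.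
have sa : s ^+ a <= (1 + t) ^+ a.
  by rewrite lerXn2r ?nnegrE// (le_trans st)// lerDr.
apply: lerD; last by apply: ler_pM => //; rewrite ?subr_ge0 ?exprn_ge0.
apply: (@le_trans _ _ ((1 + t) * (t ^+ a - s ^+ a))).
  by rewrite ler_wpM2r ?lerDr// subr_ge0 lerXn2r ?nnegrE.
by rewrite ler_wpM2l.
Qed.

Lemma prod_trunc (I : finType) (al : I -> nat) (d : R) (s t : I -> R) : 0 <= d ->
  (forall i, 0 <= s i <= t i /\ t i - s i <= d * (1 + t i) ^+ 2) ->
  \prod_i t i ^+ al i - \prod_i s i ^+ al i
    <= d * ((\sum_i al i)%:R * \prod_i (1 + t i) ^+ (al i).+1).
Proof.
move=> d0 h; rewrite natr_sum.
suff: [/\ \prod_i t i ^+ al i - \prod_i s i ^+ al i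
    <= d * ((\sum_i (al i)%:R) * \prod_i (1 + t i) ^+ (al i).+1),
   0 <= \prod_i s i ^+ al i <= \prod_i t i ^+ al i,
   \prod_i t i ^+ al i <= \prod_i (1 + t i) ^+ (al i).+1 & 0 <= \sum_i (al i)%:R :> R] by case.
elim: (index_enum I) => [|i r].
  by rewrite !big_nil subrr !mul0r mulr0 !lexx ler01.
rewrite !big_cons; move: (\prod_(j <- r) (1 + _) ^+ _) (\sum_(j <- r) _).
move: (\prod_(j <- r) s _ ^+ _) (\prod_(j <- r) t _ ^+ _).
move=> S T Q A [h1 /andP[S0 ST] TQ A0].
have [st1 st2] := h i; have /andP[s0 st] := st1.
have t0 : 0 <= t i by exact: le_trans st.
have e1 := expr_trunc (al i) d0 st1 st2.
have e2 : s i ^+ al i <= t i ^+ al i by rewrite lerXn2r ?nnegrE.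
have u0 : 0 <= s i ^+ al i by rewrite exprn_ge0.
have T0 : 0 <= T by exact: le_trans ST.
have q1 : t i ^+ al i <= (1 + t i) ^+ (al i).+1.
  apply: (@le_trans _ _ ((1 + t i) ^+ (al i))); first by rewrite lerXn2r ?nnegrE ?addr_ge0// lerDr.
  by apply: ler_weXn2l => //; rewrite lerDl.
have q0 : 0 <= (1 + t i) ^+ (al i).+1 by rewrite exprn_ge0// addr_ge0.
split.
- have -> : t i ^+ al i * T - s i ^+ al i * S =
     (t i ^+ al i - s i ^+ al i) * T + s i ^+ al i * (T - S) by ring.
  rewrite [leRHS](_ : _ = (al i)%:R * d * (1 + t i) ^+ (al i).+1 * Q +
     (1 + t i) ^+ (al i).+1 * (d * (A * Q))); last by ring.
  apply: lerD.
    apply: (@le_trans _ _ ((al i)%:R * d * (1 + t i) ^+ (al i).+1 * T)).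
      by rewrite ler_wpM2r.
    by rewrite ler_wpM2l// !mulr_ge0.
  by apply: ler_pM => //; rewrite ?subr_ge0// (le_trans e2).
- by rewrite mulr_ge0//= ler_pM.
- by rewrite ler_pM// (le_trans u0).
- by rewrite addr_ge0.
Qed.

Lemma expr1D_le (t : R) b : 0 <= t -> (1 + t) ^+ b <= 2 ^+ b * (1 + t ^+ b).
Proof.
move=> t0; rewrite mulrDr mulr1 -exprMn; have [t1|t1] := leP t 1.
  rewrite (@le_trans _ _ (2 ^+ b))//.
    by rewrite lerXn2r ?nnegrE ?addr_ge0//; lra.
  by rewrite lerDl exprn_ge0// mulr_ge0.
rewrite (@le_trans _ _ ((2 * t) ^+ b))//.
  by rewrite lerXn2r ?nnegrE ?addr_ge0 ?mulr_ge0//; lra.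
by rewrite lerDr exprn_ge0.
Qed.

(** The truncation error is bounded by finitely many moments, uniformly in the
    number of digits. *)
Lemma prod1D_le (I : finType) (b : I -> nat) (t : I -> R) : (forall i, 0 <= t i) ->
  \prod_i (1 + t i) ^+ b i <= 2 ^+ (\sum_i b i) *
    \sum_(e : {ffun I -> bool}) \prod_i t i ^+ (e i * b i).
Proof.
move=> t0.
have -> : \sum_(e : {ffun I -> bool}) \prod_i t i ^+ (e i * b i) =
    \prod_i (1 + t i ^+ b i).
  rewrite -(bigA_distr_bigA (fun i (e : bool) => t i ^+ (e * b i))).
  apply: eq_bigr => i _; rewrite (bigD1 false)//= mul0n expr0; congr (_ + _).
  by rewrite (big_pred1 true) ?mul1n// => -[].
rewrite expr_sum -big_split/=; apply: ler_prod => i _.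
by rewrite exprn_ge0 ?addr_ge0//= expr1D_le.
Qed.

End BinaryDigits.

(** * Realization of limits of moments *)

Section MomentRealization.
Variables (R : realType) (M : nat) (ell : ('I_M -> nat) -> R).
Hypothesis M_gt0 : (0 < M)%N.
Hypothesis approximable : forall (D : nat) (eps : R), 0 < eps ->
  exists (T : finType) (W : T -> R) (x : T -> 'I_M -> R),
    [/\ forall t, 0 <= W t, forall t i, 0 <= x t i &
      forall al : 'I_M -> nat, (forall i, (al i <= D)%N) ->
      `|\sum_t W t * \prod_i x t i ^+ al i - ell al| <= eps].

(** A point of the orthant is coded by one binary sequence, in which the digits
    of its M coordinates alternate. *)
Definition interleave (x : 'I_M -> R) (k : nat) : bool :=
  digit (unit_coord (x (Ordinal (ltn_pmod k M_gt0)))) (k %/ M).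

Definition channel (b : nat -> bool) (i : 'I_M) (j : nat) : bool := b (j * M + i)%N.

Definition dyadic_coord (b : nat -> bool) (i : 'I_M) J : R :=
  odds (bin_value R (channel b i) J).

Lemma channel_interleave x i : channel (interleave x) i =1 digit (unit_coord (x i)).
Proof.
move=> j; rewrite /channel /interleave divnMDl// divn_small// addn0.
by congr digit; congr unit_coord; congr x; apply/val_inj; rewrite /= modnMDl modn_small.
Qed.

Lemma dyadic_coord_interleave x i J :
  dyadic_coord (interleave x) i J = odds (bin_value R (digit (unit_coord (x i))) J).
Proof.
by congr odds; apply: eq_bigr => j _; rewrite channel_interleave.
Qed.

Lemma dyadic_coord_mkseq b i J :
  dyadic_coord (nth false (mkseq b (J * M))) i J = dyadic_coord b i J.
Proof.
congr odds; apply: eq_bigr => j _; rewrite /channel nth_mkseq//.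
apply: (@leq_trans (j.+1 * M)%N); last by rewrite leq_mul2r ltn_ord orbT.
by rewrite mulSn addnC ltn_add2r.
Qed.

Lemma dyadic_coord_ge0 b i J : 0 <= dyadic_coord b i J.
Proof. by rewrite odds_ge0 ?bin_value_ge0 ?bin_value_lt1. Qed.

Lemma dyadic_coord_nondecreasing b i :
  {homo dyadic_coord b i : m n / (m <= n)%N >-> m <= n}.
Proof.
by move=> m n mn; rewrite odds_le ?bin_value_ge0 ?bin_value_lt1 ?bin_value_nondecreasing.
Qed.

Lemma moment_limit (T : nat -> finType)
    (W : forall n, T n -> R) (x : forall n, T n -> 'I_M -> R) (al : 'I_M -> nat) :
  (forall n (al : 'I_M -> nat), (forall i, (al i <= n)%N) ->
      `|\sum_t W n t * \prod_i x n t i ^+ al i - ell al| <= n.+1%:R^-1) ->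
  (fun n => \sum_t W n t * \prod_i x n t i ^+ al i) @ \oo --> ell al.
Proof.
move=> h; apply/cvgrPdist_le => e e0.
have [N hN] : exists N, forall n, (N <= n)%N -> n.+1%:R^-1 <= e.
  exists (Num.truncn e^-1) => n Nn; rewrite -[leRHS]invrK lef_pV2 ?posrE ?invr_gt0//.
  by rewrite (le_trans (ltW (truncnS_gt _)))// ler_nat.
exists (N + \sum_i al i)%N => // n /= Nn; rewrite distrC.
apply: le_trans (h n al _) (hN n _) => [i|]; last by rewrite (leq_trans _ Nn)// leq_addr.
by rewrite (leq_trans _ Nn)// (bigD1 i)//= addnCA leq_addr.
Qed.

(** For a fixed number J of digits the integrands depend on finitely many bits,
    so [random_bits] gives their integrals as ultrafilter limits; by [odds_trunc]
    these limits differ from the moments by at most a constant times 2^(-J). *)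
Lemma dyadic_moments : exists (c : R) (b : R -> nat -> bool), 0 <= c /\
  forall al : 'I_M -> nat,
  (forall J, measurable_fun `[0, c[%classic
     (fun u => \prod_i dyadic_coord (b u) i J ^+ al i)) /\
  (fun J => \int[lebesgue_measure]_(u in `[0%R, c[%classic)
     (\prod_i dyadic_coord (b u) i J ^+ al i)%:E)%E @ \oo --> (ell al)%:E.
Proof.
have e0 n : 0 < (n.+1%:R^-1 : R) by rewrite invr_gt0.
have [T [W [x [W0 x0 mom]]]] : exists (T : nat -> finType) (W : forall n, T n -> R)
   (x : forall n, T n -> 'I_M -> R), [/\ forall n t, 0 <= W n t,
     forall n t i, 0 <= x n t i & forall n (al : 'I_M -> nat), (forall i, (al i <= n)%N) ->
      `|\sum_t W n t * \prod_i x n t i ^+ al i - ell al| <= n.+1%:R^-1].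
  pose data := {T : finType & ((T -> R) * (T -> 'I_M -> R))%type}.
  pose good n (s : data) := [/\ forall t, 0 <= (projT2 s).1 t,
    forall t i, 0 <= (projT2 s).2 t i & forall al : 'I_M -> nat, (forall i, (al i <= n)%N) ->
    `|\sum_t (projT2 s).1 t * \prod_i (projT2 s).2 t i ^+ al i - ell al| <= n.+1%:R^-1].
  have ex n : exists s, good n s.
    have [T [W [x h]]] := approximable n (e0 n).
    by exists (existT (fun T : finType => ((T -> R) * (T -> 'I_M -> R))%type) T (W, x)).
  pose s n := sval (cid (ex n)); pose hs n : good n (s n) := svalP (cid (ex n)).
  exists (fun n => projT1 (s n)), (fun n => (projT2 (s n)).1), (fun n => (projT2 (s n)).2).
  by split=> n; have [] := hs n.
have total n : \sum_t W n t <= ell (fun=> 0%N) + 1.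
  have := mom n (fun=> 0%N) (fun=> leq0n _); rewrite ler_norml => /andP[_].
  rewrite lerBlDl (eq_bigr (fun t => W n t)); last first.
    by move=> t _; rewrite big1 ?mulr1// => i _; rewrite expr0.
  by move/le_trans; apply; rewrite lerD2l invf_le1// ler1n.
have [U [c [b [pU sU c0 rb]]]] :=
  @random_bits R T W (fun n t => interleave (x n t)) _ W0 total.
exists c, b; split=> // al.
pose phi J (w : seq bool) := \prod_i dyadic_coord (nth false w) i J ^+ al i : R.
have phi0 J w : 0 <= phi J w.
  by apply: prodr_ge0 => i _; rewrite exprn_ge0 ?dyadic_coord_ge0.
have phiE J v : phi J (mkseq v (J * M)) = \prod_i dyadic_coord v i J ^+ al i.
  by apply: eq_bigr => i _; rewrite dyadic_coord_mkseq.
split=> [J|].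
  have [mf _] := rb (J * M)%N (phi J) (phi0 J).
  apply: eq_measurable_fun mf => u _; exact: phiE.
pose I (a : 'I_M -> nat) n := \sum_t W n t * \prod_i x n t i ^+ a i.
have limU a : I a @ U --> ell a.
  by move=> V hV; apply: sU; have := @moment_limit T W x a mom V hV.
pose K : R := (\sum_i al i)%:R * 2 ^+ (\sum_i (al i).+1).
pose S n := \sum_(e : {ffun 'I_M -> bool}) I (fun i => (e i * (al i).+1)%N) n.
pose C : R := \sum_(e : {ffun 'I_M -> bool}) ell (fun i => (e i * (al i).+1)%N).
have limS : S @ U --> C.
  by apply: cvg_big => [|e _]; [exact: add_continuous|exact: limU].
have trunc J n t i : 0 <= dyadic_coord (interleave (x n t)) i J <= x n t i /\
    x n t i - dyadic_coord (interleave (x n t)) i J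
      <= (2 ^+ J)^-1 * (1 + x n t i) ^+ 2.
  by rewrite dyadic_coord_interleave; apply: odds_trunc.
have J0 J : 0 <= (2 ^+ J)^-1 :> R by rewrite invr_ge0 exprn_ge0.
have upper J n : \sum_t W n t * phi J (mkseq (interleave (x n t)) (J * M)) <= I al n.
  apply: ler_sum => t _; rewrite ler_wpM2l// phiE; apply: ler_prod => i _.
  have [/andP[s0 st] _] := trunc J n t i.
  by rewrite exprn_ge0//= lerXn2r ?nnegrE.
have lower J n : I al n - (2 ^+ J)^-1 * (K * S n)
    <= \sum_t W n t * phi J (mkseq (interleave (x n t)) (J * M)).
  rewrite lerBlDl -lerBlDr /I -sumrB /S exchange_big/= !mulr_sumr.
  apply: ler_sum => t _; rewrite -mulrBr phiE -mulr_sumr.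
  rewrite [leRHS](_ : _ = W n t * ((2 ^+ J)^-1 * (K *
    \sum_(e : {ffun 'I_M -> bool}) \prod_i x n t i ^+ (e i * (al i).+1)))); last by ring.
  rewrite ler_wpM2l//.
  apply: le_trans (prod_trunc al (J0 J) (trunc J n t)) _.
  by rewrite ler_wpM2l// /K -mulrA ler_wpM2l// prod1D_le.
have bounds J : exists a, [/\ \int[lebesgue_measure]_(u in `[0%R, c[%classic)
     (\prod_i dyadic_coord (b u) i J ^+ al i)%:E = a%:E,
     (a <= ell al)%R & (ell al - (2 ^+ J)^-1 * (K * C) <= a)%R]%E.
  have [_ [a [ia la]]] := rb (J * M)%N (phi J) (phi0 J).
  exists a; split.
  - by rewrite -ia; apply: eq_integral => u _; rewrite phiE.
  - by apply: (ler_cvg_to la (limU al)); apply: nearW => n; exact: upper.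
  - have lim : (fun n => I al n - (2 ^+ J)^-1 * (K * S n)) @ U -->
        ell al - (2 ^+ J)^-1 * (K * C).
      by apply: cvgB; [exact: limU|apply: cvgMr; apply: cvgMr; exact: limS].
    by apply: (ler_cvg_to lim la); apply: nearW => n; exact: lower.
pose a J := sval (cid (bounds J)).
have aE J : (\int[lebesgue_measure]_(u in `[0%R, c[%classic)
     (\prod_i dyadic_coord (b u) i J ^+ al i)%:E)%E = (a J)%:E.
  by rewrite /a; case: cid => /= ? [].
under eq_cvg do rewrite aE.
suff lima : a @ \oo --> ell al by apply: cvg_EFin; [exact: nearW|exact: lima].
have low : (fun J => ell al - (2 ^+ J)^-1 * (K * C)) @ \oo --> ell al.
  rewrite -[X in _ --> X]subr0 -(mul0r (K * C)); apply: cvgB; first exact: cvg_cst.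
  apply: cvgMl; rewrite (_ : (fun J => (2 ^+ J)^-1) = fun J => (2^-1 : R) ^+ J).
    by apply: cvg_expr; rewrite ger0_norm; lra.
  by apply/funext => J; rewrite exprVn.
apply: (squeeze_cvgr _ low (cvg_cst (ell al))).
by apply: nearW => J; rewrite /a /=; case: cid => /= ? [_ -> ->].
Qed.

End MomentRealization.

(** The truncated coordinates increase with J, and monotone convergence passes
    their moments to the limit.  The limit coordinates are finite almost
    everywhere because their first moments are; [fine] sends the exceptional
    values to 0. *)
Lemma moment_realization (R : realType) (M : nat) (ell : ('I_M -> nat) -> R) :
  (0 < M)%N ->
  (forall (D : nat) (eps : R), 0 < eps ->
  exists (T : finType) (W : T -> R) (x : T -> 'I_M -> R),
    [/\ forall t, 0 <= W t, forall t i, 0 <= x t i &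
      forall al : 'I_M -> nat, (forall i, (al i <= D)%N) ->
      `|\sum_t W t * \prod_i x t i ^+ al i - ell al| <= eps]) ->
  exists (c : R) (X : 'I_M -> R -> R),
  [/\ forall i, measurable_fun `[0, c[%classic (X i),
     forall i u, 0 <= X i u & forall al : 'I_M -> nat,
     (\int[lebesgue_measure]_(u in `[0%R, c[%classic) (\prod_i X i u ^+ al i)%:E
       = (ell al)%:E)%E].
Proof.
move=> M_gt0 approx; have [c [b [c0 db]]] := dyadic_moments M_gt0 approx.
set D : set R := `[0, c[%classic.
have mD : measurable D by exact: measurable_itv.
pose mu := [the {measure set (measurableTypeR R) -> \bar R} of @lebesgue_measure R].
pose t (i : 'I_M) J (u : R) := dyadic_coord R (b u) i J.
pose Te i u : \bar R := limn (fun J => (t i J u)%:E).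
have t0 i J u : 0 <= t i J u by exact: dyadic_coord_ge0.
have tnd i u : {homo (fun J => (t i J u)%:E) : m n / (m <= n)%N >-> (m <= n)%E}.
  by move=> m n mn; rewrite lee_fin dyadic_coord_nondecreasing.
have tcv i u : (fun J => (t i J u)%:E) @ \oo --> Te i u.
  exact: ereal_nondecreasing_is_cvgn.
have Te0 i u : (0 <= Te i u)%E.
  by apply: lime_ge; [exact: ereal_nondecreasing_is_cvgn|apply: nearW => J; rewrite lee_fin].
pose G (al : 'I_M -> nat) J u := \prod_i t i J u ^+ al i : R.
have G0 al J u : 0 <= G al J u by apply: prodr_ge0 => i _; rewrite exprn_ge0.
have mG al J : measurable_fun D (fun u => (G al J u)%:E).
  by apply/measurable_EFinP; have [+ _] := db al; apply.
have Gnd al u : {homo (fun J => (G al J u)%:E) : m n / (m <= n)%N >-> (m <= n)%E}.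
  move=> m n mn; rewrite lee_fin; apply: ler_prod => i _.
  by rewrite exprn_ge0//= lerXn2r ?nnegrE// dyadic_coord_nondecreasing.
have intG al : (\int[lebesgue_measure]_(u in D) limn (fun J => (G al J u)%:E) = (ell al)%:E)%E.
  have [_ lim] := db al.
  have G0' J u : D u -> (0 <= (G al J u)%:E)%E by rewrite lee_fin.
  have h1 := cvg_monotone_convergence (mu := lebesgue_measure) mD (mG al) G0' (fun u _ => Gnd al u).
  exact: (cvg_unique _ h1 lim).
have G1 i J u : G (fun k => (k == i) : nat) J u = t i J u.
  by rewrite /G (bigD1 i)//= eqxx expr1 big1 ?mulr1// => k /negbTE ->; rewrite expr0.
have mt i J : measurable_fun D (fun u => (t i J u)%:E).
  by under eq_fun do rewrite -G1; exact: mG.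
have mTe i : measurable_fun D (Te i).
  by apply: (emeasurable_fun_cvg (fun J u => (t i J u)%:E)) => // u _; exact: tcv.
have fin : {ae mu, forall u, D u -> forall i, Te i u \is a fin_num}.
  have : \forall u \near almost_everywhere mu,
      forall i : 'I_M, D u -> Te i u \is a fin_num.
    apply: filter_forall => i; apply: integrable_ae => //; apply/integrableP; split; first exact: mTe.
    apply: (@le_lt_trans _ _ (ell (fun k => (k == i) : nat))%:E); last exact: ltry.
    rewrite -intG le_eqVlt; apply/orP; left; apply/eqP.
    apply: eq_integral => u _; rewrite gee0_abs// /Te.
    by congr (limn _); apply/funext => J; rewrite G1.
  by apply: (@filterS _ _ (ae_filter_ringOfSetsType mu)) => u h Du i; exact: h.
have mX i : measurable_fun D (fun u => fine (Te i u)).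
  exact: measurableT_comp (fine_measurable measurableT) (mTe i).
exists c, (fun (i : 'I_M) (u : R) => fine (Te i u)); split=> [i|i u|al].
- exact: mX.
- exact: fine_ge0.
rewrite -intG; apply: ae_eq_integral => //.
- apply/measurable_EFinP; apply: measurable_prod => i _; apply: measurable_funX; exact: mX.
- apply: (emeasurable_fun_cvg (fun J u => (G al J u)%:E)) => // u _.
  exact: ereal_nondecreasing_is_cvgn.
apply: (@filterS _ _ (ae_filter_ringOfSetsType mu) _ _ _ fin) => u h Du; apply/esym/cvg_lim => //.
apply: cvg_EFin; first by apply: nearW.
have lt i : (fun J => t i J u) @ \oo --> fine (Te i u).
  have h1 : (fun J => (t i J u)%:E) @ \oo --> (fine (Te i u))%:E.
    by rewrite fineK ?h//; exact: tcv.
  exact: (fine_cvg h1).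
have lG : (fun J => G al J u) @ \oo --> \prod_i fine (Te i u) ^+ al i.
  apply: cvg_big => [|i _]; first exact: mul_continuous.
  exact: (cvg_comp _ _ (lt i) (@exprn_continuous _ _ _)).
exact: lG.
Qed.

(** * Finite Borel measures on R^d are Radon *)

Section BorelRn.
Variables (R : realType) (d : nat).
Local Notation rV := 'rV[R]_d.

(** A countable family of compact boxes, in which every open set is a union of
    members. *)
Definition rat_box (q : {ffun 'I_d -> rat}) (r : nat) : set rV :=
  [set x | forall i, `|x ord0 i - ratr (q i)| <= r.+1%:R^-1].

Lemma rat_box_compact q r : compact (rat_box q r).
Proof.
rewrite (_ : rat_box q r = [set v : rV | forall i,
    `[ratr (q i) - r.+1%:R^-1, ratr (q i) + r.+1%:R^-1]%classic (v ord0 i)]).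
  exact: (@rV_compact R d (fun i => `[ratr (q i) - r.+1%:R^-1, ratr (q i) + r.+1%:R^-1]%classic)
    (fun i => @segment_compact R _ _)).
by apply/seteqP; split => x /= h i; have := h i; rewrite /= in_itv/= -ler_distl.
Qed.

Lemma compact_closed_rV (K : set rV) : compact K -> closed K.
Proof. by apply: compact_closed => p q; exact: (@norm_hausdorff R rV). Qed.

Lemma open_rat_box (U : set rV) (x : rV) : open U -> U x ->
  exists q r, rat_box q r `<=` U /\ rat_box q r x.
Proof.
move=> oU Ux; have /nbhs_ballP[e /= e0 eU] : nbhs x U by exact: open_nbhs_nbhs.
pose r := Num.truncn (2 / e); pose s : R := r.+1%:R^-1.
have s0 : 0 < s by rewrite invr_gt0.
have se : 2 * s < e.
  by rewrite /s mulrC ltr_pdivrMl// -ltr_pdivrMr// truncnS_gt.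
have hq i : exists q : rat, `|x ord0 i - ratr q| < s.
  have [|q] := @rat_in_itvoo R (x ord0 i - s) (x ord0 i + s); first by lra.
  by rewrite in_itv/= => /andP[h1 h2]; exists q; rewrite ltr_norml; apply/andP; split; lra.
exists [ffun i => sval (cid (hq i))], r; split; last first.
  by move=> i; rewrite ffunE; apply: ltW; exact: svalP (cid (hq i)).
move=> y yb; apply: eU; split=> //= i j; rewrite !ord1.
have := yb j; have := svalP (cid (hq j)); rewrite ffunE -/s => h1 h2.
rewrite /ball/= (le_lt_trans _ se)// -(subrKA (ratr (sval (cid (hq j))))).
rewrite (le_trans (ler_normD _ _))// [2 * s]mulr_natl mulr2n lerD ?(ltW h1)//.
by rewrite distrC.
Qed.

Lemma open_bigcup_rat_box (U : set rV) : open U ->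
  exists B : nat -> set rV,
    (forall n, B n = set0 \/ exists q r, B n = rat_box q r) /\ U = \bigcup_n B n.
Proof.
move=> oU.
pose B n : set rV := if unpickle n is Some k then
  if `[< rat_box k.1 k.2 `<=` U >] then rat_box k.1 k.2 else set0 else set0.
exists B; split=> [n|].
  rewrite /B; case: unpickle => [[q r]|]; last by left.
  by case: asboolP => _; [right; exists q, r|left].
apply/seteqP; split => [x Ux|x [n _]].
  have [q [r [bU bx]]] := open_rat_box oU Ux.
  by exists (pickle (q, r)) => //; rewrite /B pickleK /= asboolT.
rewrite /B; case: unpickle => [[q r]|//].
by case: asboolP => // h; exact: h.
Qed.

Lemma measurable_coord (i : 'I_d) :
  measurable_fun setT (fun x : borelRn R d => x ord0 i).
Proof.
apply: (measurability (@RGenOpens.G R)) => [|/= _ [_ [a [b ->]] <-]].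
  exact: RGenOpens.measurableE.
rewrite setTI; apply: sub_sigma_algebra.
by apply: open_comp; [move=> x _; exact: coord_continuous|exact: interval_open].
Qed.

Lemma measurable_to_borelRn disp (T : measurableType disp) (X : T -> borelRn R d) :
  (forall i, measurable_fun setT (fun u => X u ord0 i)) -> measurable_fun setT X.
Proof.
move=> mX; apply: (@measurability _ _ T (borelRn R d) setT X (@open 'rV[R]_d)) => // _ [U oU <-].
rewrite setTI; have [B [Bbox ->]] := open_bigcup_rat_box oU.
rewrite preimage_bigcup; apply: bigcup_measurable => n _.
have [->|[q [r ->]]] := Bbox n; first by rewrite preimage_set0.
have -> : X @^-1` rat_box q r = \bigcap_(i in [set: 'I_d])
    ((fun u => X u ord0 i) @^-1` `[ratr (q i) - r.+1%:R^-1, ratr (q i) + r.+1%:R^-1]%classic).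
  apply/seteqP; split => u /= h i; first by move=> _; rewrite /= in_itv/= -ler_distl.
  by have := h i I; rewrite /= in_itv/= -ler_distl.
apply: fin_bigcap_measurable => // i _.
by rewrite -[X in measurable X]setTI; apply: mX => //; exact: measurable_itv.
Qed.

Lemma measurable_polyfun (p : rpoly R d) :
  measurable_fun setT (polyfun p : borelRn R d -> R).
Proof.
rewrite /polyfun; under eq_fun do rewrite mevalE.
apply: measurable_sum => m; apply: measurable_funM => //.
by apply: measurable_prod => i _; apply: measurable_funX; exact: measurable_coord.
Qed.

Variable mu : {measure set (borelRn R d) -> \bar R}.
Hypothesis mu_fin : (mu setT < +oo)%E.

Local Open Scope ereal_scope.

Lemma finite_measurable A : measurable A -> mu A \is a fin_num.
Proof.
move=> mA; rewrite ge0_fin_numE// (le_lt_trans _ mu_fin)//.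
by apply: le_measure; rewrite ?inE.
Qed.

Lemma bigcup_remainder (A : nat -> set (borelRn R d)) (e : R) :
  (forall n, measurable (A n)) -> (0 < e)%R ->
  exists N, mu (\bigcup_n A n `\` \big[setU/set0]_(n < N) A n) < e%:E.
Proof.
move=> mA e0; set U := \bigcup_n A n; have mU : measurable U by exact: bigcup_measurable.
pose F N := U `\` \big[setU/set0]_(n < N) A n.
have mF N : measurable (F N) by apply: measurableD => //; exact: bigsetU_measurable.
have : mu \o F @ \oo --> mu (\bigcap_N F N).
  apply: nonincreasing_cvg_mu => //.
  - by rewrite (le_lt_trans _ mu_fin)//; apply: le_measure; rewrite ?inE.
  - exact: bigcap_measurable.
  - by move=> m n mn; apply/subsetPset; apply: setDS; exact: subset_bigsetU.
have -> : \bigcap_N F N = set0.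
  apply/seteqP; split => // x h; have [[n _ An] _] := h 0%N I.
  by have [_] := h n.+1 I; apply; rewrite -bigcup_mkord; exists n => /=.
rewrite measure0 => /fine_cvgP[_ /cvgrPdist_lt/(_ e e0)[N _ /(_ N (leqnn N))]].
rewrite /= sub0r normrN ger0_norm ?fine_ge0// => h; exists N.
by rewrite -(fineK (finite_measurable (mF N))) lte_fin.
Qed.

(** Approximation from inside by closed sets, the form of regularity that is
    stable under countable unions and intersections. *)
Definition closed_regular (A : set (borelRn R d)) := forall e : R, (0 < e)%R ->
  exists F : set rV, [/\ closed F, F `<=` A & mu (A `\` F) < e%:E].

Lemma closed_measurable (F : set rV) : closed F -> measurable (F : set (borelRn R d)).
Proof.
by move=> /closed_openC oF; rewrite -[F]setCK; apply: measurableC; exact: sub_sigma_algebra.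
Qed.

Lemma closed_closed_regular (F : set rV) : closed F -> closed_regular F.
Proof. by move=> cF e e0; exists F; split=> //; rewrite setDv measure0 lte_fin. Qed.

Lemma bigcup_closed_regular (A : nat -> set (borelRn R d)) :
  (forall n, measurable (A n)) -> (forall n, closed_regular (A n)) ->
  closed_regular (\bigcup_n A n).
Proof.
move=> mA rA e e0; have e2 : (0 < e / 2)%R by rewrite divr_gt0.
have [N hN] := bigcup_remainder mA e2.
have e3 : (0 < e / 2 / N.+1%:R)%R by rewrite divr_gt0.
pose F n := sval (cid (rA n _ e3)).
have cF n : closed (F n) by rewrite /F; case: cid => ? [].
have FA n : F n `<=` A n by rewrite /F; case: cid => ? [].
have muF n : mu (A n `\` F n) < (e / 2 / N.+1%:R)%:E by rewrite /F; case: cid => ? [].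
have mF n : measurable (F n : set (borelRn R d)) by exact: closed_measurable.
exists (\big[setU/set0]_(n < N) F n); split.
- exact: closed_bigsetU.
- move=> x; rewrite -bigcup_mkord => -[n /= nN Fx]; exists n => //; exact: FA.
have sub : \bigcup_n A n `\` \big[setU/set0]_(n < N) F n `<=`
    (\bigcup_n A n `\` \big[setU/set0]_(n < N) A n) `|`
    \big[setU/set0]_(n < N) (A n `\` F n).
  move=> x [Ax nF]; have [[n nN Anx]|h] := pselect ((\bigcup_(n < N) A n) x).
    right; rewrite -(bigcup_mkord N (fun n => A n `\` F n)); exists n => //; split=> // Fx; apply: nF.
    by rewrite -bigcup_mkord; exists n.
  by left; split=> //; rewrite -bigcup_mkord.
have mD n : measurable (A n `\` F n) by exact: measurableD.
have mS : measurable (\big[setU/set0]_(n < N) (A n `\` F n)) by exact: bigsetU_measurable.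
have mR : measurable (\bigcup_n A n `\` \big[setU/set0]_(n < N) A n).
  by apply: measurableD; [exact: bigcup_measurable|exact: bigsetU_measurable].
apply: le_lt_trans (_ : _ <= mu (\bigcup_n A n `\` \big[setU/set0]_(n < N) A n) +
   mu (\big[setU/set0]_(n < N) (A n `\` F n))) _.
  apply: (@le_trans _ _ (mu (_ `|` _))); last exact: measureU2 mR mS.
  apply: le_measure; rewrite ?inE//; last exact: measurableU.
  by apply: measurableD; [exact: bigcup_measurable|exact: bigsetU_measurable].
have -> : e%:E = (e / 2)%:E + (e / 2)%:E by rewrite -EFinD -splitr.
apply: lte_leD => //; first exact: finite_measurable.
apply: le_trans (@Boole_inequality _ _ _ mu (fun n => A n `\` F n) N (fun n _ => mD n)) _.
apply: (@le_trans _ _ (\sum_(n < N) (e / 2 / N.+1%:R)%:E)).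
  by apply: lee_sum => n _; apply: ltW; exact: muF.
rewrite sumEFin lee_fin sumr_const card_ord -[leLHS]mulr_natl mulrA ler_pdivrMr// mulrC.
by rewrite ler_wpM2l ?ler_nat// ltW.
Qed.

Lemma bigcap_closed_regular (A : nat -> set (borelRn R d)) :
  (forall n, measurable (A n)) -> (forall n, closed_regular (A n)) ->
  closed_regular (\bigcap_n A n).
Proof.
move=> mA rA e e0.
have ek n : (0 < e / 2 / (2 ^ n.+1)%:R)%R by rewrite !divr_gt0// ltr0n expn_gt0.
pose F n := sval (cid (rA n _ (ek n))).
have cF n : closed (F n) by rewrite /F; case: cid => ? [].
have FA n : F n `<=` A n by rewrite /F; case: cid => ? [].
have muF n : mu (A n `\` F n) < (e / 2 / (2 ^ n.+1)%:R)%:E by rewrite /F; case: cid => ? [].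
have mF n : measurable (F n : set (borelRn R d)) by exact: closed_measurable.
exists (\bigcap_n F n); split.
- by apply: closed_bigI => n _.
- by move=> x Fx n _; apply: (FA n); exact: Fx.
have mD n : measurable (A n `\` F n) by exact: measurableD.
have mF' : measurable (\bigcap_n F n : set (borelRn R d)) by exact: bigcap_measurable.
have sub : \bigcap_n A n `\` \bigcap_n F n `<=` \bigcup_n (A n `\` F n).
  move=> x [Ax nF]; apply: contrapT => h; apply: nF => n _.
  by apply: contrapT => nFx; apply: h; exists n => //; split=> //; exact: Ax.
have e2 : (0 <= e / 2)%R by rewrite divr_ge0// ltW.
apply: (@le_lt_trans _ _ (e / 2)%:E); last by rewrite lte_fin ltr_pdivrMr// ltr_pMr// ltr1n.
have mR : measurable (\bigcap_n A n `\` \bigcap_n F n).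
  by apply: measurableD => //; exact: bigcap_measurable.
have subadd : mu (\bigcap_n A n `\` \bigcap_n F n) <= \sum_(n <oo) mu (A n `\` F n).
  exact: measure_sigma_subadditive mD mR sub.
apply: le_trans subadd _.
apply: le_trans (_ : _ <= \sum_(n <oo) (0 + (e / 2 / (2 ^ n.+1)%:R)%:E)) _.
  by apply: lee_nneseries => // n _; rewrite add0e; exact: ltW.
apply: le_trans (epsilon_trick xpredT _ e2) _ => //.
by rewrite eseries0 ?add0e.
Qed.

(** The sets that are regular together with their complement form a
    sigma-algebra; open sets belong to it, being countable unions of compact
    boxes. *)
Lemma borel_closed_regular (A : set (borelRn R d)) : measurable A -> closed_regular A.
Proof.
pose C := [set A : set (borelRn R d) |
  [/\ measurable A, closed_regular A & closed_regular (~` A)]].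
suff: @measurable _ (borelRn R d) `<=` C by move=> h /h [].
apply: smallest_sub; first split => /=.
- split; first exact: measurable0.
    exact: (@closed_closed_regular set0 closed0).
  by rewrite setC0; exact: (@closed_closed_regular setT closedT).
- move=> B [mB rB rCB]; rewrite setTD; split=> //; first exact: measurableC.
  by rewrite setCK.
- move=> F CF; split.
  + by apply: bigcup_measurable => n _; have [] := CF n.
  + by apply: bigcup_closed_regular => n; have [] := CF n.
  + rewrite setC_bigcup; apply: bigcap_closed_regular => n; have [? _ ?] := CF n => //.
    exact: measurableC.
move=> U oU; split; first exact: sub_sigma_algebra; last first.
  by apply: (@closed_closed_regular (~` U)); exact: open_closedC.
have [B [Bbox ->]] := open_bigcup_rat_box oU.
have cB n : closed (B n).
  have [->|[q [r ->]]] := Bbox n; first exact: closed0.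
  by apply: compact_closed_rV; exact: rat_box_compact.
apply: bigcup_closed_regular => n; first exact: closed_measurable.
exact: closed_closed_regular.
Qed.

(** Closed sets are cut down to compact ones by finitely many boxes that carry
    almost all of the mass. *)
Lemma finite_borel_radon : is_radon mu.
Proof.
have cpt_meas (K : set 'rV[R]_d) : compact K -> measurable (K : set (borelRn R d)).
  by move=> /compact_closed_rV; exact: closed_measurable.
rewrite /is_radon; split=> [K cK|A mA].
  by rewrite (le_lt_trans _ mu_fin)//; apply: le_measure; rewrite ?inE//; exact: cpt_meas.
apply/eqP; rewrite eq_le; apply/andP; split; last first.
  apply: ub_ereal_sup => _ [K [cK KA] <-].
  by apply: le_measure; rewrite ?inE//; exact: cpt_meas.
apply/lee_addgt0Pr => e e0; have e2 : (0 < e / 2)%R by rewrite divr_gt0.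
have [F [cF FA muF]] := borel_closed_regular mA e2.
have [B [Bbox BT]] := open_bigcup_rat_box (@openT 'rV[R]_d).
have cB n : compact (B n).
  by have [->|[q [r ->]]] := Bbox n; [exact: compact0|exact: rat_box_compact].
have mB n : measurable (B n : set (borelRn R d)) by exact: cpt_meas.
have [N hN] := bigcup_remainder mB e2; rewrite -BT in hN.
pose K := F `&` \big[setU/set0]_(n < N) B n.
have cK : compact K.
  rewrite /K setIC; apply: compact_closedI => //.
  by apply: big_ind => //; [exact: compact0|exact: compactU].
have KA : K `<=` A by move=> x [Fx _]; exact: FA.
have mF : measurable (F : set (borelRn R d)) by exact: closed_measurable.
have mS : measurable (\big[setU/set0]_(n < N) B n : set (borelRn R d)) by exact: bigsetU_measurable.
have mK := cpt_meas _ cK.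
apply: (@le_trans _ _ (mu K + e%:E)); last first.
  by rewrite leeD2r//; apply: ereal_sup_ubound; exists K.
have mAF : measurable (A `\` F) by exact: measurableD.
have mTS : measurable (setT `\` \big[setU/set0]_(n < N) B n : set (borelRn R d)).
  exact: measurableD.
have sub : A `<=` K `|` ((A `\` F) `|` (setT `\` \big[setU/set0]_(n < N) B n)).
  move=> x Ax; have [Fx|nFx] := pselect (F x); last by right; left.
  have [Sx|nSx] := pselect ((\big[setU/set0]_(n < N) B n) x); first by left.
  by right; right.
apply: le_trans (_ : _ <= mu (K `|` ((A `\` F) `|` (setT `\` \big[setU/set0]_(n < N) B n)))) _.
  by apply: le_measure; rewrite ?inE//; do 2 apply: measurableU => //.
have le1 : mu (K `|` ((A `\` F) `|` (setT `\` \big[setU/set0]_(n < N) B n))) <=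
    mu K + mu ((A `\` F) `|` (setT `\` \big[setU/set0]_(n < N) B n)).
  by apply: measureU2 => //; exact: measurableU.
have le2 : mu ((A `\` F) `|` (setT `\` \big[setU/set0]_(n < N) B n)) <=
    mu (A `\` F) + mu (setT `\` \big[setU/set0]_(n < N) B n).
  exact: measureU2.
rewrite (le_trans le1)// leeD2l// (le_trans le2)//.
by rewrite [e in e%:E]splitr EFinD leeD// ltW.
Qed.

End BorelRn.

(** * Weighted square-mean approximation by polynomials *)

Section PolyfunMorphism.
Variables (R : realType) (d : nat).
Implicit Types (p q : rpoly R d) (x : 'rV[R]_d).

Lemma polyfunD p q x : polyfun (p + q) x = polyfun p x + polyfun q x.
Proof. by rewrite /polyfun mevalD. Qed.

Lemma polyfunB p q x : polyfun (p - q) x = polyfun p x - polyfun q x.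
Proof. by rewrite /polyfun mevalB. Qed.

Lemma polyfunM p q x : polyfun (p * q) x = polyfun p x * polyfun q x.
Proof. by rewrite /polyfun mevalM. Qed.

Lemma polyfunC (c : R) x : polyfun (mpolyC d c) x = c.
Proof. by rewrite /polyfun mevalC. Qed.

Lemma polyfun1 x : polyfun 1 x = 1.
Proof. by rewrite /polyfun meval1. Qed.

Lemma polyfunZ c p x : polyfun (c *: p) x = c * polyfun p x.
Proof. by rewrite /polyfun mevalZ. Qed.

Lemma polyfunX2 p x : polyfun (p ^+ 2) x = polyfun p x ^+ 2.
Proof. by rewrite !expr2 polyfunM. Qed.

End PolyfunMorphism.

Section SquareNorm.
Context disp (T : measurableType disp) (R : realType).
Variable mu : {measure set T -> \bar R}.
Implicit Types f g : T -> R.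

Definition sqnorm f : \bar R := (\int[mu]_x ((f x) ^+ 2)%:E)%E.

Lemma measurable_sqr f : measurable_fun setT f ->
  measurable_fun setT (fun x => ((f x) ^+ 2)%:E : \bar R).
Proof. by move=> mf; apply/measurable_EFinP; exact: measurable_funX. Qed.

Lemma sqnorm_ge0 f : (0 <= sqnorm f)%E.
Proof. by apply: integral_ge0 => x _; rewrite lee_fin sqr_ge0. Qed.

Lemma sqnorm_le f g (C : R) : measurable_fun setT f -> measurable_fun setT g ->
  (forall x, `|f x| <= C * `|g x|) -> (sqnorm f <= (C ^+ 2)%:E * sqnorm g)%E.
Proof.
move=> mf mg fg; rewrite /sqnorm -ge0_integralZl ?lee_fin ?sqr_ge0//; last 2 first.
- exact: measurable_sqr.
- by move=> x _; rewrite lee_fin sqr_ge0.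
apply: ge0_le_integral => //.
- by move=> x _; rewrite lee_fin sqr_ge0.
- exact: measurable_sqr.
- by apply: measurable_funeM; exact: measurable_sqr.
move=> x _; rewrite -EFinM lee_fin -[leLHS]real_normK ?num_real//.
by rewrite -[g x ^+ 2]real_normK ?num_real// -exprMn lerXn2r ?nnegrE ?(le_trans _ (fg x)).
Qed.

Lemma sqnormD f g : measurable_fun setT f -> measurable_fun setT g ->
  (sqnorm (fun x => f x + g x)%R <= 2%:E * (sqnorm f + sqnorm g))%E.
Proof.
move=> mf mg; have sge (h : T -> R) x : setT x -> (0 <= ((h x) ^+ 2)%:E :> \bar R)%E.
  by move=> _; rewrite lee_fin sqr_ge0.
have msf := measurable_sqr mf; have msg := measurable_sqr mg.
have -> : (sqnorm f + sqnorm g = \int[mu]_x (((f x) ^+ 2)%:E + ((g x) ^+ 2)%:E))%E.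
  by rewrite ge0_integralD//; [exact: sge|exact: sge].
rewrite -ge0_integralZl//; last 2 first.
- exact: emeasurable_funD.
- by move=> x Tx; rewrite adde_ge0// sge.
apply: ge0_le_integral => //.
- by move=> x _; rewrite lee_fin sqr_ge0.
- by apply: measurable_sqr; exact: measurable_funD.
- by apply: measurable_funeM; exact: emeasurable_funD.
move=> x _; rewrite -EFinD -EFinM lee_fin -subr_ge0.
by rewrite (_ : _ - _ = (f x - g x) ^+ 2) ?sqr_ge0//; ring.
Qed.

End SquareNorm.

Section PolynomialDensity.
Variables (R : realType) (d : nat).
Variable mu : {measure set (borelRn R d) -> \bar R}.
Hypothesis mu_sqr : forall p : rpoly R d, (sqnorm mu (polyfun p) < +oo)%E.
Local Notation T := (borelRn R d).
Implicit Types (h g : T -> R) (p q w : rpoly R d) (eps : R).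

(** All polynomial weights are allowed so that the property is stable under
    products. *)
Definition poly_dense h := [/\ measurable_fun setT h,
  exists C, forall x, `|h x| <= C &
  forall w eps, 0 < eps -> exists p,
    (sqnorm mu (fun x => polyfun w x * (h x - polyfun p x))%R < eps%:E)%E].

Lemma measurable_weighted_diff w h p : measurable_fun setT h ->
  measurable_fun setT (fun x : T => polyfun w x * (h x - polyfun p x)).
Proof.
move=> mh; apply: measurable_funM; first exact: measurable_polyfun.
by apply: measurable_funB => //; exact: measurable_polyfun.
Qed.

Lemma poly_dense_cst (c : R) : poly_dense (fun=> c).
Proof.
split; [exact: measurable_cst|by exists `|c| |move=> w eps eps0; exists (mpolyC d c)].
rewrite (_ : sqnorm _ _ = 0%E) ?lte_fin// /sqnorm integral0_eq// => x _.
by rewrite polyfunC subrr mulr0 expr0n.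
Qed.

Lemma poly_denseD h g : poly_dense h -> poly_dense g ->
  poly_dense (fun x => h x + g x).
Proof.
move=> [mh [C hC] hd] [mg [D gD] gd]; split; first exact: measurable_funD.
  by exists (C + D) => x; rewrite (le_trans (ler_normD _ _))// lerD.
move=> w eps eps0; have e4 : 0 < eps / 4 by rewrite divr_gt0.
have [p hp] := hd w _ e4; have [q gq] := gd w _ e4; exists (p + q).
rewrite (_ : (fun x => _) = (fun x => polyfun w x * (h x - polyfun p x) +
   polyfun w x * (g x - polyfun q x))); last first.
  by apply/funext => x; rewrite polyfunD; ring.
apply: le_lt_trans (sqnormD _ _ _) _; try exact: measurable_weighted_diff.
rewrite (_ : eps%:E = (2%:E * ((eps / 4)%:E + (eps / 4)%:E))%E); last first.
  by rewrite -EFinD -EFinM; congr EFin; field.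
by rewrite lte_pmul2l ?lte_fin// lteD.
Qed.

Lemma poly_denseM h g : poly_dense h -> poly_dense g ->
  poly_dense (fun x => h x * g x).
Proof.
move=> [mh [C hC] hd] [mg [D gD] gd]; split; first exact: measurable_funM.
  exists (C * D) => x; rewrite normrM ler_pM//.
move=> w eps eps0; pose K := 1 + `|C|.
have K0 : 0 < K by rewrite /K ltr_pwDl.
have e1 : 0 < eps / 4 / K ^+ 2 by rewrite !divr_gt0// exprn_gt0.
have e4 : 0 < eps / 4 by rewrite divr_gt0.
have [q gq] := gd w _ e1; have [p hp] := hd (w * q) _ e4; exists (p * q).
rewrite (_ : (fun x => _) = (fun x => h x * (polyfun w x * (g x - polyfun q x)) +
   polyfun (w * q) x * (h x - polyfun p x))); last first.
  by apply/funext => x; rewrite !polyfunM; ring.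
have m1 := measurable_weighted_diff w q mg.
have m2 := measurable_weighted_diff (w * q) p mh.
have m3 : measurable_fun setT (fun x => h x * (polyfun w x * (g x - polyfun q x))).
  exact: measurable_funM.
apply: le_lt_trans (sqnormD mu m3 m2) _.
rewrite (_ : eps%:E = (2%:E * ((eps / 4)%:E + (eps / 4)%:E))%E); last first.
  by rewrite -EFinD -EFinM; congr EFin; field.
rewrite lte_pmul2l ?lte_fin// lteD//.
apply: le_lt_trans (sqnorm_le mu (C := K) m3 m1 _) _.
  move=> x; rewrite normrM ler_wpM2r// (le_trans (hC x))// (le_trans (ler_norm _))//.
  by rewrite /K lerDr.
rewrite -[ltRHS](_ : ((K ^+ 2)%:E * (eps / 4 / K ^+ 2)%:E)%E = _).
  by rewrite lte_pmul2l ?lte_fin ?exprn_gt0.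
by rewrite -EFinM; congr EFin; field; rewrite gt_eqF.
Qed.

Lemma poly_denseZ (c : R) h : poly_dense h -> poly_dense (fun x => c * h x).
Proof. exact: poly_denseM (poly_dense_cst c). Qed.

Lemma poly_denseB h g : poly_dense h -> poly_dense g ->
  poly_dense (fun x => h x - g x).
Proof.
move=> hd gd; rewrite (_ : (fun x => _) = (fun x => h x + (-1) * g x)).
  by apply: poly_denseD => //; exact: poly_denseZ.
by apply/funext => x; rewrite mulN1r.
Qed.

(** Dominated convergence, with a constant times w^2 as dominating function. *)
Lemma poly_dense_lim (hn : nat -> T -> R) h (C : R) :
  (forall n, poly_dense (hn n)) -> (forall n x, `|hn n x| <= C) ->
  (forall x, hn ^~ x @ \oo --> h x) -> poly_dense h.
Proof.
move=> hd hC hl; have mhn n : measurable_fun setT (hn n) by have [] := hd n.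
have mh : measurable_fun setT h.
  apply: (measurable_fun_cvg (h := hn)) => // x _; exact: hl.
have hCl x : `|h x| <= C.
  have cn : `|hn n x| @[n --> \oo] --> `|h x| by exact: cvg_norm (hl x).
  by apply: (ler_cvg_to cn (cvg_cst C)); exact: nearW.
split => //; first by exists C.
move=> w eps eps0; have e4 : 0 < eps / 4 by rewrite divr_gt0.
have mw : measurable_fun setT (polyfun w : T -> R) by exact: measurable_polyfun.
have md n : measurable_fun setT (fun x : T => polyfun w x * (h x - hn n x)).
  by apply: measurable_funM => //; exact: measurable_funB.
have cv : sqnorm mu (fun x => polyfun w x * (h x - hn n x))%R @[n --> \oo] --> 0%E.
  pose G (x : T) : \bar R := (((2 * C) ^+ 2)%:E * ((polyfun w x) ^+ 2)%:E)%E.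
  have [] := @dominated_convergence _ T R mu setT measurableT
    (fun n (x : T) => ((polyfun w x * (h x - hn n x)) ^+ 2)%:E) (cst 0%E) G.
  - by move=> n; apply: measurable_sqr.
  - exact: measurable_cst.
  - apply: aeW => x _ /=; apply: cvg_EFin; first exact: nearW.
    have cz : polyfun w x * (h x - hn n x) @[n --> \oo] --> (0 : R).
      rewrite -(mulr0 (polyfun w x)) -(subrr (h x)).
      by apply: cvgM; [exact: cvg_cst|apply: cvgB; [exact: cvg_cst|exact: hl]].
    rewrite -[0](mulr0 0); under eq_fun do rewrite /= expr2.
    by apply: (@cvgM _ _ _ _ _ _ _ _ cz cz).
  - have iw : mu.-integrable setT (fun x : T => ((polyfun w x) ^+ 2)%:E).
      apply/integrableP; split; first exact: measurable_sqr.
      apply: le_lt_trans (mu_sqr w); rewrite /sqnorm.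
      rewrite le_eqVlt; apply/orP; left; apply/eqP; apply: eq_integral => x _; rewrite /= ger0_norm ?sqr_ge0//.
    by apply: (@integrableZl _ _ _ mu setT measurableT ((2 * C) ^+ 2) _ iw).
  - apply: aeW => x n _ /=; rewrite /G -EFinM lee_fin ger0_norm ?sqr_ge0//.
    rewrite mulrC exprMn ler_wpM2r ?sqr_ge0//.
    rewrite -[leLHS]real_normK ?num_real// lerXn2r ?nnegrE//.
      by rewrite mulr_ge0// (le_trans _ (hCl x)).
    by rewrite (le_trans (ler_normB _ _))// mulr_natl mulr2n lerD.
  by move=> _ _; rewrite integral0.
have /fine_cvgP[fcv /cvgrPdist_lt/(_ _ e4)[N _ hN]] := cv.
have [N' _ hN'] := fcv; pose n := maxn N N'.
have small : (sqnorm mu (fun x => polyfun w x * (h x - hn n x))%R < (eps / 4)%:E)%E.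
  have := hN n (leq_maxl _ _); rewrite /= sub0r normrN ger0_norm ?fine_ge0 ?sqnorm_ge0// => lt.
  by rewrite -(fineK (hN' n (leq_maxr _ _))) lte_fin.
have [_ _ /(_ w _ e4)[p hp]] := hd n; exists p.
rewrite (_ : (fun x => _) = (fun x => polyfun w x * (h x - hn n x) +
   polyfun w x * (hn n x - polyfun p x))); last by apply/funext => x; ring.
apply: le_lt_trans (sqnormD mu (md n) (measurable_weighted_diff w p (mhn n))) _.
rewrite (_ : eps%:E = (2%:E * ((eps / 4)%:E + (eps / 4)%:E))%E); last first.
  by rewrite -EFinD -EFinM; congr EFin; field.
by rewrite lte_pmul2l ?lte_fin// lteD.
Qed.

End PolynomialDensity.

(** * Approximation of indicators of Borel sets *)

Section SignIteration.
Variable R : realType.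
Implicit Types y z : R.

(** Newton-type iteration of an odd polynomial whose iterates on [-1, 1]
    converge to the sign function: the fixed points 1 and -1 attract everything
    except 0. *)
Definition sign_step y := (3 * y - y ^+ 3) / 2.

Lemma sign_step_norm y : `|y| <= 1 -> `|sign_step y| <= 1.
Proof.
rewrite !ler_norml /sign_step => /andP[y1 y2].
have h1 : 0 <= (1 - y) ^+ 2 * (2 + y) by rewrite mulr_ge0 ?sqr_ge0//; lra.
have h2 : 0 <= (1 + y) ^+ 2 * (2 - y) by rewrite mulr_ge0 ?sqr_ge0//; lra.
by apply/andP; split; lra.
Qed.

Lemma sign_stepN y : sign_step (- y) = - sign_step y.
Proof. by rewrite /sign_step; ring. Qed.

Lemma iter_sign_step_pos y n : 0 < y -> y <= 1 ->
  [/\ y <= iter n sign_step y, iter n sign_step y <= 1 &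
      1 - iter n sign_step y <= (1 - y / 2) ^+ n].
Proof.
move=> y0 y1; elim: n => [|n [h1 h2 h3]] /=; first by split=> //; rewrite expr0; lra.
move: (iter n _ y) h1 h2 h3 => z h1 h2 h3.
have z0 : 0 <= z by lra.
have e1 : 0 <= z * (1 - z) * (1 + z) by rewrite !mulr_ge0//; lra.
have e2 : 0 <= (1 - z) ^+ 2 * (2 + z) by rewrite mulr_ge0 ?sqr_ge0//; lra.
rewrite /sign_step; split; [lra|lra|].
have -> : 1 - (3 * z - z ^+ 3) / 2 = (1 - (z + z ^+ 2) / 2) * (1 - z) by field.
rewrite [leRHS]exprS; apply: ler_pM => //; [|lra|].
  have : z ^+ 2 <= 1 by rewrite expr_le1.
  lra.
have : 0 <= z ^+ 2 by exact: sqr_ge0.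
lra.
Qed.

Lemma iter_sign_step_cvg y : `|y| <= 1 ->
  iter n sign_step y @[n --> \oo] --> Num.sg y.
Proof.
have pos z : 0 < z -> z <= 1 -> iter n sign_step z @[n --> \oo] --> (1 : R).
  move=> z0 z1; apply: (@squeeze_cvgr _ _ _ _ (fun n => 1 - (1 - z / 2) ^+ n) (fun=> 1)).
  - apply: nearW => n; have [_ h1 h2] := iter_sign_step_pos n z0 z1.
    by rewrite h1 andbT; lra.
  - rewrite -[X in _ --> X]subr0; apply: cvgB; first exact: cvg_cst.
    by apply: cvg_expr; rewrite ger0_norm; lra.
  - exact: cvg_cst.
rewrite ler_norml => /andP[y1 y2]; case: (sgrP y) => [->|y0|y0].
- have -> : (fun n => iter n sign_step 0) = (fun=> 0).
    apply/funext; elim=> //= n ->; by rewrite /sign_step; ring.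
  exact: cvg_cst.
- exact: pos.
have iterN n : iter n sign_step y = - iter n sign_step (- y).
  by elim: n => [|n ih] /=; [rewrite opprK|rewrite ih sign_stepN].
under eq_fun do rewrite iterN.
by apply: cvgN; apply: pos; lra.
Qed.

End SignIteration.

Section DenseIndicators.
Variables (R : realType) (d : nat).
Variable mu : {measure set (borelRn R d) -> \bar R}.
Hypothesis mu_sqr : forall p : rpoly R d, (sqnorm mu (polyfun p) < +oo)%E.
Local Notation T := (borelRn R d).
Implicit Types (h g : T -> R) (A B : set T).

(** Iterates of a polynomial stay in the algebra of approximable functions, and
    the sign function is their bounded limit. *)
Lemma poly_dense_sg h : (forall x, `|h x| <= 1) -> poly_dense mu h ->
  poly_dense mu (fun x => Num.sg (h x)).
Proof.
move=> h1 hd.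
have dn n : poly_dense mu (fun x => iter n (@sign_step R) (h x)).
  elim: n => [//|n ih] /=.
  rewrite (_ : (fun x => _) = (fun x => 2^-1 * (3 * iter n (@sign_step R) (h x) -
    iter n (@sign_step R) (h x) * (iter n (@sign_step R) (h x) *
      iter n (@sign_step R) (h x))))).
    apply: poly_denseZ => //; apply: poly_denseB => //; first exact: poly_denseZ.
    by apply: poly_denseM => //; exact: poly_denseM.
  by apply/funext => x; rewrite /sign_step; ring.
apply: (poly_dense_lim mu_sqr (C := 1) dn).
  by elim=> [//|n ih] x /=; exact: sign_step_norm.
by move=> x; exact: iter_sign_step_cvg.
Qed.

Definition dense_sets : set (set T) := [set A | poly_dense mu (\1_A)].

(** The indicator of the positive half line is (s + s^2) / 2 for the sign s. *)
Lemma dense_sets_gt h (a : R) : poly_dense mu h -> dense_sets [set x | a < h x].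
Proof.
move=> hd; have [_ [C hC] _] := poly_denseB hd (poly_dense_cst mu a).
pose K := 1 + `|C|; have K0 : 0 < K by rewrite /K ltr_pwDl.
pose g x := K^-1 * (h x - a).
have gd : poly_dense mu g.
  by apply: poly_denseZ => //; apply: poly_denseB => //; exact: poly_dense_cst.
have g1 x : `|g x| <= 1.
  rewrite /g normrM ger0_norm ?invr_ge0 ?(ltW K0)// ler_pdivrMl// mulr1.
  by rewrite (le_trans (hC x))// (le_trans (ler_norm _))// /K lerDr.
have sd := poly_dense_sg g1 gd.
rewrite /dense_sets/= (_ : \1__ = (fun x => 2^-1 * (Num.sg (g x) + Num.sg (g x) * Num.sg (g x)))).
  by apply: poly_denseZ => //; apply: poly_denseD => //; exact: poly_denseM.
apply/funext => x; rewrite indicE /g sgrM gtr0_sg ?invr_gt0// mul1r.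
have -> : (x \in [set x | a < h x]) = (0 < h x - a).
  by rewrite subr_gt0; apply/idP/idP; rewrite inE.
by case: (sgrP (h x - a)) => _; rewrite ?mulr0 ?addr0 ?mulr0//=; field.
Qed.

Lemma dense_sets0 : dense_sets set0.
Proof. by rewrite /dense_sets/= indic0; exact: poly_dense_cst. Qed.

Lemma dense_setsC A : dense_sets A -> dense_sets (~` A).
Proof.
move=> Ad; rewrite /dense_sets/= (_ : \1__ = (fun x => 1 - \1_A x)).
  by apply: poly_denseB => //; exact: poly_dense_cst.
by apply/funext => x; rewrite !indicE in_setC; case: (x \in A); rewrite /= ?subrr ?subr0.
Qed.

Lemma dense_setsU A B : dense_sets A -> dense_sets B -> dense_sets (A `|` B).
Proof.
move=> Ad Bd; rewrite /dense_sets/= (_ : \1__ = (fun x => \1_A x + \1_B x - \1_A x * \1_B x)).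
  by apply: poly_denseB => //; [exact: poly_denseD|exact: poly_denseM].
apply/funext => x; rewrite !indicE in_setU.
by case: (x \in A); case: (x \in B); rewrite /=; ring.
Qed.

Lemma dense_sets_sigma : sigma_algebra setT dense_sets.
Proof.
split => //; [exact: dense_sets0|by move=> A Ad; rewrite setTD; exact: dense_setsC|].
move=> F Fd; pose G n := \big[setU/set0]_(i < n) F i.
have Gd n : dense_sets (G n).
  by rewrite /G; elim/big_ind: _ => //; [exact: dense_sets0|exact: dense_setsU].
apply: (poly_dense_lim mu_sqr (C := 1) Gd) => [n x|x].
  by rewrite indicE; case: (_ \in _); rewrite ?normr1 ?normr0.
have [[k _ Fx]|nFx] := pselect ((\bigcup_i F i) x).
  apply: cvg_near_cst; exists k.+1 => // n /= kn.
  rewrite !indicE !mem_set//; first by exists k.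
  by rewrite /G -bigcup_mkord; exists k.
apply: cvg_near_cst; apply: nearW => n; rewrite !indicE !memNset//.
by rewrite /G -bigcup_mkord => -[k _ Fx]; apply: nFx; exists k.
Qed.

(** The sets with approximable indicator form a sigma-algebra for which the
    resolvents 1 / (1 + g_i), hence the g_i, are measurable.  The polynomials
    measurable for it are a subalgebra, hence all polynomials; so the coordinates
    are measurable and every Borel set belongs to the sigma-algebra. *)
Theorem borel_dense_sets (M : nat) (g : 'I_M -> rpoly R d) :
  generates_algebra g -> (forall i x, 0 <= polyfun (g i) x) ->
  (forall i, poly_dense mu (fun x => (1 + polyfun (g i) x)^-1)) ->
  forall A : set T, measurable A -> poly_dense mu (\1_A).
Proof.
move=> ggen g0 gd.
pose T' := g_sigma_algebraType dense_sets.
pose S : {pred rpoly R d} := fun p => `[< measurable_fun setT (polyfun p : T' -> R) >].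
have SP p : p \in S <-> measurable_fun setT (polyfun p : T' -> R).
  by split => [/asboolP|h]; last exact/asboolP.
have Sall : forall p, p \in S.
  apply: ggen.
    split.
    - apply/SP; rewrite (_ : polyfun 1 = cst 1); first exact: measurable_cst.
      by apply/funext => x; rewrite polyfun1.
    - move=> a p q /SP mp /SP mq; apply/SP.
      rewrite (_ : polyfun _ = (fun x => a * polyfun p x + polyfun q x)).
        by apply: measurable_funD => //; apply: measurable_funM.
      by apply/funext => x; rewrite polyfunD polyfunZ.
    - move=> p q /SP mp /SP mq; apply/SP.
      rewrite (_ : polyfun _ = (fun x => polyfun p x * polyfun q x)).
        exact: measurable_funM.
      by apply/funext => x; rewrite polyfunM.
  move=> i; apply/SP => _.
  apply: (measurability _ (RGenOInfty.measurableE R)) => //.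
  move=> _ [_ [a ->] <-]; rewrite setTI; apply: sub_sigma_algebra.
  have [a0|a0] := ltP a 0.
    have -> : polyfun (g i) @^-1` `]a, +oo[%classic = setT.
      by apply/seteqP; split => x //= _; rewrite in_itv/= andbT (lt_le_trans a0).
    by rewrite -setC0; apply/dense_setsC/dense_sets0.
  rewrite (_ : polyfun (g i) @^-1` _ = [set x | - (1 + a)^-1 < 0 - (1 + polyfun (g i) x)^-1]).
    by apply: dense_sets_gt; apply: poly_denseB => //; exact: poly_dense_cst.
  have p1 : 0 < 1 + a by rewrite ltr_pwDl.
  apply/seteqP; split => x /=; have p2 : 0 < 1 + polyfun (g i) x by rewrite ltr_pwDl.
    by rewrite in_itv/= andbT sub0r ltrN2 ltf_pV2 ?posrE// ltrD2l.
  by rewrite in_itv/= andbT sub0r ltrN2 ltf_pV2 ?posrE// ltrD2l.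
have mid : measurable_fun setT (id : T' -> borelRn R d).
  apply: measurable_to_borelRn => i.
  rewrite (_ : (fun u => _) = (polyfun (mpolyX R (mnm1 i)) : T' -> R)).
    exact/SP.
  by apply/funext => x; rewrite /polyfun mevalXU.
move=> A mA; have := mid measurableT A mA; rewrite setTI preimage_id.
by rewrite /measurable/= (sigma_algebra_id dense_sets_sigma).
Qed.

End DenseIndicators.

(** * From dense multipliers to indicators *)

Section SquareFamily.
Variables (R : realType) (d m : nat) (f : 'I_m -> rpoly R d).

Definition shift_pair (i : 'I_(m + m)) : rpoly R d :=
  match fintype.split i with inl j => f j | inr j => 1 + f j end.

(** f = ((1 + f)^2 - f^2 - 1) / 2. *)
Lemma shift_pair_sqr_generates :
  generates_algebra f -> generates_algebra (fun i => shift_pair i ^+ 2).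
Proof.
move=> fgen S Ssub Sg; apply: fgen => // j; have [S1 Slin _] := Ssub.
have := Sg (lshift m j); have := Sg (rshift m j); rewrite /shift_pair.
rewrite (unsplitK (inl j)) (unsplitK (inr j)) => h1 h2.
have S0 : 0 \in S by rewrite -(addNr 1) -scaleN1r; exact: Slin.
have hd : (1 + f j) ^+ 2 - f j ^+ 2 \in S by rewrite addrC -scaleN1r; exact: Slin.
have hd1 : (1 + f j) ^+ 2 - f j ^+ 2 - 1 \in S by rewrite addrC -scaleN1r; exact: Slin.
have -> : f j = 2^-1 *: ((1 + f j) ^+ 2 - f j ^+ 2 - 1) + 0.
  rewrite addr0 (_ : _ - 1 = 2 *: f j) ?scalerA ?mulVf ?scale1r//.
  by rewrite scaler_nat; ring.
exact: Slin.
Qed.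

End SquareFamily.

Section RepresentedDensity.
Variables (R : realType) (d : nat) (L : {scalar rpoly R d}).
Variable mu : {measure set (borelRn R d) -> \bar R}.
Variable c : R.
Hypothesis L_sqr : forall q, 0 <= L (q ^+ 2).
Hypothesis mu_sqr : forall q : rpoly R d, sqnorm mu (polyfun q) = (c * L (q ^+ 2))%:E.

Lemma represented_sqr_fin q : (sqnorm mu (polyfun q) < +oo)%E.
Proof. by rewrite mu_sqr ltry. Qed.

(** The resolvent r = 1 / (1 + F^2) is at most 1, and
    r - p = r (1 - (1 + F^2) p). *)
Lemma resolvent_poly_dense (F : rpoly R d) : dense_mul L (1 + F ^+ 2) ->
  poly_dense mu (fun x => (1 + polyfun (F ^+ 2) x)^-1).
Proof.
move=> Fd; have den x : 1 <= 1 + polyfun (F ^+ 2) x.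
  by rewrite polyfunX2 lerDl sqr_ge0.
have den0 x : 0 < 1 + polyfun (F ^+ 2) x by exact: lt_le_trans (den x).
have mr : measurable_fun setT (fun x : borelRn R d => (1 + polyfun (F ^+ 2) x)^-1).
  move=> _; apply: (measurability _ (RGenOInfty.measurableE R)) => // _ [_ [a ->] <-].
  rewrite setTI; have [a0|a0] := leP a 0.
    rewrite (_ : _ @^-1` _ = setT)//; apply/seteqP; split => x //= _.
    by rewrite in_itv/= andbT (le_lt_trans a0)// invr_gt0.
  rewrite (_ : _ @^-1` _ = polyfun (1 + F ^+ 2) @^-1` `]-oo, a^-1[%classic).
    by rewrite -[X in measurable X]setTI; exact: measurable_polyfun.
  apply/seteqP; split => x /=; rewrite !in_itv/= andbT polyfunD polyfun1.
    by rewrite -[a in a < _]invrK ltf_pV2 ?posrE ?invr_gt0.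
  by rewrite -[a in a < _]invrK ltf_pV2 ?posrE ?invr_gt0.
split => //.
  by exists 1 => x; rewrite ger0_norm ?invr_ge0 ?(ltW (den0 x))// invf_le1.
move=> w eps eps0; have c0 : 0 < 1 + `|c| by rewrite ltr_pwDl.
have [p hp] := Fd w _ (divr_gt0 eps0 c0); exists p.
apply: (@le_lt_trans _ _ ((1 ^+ 2)%:E * sqnorm mu (polyfun (w * (1 - (1 + F ^+ 2) * p))%R))%E).
  apply: sqnorm_le; [exact: measurable_weighted_diff|exact: measurable_polyfun|].
  move=> x; rewrite mul1r !(polyfunM, polyfunB, polyfunD, polyfun1) !normrM.
  rewrite ler_wpM2l//; move: (den x) (den0 x); rewrite polyfunX2.
  move: (1 + _) (polyfun p x) => D P D1 D0.
  have -> : D^-1 - P = D^-1 * (1 - D * P) by field; rewrite gt_eqF.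
  by rewrite normrM ler_piMl// ger0_norm ?invr_ge0 ?(ltW D0)// invf_le1.
rewrite expr1n mul1e mu_sqr lte_fin; apply: (@le_lt_trans _ _ (`|c| * (eps / (1 + `|c|)))).
  rewrite (le_trans (ler_norm _))// normrM ler_wpM2l// ger0_norm ?L_sqr//.
  by apply: ltW; exact: hp.
by rewrite mulrCA gtr_pMr// ltr_pdivrMr// mul1r ltrDr.
Qed.

End RepresentedDensity.

(** * Uniqueness and support *)

Section SmallSquareNorm.
Context disp (T : measurableType disp) (R : realType).
Variable mu : {measure set T -> \bar R}.
Hypothesis mu_fin : (mu setT < +oo)%E.

Lemma integrable_indic_fin (A : set T) : measurable A ->
  mu.-integrable setT (EFin \o \1_A).
Proof.
move=> mA; apply/integrableP; split; first by apply/measurable_EFinP; exact: measurable_indic.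
rewrite (eq_integral (fun x => (\1_A x)%:E)).
  by rewrite integral_indic// (le_lt_trans _ mu_fin)//; apply: le_measure; rewrite ?inE// setIT.
by move=> x _; rewrite /= ger0_norm.
Qed.

(** The estimate |D| <= D^2 / e + e trades the mean of |D| for its square mean;
    it avoids the Cauchy-Schwarz inequality for integrals. *)
Lemma sqnorm_small (D : T -> R) (e : R) : measurable_fun setT D -> 0 < e ->
  (sqnorm mu D < (e ^+ 2)%:E)%E ->
  [/\ mu.-integrable setT (EFin \o D),
      mu.-integrable setT (EFin \o (fun x => D x ^+ 2)),
      \int[mu]_x (D x ^+ 2) <= e ^+ 2 &
      \int[mu]_x `|D x| <= e * (1 + fine (mu setT))].
Proof.
move=> mD e0 small.
have mD2 : measurable_fun setT (fun x => D x ^+ 2) by exact: measurable_funX.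
have iD2 : mu.-integrable setT (EFin \o (fun x => D x ^+ 2)).
  apply/integrableP; split; first exact/measurable_EFinP.
  apply: le_lt_trans (_ : _ <= sqnorm mu D)%E (lt_trans small (ltry _)).
  rewrite le_eqVlt; apply/orP; left; apply/eqP; apply: eq_integral => x _.
  by rewrite /= ger0_norm ?sqr_ge0.
have ie : mu.-integrable setT (EFin \o (fun=> e)).
  apply/integrableP; split; first exact: measurable_cst.
  by rewrite /= integral_cst// lte_mul_pinfty.
have ib1 : mu.-integrable setT (EFin \o (fun x => e^-1 * D x ^+ 2)).
  exact: (@integrableZl _ _ _ mu setT measurableT e^-1 _ iD2).
have ib : mu.-integrable setT (EFin \o (fun x => e^-1 * D x ^+ 2 + e)).
  exact: (@integrableD _ _ _ mu setT measurableT _ _ ib1 ie).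
have bound x : `|D x| <= e^-1 * D x ^+ 2 + e.
  rewrite -(ler_pM2l e0) mulrDr mulrA mulfV ?gt_eqF// mul1r -[D x ^+ 2]real_normK ?num_real//.
  by have := sqr_ge0 (e - `|D x|); nra.
have iD : mu.-integrable setT (EFin \o D).
  apply: le_integrable ib => //; first exact/measurable_EFinP.
  by move=> x _ /=; rewrite lee_fin (le_trans (bound x))// ler_norm.
have J2 : \int[mu]_x (D x ^+ 2) <= e ^+ 2.
  rewrite -lee_fin fineK; last exact: integrable_fin_num.
  exact: ltW.
split=> //; apply: (@le_trans _ _ (\int[mu]_x (e^-1 * D x ^+ 2 + e))).
  apply: le_Rintegral => //; exact: integrable_norm.
rewrite RintegralD// RintegralZl// Rintegral_cst// mulrDr mulr1 lerD2r.
by rewrite ler_pdivrMl.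
Qed.

End SmallSquareNorm.

(** With H = h(x), P = p(x) and i the indicator of h < 0 at x: replacing the
    indicator by p^2 in the integral of h costs no more than the square and the
    absolute value of the error weighted by 1 + h^2. *)
Lemma sign_defect_bound (R : realDomainType) (H P i : R) : i = 0 \/ i = 1 ->
  - H * i <= - (H * P ^+ 2) +
    (((1 + H ^+ 2) * (i - P)) ^+ 2 + `|(1 + H ^+ 2) * (i - P)|).
Proof.
move=> i01; have iE : i ^+ 2 = i by case: i01 => ->; rewrite ?expr0n ?expr1n.
have i1 : `|i| <= 1 by case: i01 => ->; rewrite ?normr0 ?normr1.
set W := 1 + H ^+ 2; set D := i - P.
have HW : 2 * `|H| <= W.
  by rewrite /W -[H ^+ 2]real_normK ?num_real//; have := sqr_ge0 (1 - `|H|); nra.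
have W1 : 1 <= W by rewrite /W lerDl sqr_ge0.
have HW2 : H <= W ^+ 2 by have := ler_norm H; have := normr_ge0 H; nra.
have a1 : H * D ^+ 2 <= W ^+ 2 * D ^+ 2 by rewrite ler_wpM2r ?sqr_ge0.
have a2 : - (2 * H * i * D) <= W * `|D|.
  rewrite (le_trans (ler_norm _))// normrN !normrM ler_wpM2r// normr_nat.
  by rewrite (le_trans _ HW)// ler_piMr// mulr_ge0.
have -> : P = i - D by rewrite /D; ring.
rewrite exprMn normrM (ger0_norm (le_trans ler01 W1)).
have -> : H * (i - D) ^+ 2 = H * i ^+ 2 - 2 * H * i * D + H * D ^+ 2 by ring.
by rewrite iE mulNr; lra.
Qed.

Section RepresentingMeasures.
Variables (R : realType) (d m : nat) (f : 'I_m -> rpoly R d) (L : {scalar rpoly R d}).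
Hypothesis f_gen : generates_algebra f.
Hypothesis L_sqr : forall p, 0 <= L (p ^+ 2).
Hypothesis f_dense : forall i, dense_mul L (1 + shift_pair f i ^+ 2).
Implicit Types mu nu : {measure set (borelRn R d) -> \bar R}.

Lemma indicator_dense mu (c : R) :
  (forall q, sqnorm mu (polyfun q) = (c * L (q ^+ 2))%:E) ->
  forall A : set (borelRn R d), measurable A -> poly_dense mu (\1_A).
Proof.
move=> mu_sqr; apply: (borel_dense_sets _ (shift_pair_sqr_generates f_gen)).
- exact: represented_sqr_fin mu_sqr.
- by move=> i x; rewrite polyfunX2 sqr_ge0.
- by move=> i; exact: (resolvent_poly_dense L_sqr mu_sqr).
Qed.

Lemma representing_integrable mu p : representing_measure L mu ->
  mu.-integrable setT (EFin \o polyfun p).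
Proof. by move=> [_ h _]; exact: h. Qed.

Lemma representing_Rintegral mu p : representing_measure L mu ->
  (\int[mu]_x polyfun p x = L p)%R.
Proof. by move=> [_ _ h]; rewrite /Rintegral -h. Qed.

Lemma representing_sqnorm mu p : representing_measure L mu ->
  sqnorm mu (polyfun p) = (L (p ^+ 2))%:E.
Proof.
move=> [_ _ ->]; apply: eq_integral => x _; by rewrite polyfunX2.
Qed.

Lemma representing_mass mu : representing_measure L mu -> mu setT = (L 1)%:E.
Proof.
move=> [_ _ ->]; rewrite (eq_integral (cst 1%:E)) ?integral_cst ?mul1e//.
by move=> x _; rewrite polyfun1.
Qed.

Lemma representing_fin mu : representing_measure L mu -> (mu setT < +oo)%E.
Proof. by move=> /representing_mass ->; rewrite ltry. Qed.

Lemma representing_approx mu (A : set (borelRn R d)) p (e : R) :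
  representing_measure L mu -> measurable A -> 0 < e ->
  (sqnorm mu (fun x => \1_A x - polyfun p x)%R < (e ^+ 2)%:E)%E ->
  `|fine (mu A) - L p| <= e * (1 + L 1).
Proof.
move=> rep mA e0 small; have fin := representing_fin rep.
have iA : mu.-integrable setT (EFin \o \1_A) by exact: integrable_indic_fin.
have mD : measurable_fun setT (fun x : borelRn R d => \1_A x - polyfun p x).
  by apply: measurable_funB; [exact: measurable_indic|exact: measurable_polyfun].
have [iD _ _ JD] := sqnorm_small fin mD e0 small.
have -> : fine (mu A) - L p = \int[mu]_x (\1_A x - polyfun p x).
  rewrite RintegralB//; last exact: representing_integrable.
  by rewrite (representing_Rintegral _ rep) /Rintegral integral_indic// setIT.
by rewrite (le_trans (le_normr_Rintegral _ iD))// (le_trans JD)// representing_mass.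
Qed.

(** A single polynomial approximates the indicator of A for mu + nu, hence for
    both measures, and its integral is the same number L p for both. *)
Lemma representing_unique mu nu : representing_measure L mu ->
  representing_measure L nu ->
  forall A : set (borelRn R d), measurable A -> mu A = nu A.
Proof.
move=> rmu rnu A mA.
pose lam := [the {measure set (borelRn R d) -> \bar R} of measure_add mu nu].
have lamE h : measurable_fun setT h -> (sqnorm lam h = sqnorm mu h + sqnorm nu h)%E.
  move=> mh; rewrite /sqnorm ge0_integral_measure_add//; last exact: measurable_sqr.
  by move=> x _; rewrite lee_fin sqr_ge0.
have lam_sqr q : sqnorm lam (polyfun q) = (2 * L (q ^+ 2))%:E.
  rewrite lamE; last exact: measurable_polyfun.
  by rewrite !representing_sqnorm// -EFinD; congr EFin; rewrite mulr_natl mulr2n.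
have [_ _ dA] := indicator_dense lam_sqr mA.
have L1 : 0 <= L 1 by rewrite -(expr1n _ 2).
have finA k : representing_measure L k -> k A \is a fin_num.
  by move=> rk; apply: finite_measurable => //; exact: representing_fin rk.
rewrite -(fineK (finA _ rmu)) -(fineK (finA _ rnu)); congr EFin.
apply/eqP; rewrite -subr_eq0 -normr_le0; apply/ler_addgt0Pl => eps eps0; rewrite addr0.
pose e := eps / (2 * (1 + L 1)).
have e0 : 0 < e by rewrite divr_gt0// mulr_gt0// ltr_pwDl.
have [p hp] := dA 1 _ (exprn_gt0 2 e0).
have mD : measurable_fun setT (fun x : borelRn R d => \1_A x - polyfun p x).
  by apply: measurable_funB; [exact: measurable_indic|exact: measurable_polyfun].
have {}hp : (sqnorm lam (fun x => \1_A x - polyfun p x)%R < (e ^+ 2)%:E)%E.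
  by move: hp; congr (sqnorm _ _ < _)%E; apply/funext => x; rewrite polyfun1 mul1r.
rewrite lamE// in hp.
have hmu := representing_approx rmu mA e0 (le_lt_trans (leeDl _ (sqnorm_ge0 _ _)) hp).
have hnu := representing_approx rnu mA e0 (le_lt_trans (leeDr _ (sqnorm_ge0 _ _)) hp).
rewrite -(subrKA (L p)) (le_trans (ler_normD _ _))//.
have -> : eps = e * (1 + L 1) + e * (1 + L 1).
  by rewrite /e; field; rewrite gt_eqF// ltr_pwDl.
by rewrite lerD// distrC.
Qed.

(** The integral of the negative part of h is compared with -L (h p^2) <= 0 for
    p close to the indicator of the set where h < 0; so it vanishes. *)
Lemma representing_nonneg mu (h : rpoly R d) : representing_measure L mu ->
  (forall p, 0 <= L (h * p ^+ 2)) -> mu [set x | polyfun h x < 0] = 0%E.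
Proof.
move=> rep hL; set A := [set x | _].
have mh : measurable_fun setT (polyfun h : borelRn R d -> R) by exact: measurable_polyfun.
have mA : measurable (A : set (borelRn R d)).
  rewrite (_ : A = polyfun h @^-1` `]-oo, 0[%classic).
    by rewrite -[X in measurable X]setTI; exact: measurable_polyfun.
  by apply/seteqP; split => x /=; rewrite in_itv.
have fin := representing_fin rep.
have rep_sqr q : sqnorm mu (polyfun q) = (1 * L (q ^+ 2))%:E.
  by rewrite mul1r representing_sqnorm.
have [_ _ dA] := indicator_dense rep_sqr mA.
have L1 : 0 <= L 1 by rewrite -(expr1n _ 2).
pose F (x : borelRn R d) := - polyfun h x * \1_A x.
have F0 x : 0 <= F x.
  rewrite /F indicE; case: (boolP (x \in A)) => [|_]; last by rewrite mulr0.
  by rewrite inE /A /= mulr1 oppr_ge0; exact: ltW.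
have mF : measurable_fun setT F.
  by apply: measurable_funM; [exact: measurable_funN|exact: measurable_indic].
have iF : mu.-integrable setT (EFin \o F).
  apply: le_integrable (representing_integrable h rep) => //; first exact/measurable_EFinP.
  move=> x _ /=; rewrite lee_fin /F normrM normrN ler_piMr// indicE.
  by case: (_ \in _); rewrite ?normr1 ?normr0.
have JF : \int[mu]_x F x <= 0.
  apply/ler_addgt0Pl => eps eps0; rewrite addr0.
  pose e := Num.min 1 (eps / (2 + L 1)).
  have L2 : 0 < 2 + L 1 by rewrite ltr_pwDl.
  have e0 : 0 < e by rewrite lt_min ltr01 divr_gt0.
  have e1 : e <= 1 by rewrite ge_min lexx.
  have e2 : e * (2 + L 1) <= eps by rewrite -ler_pdivlMr// ge_min lexx orbT.
  pose w : rpoly R d := 1 + h ^+ 2.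
  have [p hp] := dA w _ (exprn_gt0 2 e0).
  pose D (x : borelRn R d) := polyfun w x * (\1_A x - polyfun p x).
  have mD : measurable_fun setT D.
    by apply: measurable_weighted_diff; exact: measurable_indic.
  have [iD iD2 J2 J1] := sqnorm_small fin mD e0 hp.
  have iN : mu.-integrable setT (EFin \o polyfun (- (h * p ^+ 2))).
    exact: representing_integrable.
  have inD : mu.-integrable setT (EFin \o (fun x => `|D x|)) by exact: integrable_norm.
  have bound x : F x <= polyfun (- (h * p ^+ 2)) x + (D x ^+ 2 + `|D x|).
    rewrite /D /F (_ : polyfun w x = 1 + polyfun h x ^+ 2); last first.
      by rewrite polyfunD polyfun1 polyfunX2.
    have -> : polyfun (- (h * p ^+ 2)) x = - (polyfun h x * polyfun p x ^+ 2).
      by rewrite -sub0r polyfunB polyfunM polyfunX2 -(subrr (1 : rpoly R d)) polyfunB subrr sub0r.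
    have : \1_A x = 0 :> R \/ \1_A x = 1 :> R.
      by rewrite indicE; case: (_ \in _); [right|left].
    move: (polyfun h x) (polyfun p x) (\1_A x) => H P i i01.
    exact: sign_defect_bound.
  have iS : mu.-integrable setT (EFin \o (fun x => D x ^+ 2 + `|D x|)).
    exact: (@integrableD _ _ _ mu setT measurableT _ _ iD2 inD).
  have iB : mu.-integrable setT
      (EFin \o (fun x => polyfun (- (h * p ^+ 2)) x + (D x ^+ 2 + `|D x|))).
    exact: (@integrableD _ _ _ mu setT measurableT _ _ iN iS).
  have h1 := le_Rintegral measurableT iF iB (fun x _ => bound x).
  rewrite RintegralD// RintegralD// (representing_Rintegral _ rep) linearN/= in h1.
  apply: (le_trans h1); apply: le_trans e2.
  have := hL p; move: J2 J1; rewrite representing_mass// => J2 J1 Lp.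
  have : e ^+ 2 <= e by rewrite expr2 ler_piMl// ltW.
  lra.
have intF : (\int[mu]_x `|(F x)%:E| = 0)%E.
  rewrite (eq_integral (EFin \o F)); last by move=> x _; rewrite /= ger0_norm.
  have iFf : (\int[mu]_x (F x)%:E)%E \is a fin_num by exact: integrable_fin_num.
  by apply/eqP; rewrite -(fineK iFf) eqe eq_le JF Rintegral_ge0.
have [|N [mN N0 AN]] := (ae_eq_integral_abs mu measurableT _).1 intF.
  exact/measurable_EFinP.
apply: (subset_measure0 mA mN _ N0) => x Ax; apply: AN => /= /(_ I) [].
by move/eqP; rewrite /F indicE mem_set// mulr1 oppr_eq0 lt_eqF.
Qed.

End RepresentingMeasures.

(** * Existence *)

Section RestrictedIntegral.
Context disp (T : measurableType disp) (R : realType).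
Variables (mu : {measure set T -> \bar R}) (D : set T) (mD : measurable D).
Local Open Scope ereal_scope.

Lemma ge0_integral_mrestr (f : T -> \bar R) : measurable_fun setT f ->
  (forall x, 0 <= f x) -> \int[mrestr mu mD]_x f x = \int[mu]_(x in D) f x.
Proof.
move=> mf f0; rewrite [LHS](ge0_negligible_integral (N := ~` D))//; last 2 first.
- exact: measurableC.
- by change (mu (~` D `&` D) = 0); rewrite setICl measure0.
rewrite setTD setCK; apply: eq_measure_integral => A mA AD.
by rewrite /mrestr/=; congr (mu _); exact: setIidl.
Qed.

Lemma integral_mrestr (f : T -> \bar R) : measurable_fun setT f ->
  \int[mrestr mu mD]_x f x = \int[mu]_(x in D) f x.
Proof.
move=> mf; rewrite [LHS]integralE [RHS]integralE !ge0_integral_mrestr//.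
  exact: measurable_funeneg.
exact: measurable_funepos.
Qed.

End RestrictedIntegral.

Section PolynomialCoordinates.
Variables (R : realType) (d M : nat) (g : 'I_M -> rpoly R d).

(** Substitution of the generators for the variables. *)
Definition poly_in_gens : mpoly M R -> rpoly R d := comp_mpoly [tuple g i | i < M].

Lemma poly_in_gensE P :
  poly_in_gens P = \sum_(k <- msupp P) mcoeff k P *: \prod_i g i ^+ k i.
Proof.
rewrite {1}[P]mpolyE /poly_in_gens raddf_sum/=; apply: eq_bigr => k _.
by rewrite comp_mpolyZ comp_mpolyX; congr (_ *: _); apply: eq_bigr => i _; rewrite tnth_mktuple.
Qed.

Lemma poly_in_gens_surj : generates_algebra g -> forall p, exists P, poly_in_gens P = p.
Proof.
move=> ggen p; pose S : {pred rpoly R d} := fun p => `[< exists P, poly_in_gens P = p >].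
suff /asboolP : p \in S by [].
apply: ggen => [|i]; first split.
- by apply/asboolP; exists 1; rewrite /poly_in_gens comp_mpoly1.
- move=> a u v /asboolP[U <-] /asboolP[V <-]; apply/asboolP; exists (a *: U + V).
  by rewrite /poly_in_gens comp_mpolyD comp_mpolyZ.
- move=> u v /asboolP[U <-] /asboolP[V <-]; apply/asboolP; exists (U * V).
  by rewrite /poly_in_gens rmorphM.
apply/asboolP; exists (mpolyX R (mnm1 i)).
by rewrite /poly_in_gens comp_mpolyXU -tnth_nth tnth_mktuple.
Qed.

Lemma poly_in_gens_comp (G : 'I_d -> mpoly M R) p :
  (forall i, poly_in_gens (G i) = mpolyX R (mnm1 i)) ->
  poly_in_gens (comp_mpoly [tuple G i | i < d] p) = p.
Proof.
move=> GX; rewrite [RHS]mpolyE {1}[p]mpolyE raddf_sum/= /poly_in_gens raddf_sum/=.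
apply: eq_bigr => k _; rewrite !comp_mpolyZ; congr (_ *: _).
rewrite comp_mpolyX rmorph_prod/= [RHS]mpolyXE_id; apply: eq_bigr => i _.
by rewrite rmorphXn/= tnth_mktuple -[in RHS]GX.
Qed.

End PolynomialCoordinates.

Section PolynomialMap.
Variables (R : realType) (d M : nat) (G : 'I_d -> mpoly M R).
Context disp (T : measurableType disp).
Variable X : 'I_M -> T -> R.
Hypothesis mX : forall i, measurable_fun setT (X i).

Definition poly_map (u : T) : borelRn R d := \row_i meval (X ^~ u) (G i).

Lemma measurable_meval (P : mpoly M R) : measurable_fun setT (fun u => meval (X ^~ u) P).
Proof.
under eq_fun do rewrite mevalE.
apply: measurable_sum => k; apply: measurable_funM => //.
by apply: measurable_prod => i _; apply: measurable_funX.
Qed.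

Lemma measurable_poly_map : measurable_fun setT poly_map.
Proof.
apply: measurable_to_borelRn => i; under eq_fun do rewrite mxE.
exact: measurable_meval.
Qed.

Lemma polyfun_poly_map p u :
  polyfun p (poly_map u) = meval (X ^~ u) (comp_mpoly [tuple G i | i < d] p).
Proof.
rewrite comp_mpoly_meval /polyfun; apply: meval_eq => i.
by rewrite mxE tnth_mktuple.
Qed.

End PolynomialMap.

Section Existence.
Variables (R : realType) (d M : nat) (g : 'I_M -> rpoly R d) (L : {scalar rpoly R d}).
Hypothesis g_gen : generates_algebra g.
Variables (c : R) (X : 'I_M -> R -> R).
Local Notation D := (`[0, c[%classic : set (measurableTypeR R)).
Hypothesis mX : forall i, measurable_fun D (X i).
Hypothesis X_ge0 : forall i u, 0 <= X i u.
Hypothesis X_moments : forall al : 'I_M -> nat,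
  (\int[lebesgue_measure]_(u in D) (\prod_i X i u ^+ al i)%:E
     = (L (\prod_i g i ^+ al i))%:E)%E.

(** Choose polynomials G_i such that G_i(g) is the i-th coordinate.  As X has under
    Lebesgue measure the moments of g under L, the point G(X) is distributed
    according to a representing measure: a polynomial p at G(X) is the polynomial
    p(G) at X, whose integral is L (p(G)(g)) = L p. *)
Lemma realized_moment_functional : moment_functional L.
Proof.
have mD : measurable D by exact: measurable_itv.
have GP i := poly_in_gens_surj g_gen (mpolyX R (mnm1 i)).
pose G i := sval (cid (GP i)).
have GX i : poly_in_gens g (G i) = mpolyX R (mnm1 i) by exact: svalP (cid (GP i)).
(* Extension by 0 outside D makes the coordinates measurable on the whole line;
   the measure is restricted to D accordingly. *)
pose Z i := X i \_ D.
have mZ i : measurable_fun setT (Z i : measurableTypeR R -> R).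
  by apply/(measurable_restrictT _ mD).
pose leb := [the {measure set (measurableTypeR R) -> \bar R} of @lebesgue_measure R].
have mono (k : multinom M) : leb.-integrable D (fun u => (\prod_i Z i u ^+ k i)%:E) /\
    (\int[leb]_(u in D) (\prod_i Z i u ^+ k i)%:E = (L (\prod_i g i ^+ k i))%:E)%E.
  have mf : measurable_fun setT (fun u => \prod_i Z i u ^+ k i).
    by apply: measurable_prod => i _; exact: measurable_funX.
  have intE : (\int[leb]_(u in D) (\prod_i Z i u ^+ k i)%:E = (L (\prod_i g i ^+ k i))%:E)%E.
    rewrite -(X_moments k); apply: eq_integral => u Du; congr EFin.
    by apply: eq_bigr => i _; rewrite /Z patchE Du.
  split=> //; apply/integrableP; split; first by apply/measurable_EFinP; exact: measurable_funTS.
  rewrite (eq_integral (fun u => (\prod_i Z i u ^+ k i)%:E)) ?intE ?ltry// => u _.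
  rewrite /= ger0_norm// prodr_ge0// => i _; rewrite exprn_ge0// /Z patchE.
  by case: ifP.
have int_meval P : leb.-integrable D (fun u => (meval (Z ^~ u) P)%:E) /\
    (\int[leb]_(u in D) (meval (Z ^~ u) P)%:E = (L (poly_in_gens g P))%:E)%E.
  have -> : (fun u => (meval (Z ^~ u) P)%:E) = (fun u => \sum_(k <- msupp P)
      (mcoeff k P)%:E * (\prod_i Z i u ^+ k i)%R%:E)%E.
    by apply/funext => u; rewrite mevalE -sumEFin.
  have im k : leb.-integrable D (fun u => (mcoeff k P)%:E * (\prod_i Z i u ^+ k i)%:E)%E.
    by have [h _] := mono k; exact: (@integrableZl _ _ _ leb D mD _ _ h).
  split; first exact: (@integrable_sum _ _ _ leb D mD _ _ xpredT _ (fun k _ => im k)).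
  rewrite integral_sum// poly_in_gensE linear_sum -sumEFin; apply: eq_bigr => k _.
  by have [h hE] := mono k; rewrite integralZl// hE linearZ.
pose lebD := [the {measure set (measurableTypeR R) -> \bar R} of mrestr leb mD].
pose Y := poly_map G (Z : 'I_M -> measurableTypeR R -> R).
have mY : measurable_fun setT Y by exact: measurable_poly_map.
pose mu := measure_function_pushforward__canonical__measure_function_Measure lebD mY.
have key p : mu.-integrable setT (fun x => (polyfun p x)%:E) /\
    (\int[mu]_x (polyfun p x)%:E = (L p)%:E)%E.
  pose P := comp_mpoly [tuple G i | i < d] p.
  have PE : (fun x => (polyfun p x)%:E) \o Y = (fun u => (meval (Z ^~ u) P)%:E).
    by apply/funext => u /=; rewrite polyfun_poly_map.
  have mp : measurable_fun setT (fun x : borelRn R d => (polyfun p x)%:E).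
    by apply/measurable_EFinP; exact: measurable_polyfun.
  have mP : measurable_fun setT (fun u => (meval (Z ^~ u) P)%:E).
    by apply/measurable_EFinP; exact: measurable_meval.
  have [/integrableP[_ iP] eP] := int_meval P.
  have iY : lebD.-integrable (Y @^-1` setT) ((fun x => (polyfun p x)%:E) \o Y).
    rewrite preimage_setT PE; apply/integrableP; split=> //.
    by rewrite integral_mrestr//; exact: measurableT_comp.
  split; first exact: (integrable_pushforward mY mp iY measurableT).
  rewrite (integral_pushforward mY mp iY measurableT) preimage_setT PE.
  by rewrite integral_mrestr// eP /P poly_in_gens_comp.
exists mu; split; [|by move=> p; have [] := key p|by move=> p; have [_ ->] := key p].
apply: finite_borel_radon.
have [_] := key 1; rewrite (eq_integral (cst 1%E)).
  by rewrite integral_cst// mul1e => ->; rewrite ltry.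
by move=> x _; rewrite polyfun1.
Qed.

End Existence.

(** * The Carleman moment theorem *)

Section CarlemanMoment.
Variables (R : realType) (d m : nat) (f : 'I_m -> rpoly R d) (L : {scalar rpoly R d}).
Hypothesis m_gt0 : (0 < m)%N.
Hypothesis f_gen : generates_algebra f.
Hypothesis L_sqr : forall p, 0 <= L (p ^+ 2).
Hypothesis L_fsqr : forall j p, 0 <= L (f j * p ^+ 2).
Hypothesis L_carleman : forall j,
  (\sum_(1 <= n <oo) carleman_term (L (f j ^+ n)%R) n = +oo)%E.

Lemma shift_pair_dense i : dense_mul L (1 + shift_pair f i ^+ 2).
Proof.
rewrite /shift_pair; case: fintype.split => j.
  exact: (dense_mul_sqr1 L_sqr (L_fsqr j) (L_carleman j)).
exact: (dense_mul_sqr1_shift L_sqr (L_fsqr j) (L_carleman j)).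
Qed.

Lemma carleman_moment_functional : moment_functional L.
Proof.
have mm_gt0 : (0 < m + m)%N by rewrite addn_gt0 m_gt0.
pose ell (al : 'I_(m + m) -> nat) := L (\prod_i (shift_pair f i ^+ 2) ^+ al i).
have [D eps eps0|c [X [mX X0 XE]]] := @moment_realization R _ ell mm_gt0.
  exact: (discrete_approximation L_sqr D shift_pair_dense eps0).
exact: (realized_moment_functional (shift_pair_sqr_generates f_gen) mX X0 XE).
Qed.

(** The complement of the semi-algebraic set is the finite union of the null
    sets where some f_j is negative. *)
Lemma carleman_supported (mu : {measure set (borelRn R d) -> \bar R}) :
  representing_measure L mu -> supported_on mu (semialgK f).
Proof.
move=> rep; rewrite /supported_on.
have mN j : measurable ([set x | polyfun (f j) x < 0] : set (borelRn R d)).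
  rewrite (_ : [set x | _] = polyfun (f j) @^-1` `]-oo, 0[%classic).
    by rewrite -[X in measurable X]setTI; exact: measurable_polyfun.
  by apply/seteqP; split => x /=; rewrite in_itv.
have -> : ~` semialgK f = \big[setU/set0]_(j < m) [set x | polyfun (f j) x < 0].
  rewrite -(bigcup_seq (index_enum _)); apply/seteqP; split => x.
    move=> /existsNP[j /negP]; rewrite -ltNge => h.
    by exists j; rewrite ?/= ?mem_index_enum.
  by move=> [j _ /= h] /(_ j); rewrite leNgt h.
pose N (n : nat) := if insub n is Some j then [set x | polyfun (f j) x < 0] else set0.
have NE (j : 'I_m) : [set x | polyfun (f j) x < 0] = N j by rewrite /N valK.
have mNn n : measurable (N n : set (borelRn R d)) by rewrite /N; case: insub.
under eq_bigr do rewrite NE.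
have le := @Boole_inequality _ _ _ mu N m (fun n _ => mNn n).
apply/eqP; rewrite -measure_le0 (le_trans le)//.
rewrite big1// => j _; rewrite -NE.
exact: (representing_nonneg f_gen L_sqr shift_pair_dense rep (L_fsqr j)).
Qed.

End CarlemanMoment.

Local Open Scope ereal_scope.

Theorem theorem3 (R : realType) (d m : nat) (d_gt0 : (0 < d)%N) (m_gt0 : (0 < m)%N)
    (f : 'I_m -> rpoly R d) (L : {scalar rpoly R d})
    (f_gen : generates_algebra f)
    (L_sqr_ge0 : forall p : rpoly R d, (0 <= L (p ^+ 2))%R)
    (L_fsqr_ge0 : forall (j : 'I_m) (p : rpoly R d), (0 <= L (f j * p ^+ 2))%R)
    (L_carleman : forall j : 'I_m,
       \sum_(1 <= n <oo) carleman_term (L (f j ^+ n)%R) n = +oo) :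
  moment_functional L /\
  (forall mu nu : {measure set (borelRn R d) -> \bar R},
     representing_measure L mu -> representing_measure L nu ->
     forall A : set (borelRn R d), measurable A -> mu A = nu A) /\
  (forall mu : {measure set (borelRn R d) -> \bar R},
     representing_measure L mu -> supported_on mu (semialgK f)).
Proof.
have f_dense := shift_pair_dense L_sqr_ge0 L_fsqr_ge0 L_carleman.
split; first exact: (carleman_moment_functional m_gt0 f_gen).
split; last by move=> mu; exact: carleman_supported.
by move=> mu nu; exact: (representing_unique f_gen L_sqr_ge0 f_dense).
Qed.
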